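(* Let $n \in \{7,8\}$ and let $K$ be an algebraically closed field of characteristic different from $2$. Then for every admissible element $f \in \operatorname{rad}^2 R(\mathbb{E}_n)$, the deformed preprojective algebra $P^f(\mathbb{E}_n)$ is isomorphic, as a $K$-algebra, to the preprojective algebra $P(\mathbb{E}_n)$.
   Context: Let $n \in \{6,7,8\}$ and let $K$ be an algebraically closed field. Paths in quivers are composed from left to right. The quiver $Q=Q_{\mathbb{E}_n}$ has vertices $0,1,\dots,n-1$ and arrows $a_0: 0\to 3$, $\bar a_0: 3\to 0$, and $a_i: i\to i+1$, $\bar a_i: i+1\to i$ for $i=1,\dots,n-2$. The preprojective algebra $P(\mathbb{E}_n)$ is the quotient of the path algebra $KQ$ by the ideal generated by the relations $a_0\bar a_0=0$; $a_1\bar a_1=0$; $\bar a_1a_1+a_2\bar a_2=0$; $\bar a_0a_0+\bar a_2a_2+a_3\bar a_3=0$; $\bar a_ia_i+a_{i+1}\bar a_{i+1}=0$ for $i\in\{3,\dots,n-3\}$; $\bar a_{n-2}a_{n-2}=0$. It is finite-dimensional; its longest nonzero paths have length $m$, where $m=10,16,28$ for $n=6,7,8$ respectively. Let $R(\mathbb{E}_n)=K\langle x,y\rangle/(x^2,y^3,(x+y)^{n-3})$, a quotient of the free associative algebra on $x,y$; it is a finite-dimensional local algebra (isomorphic to $e_3P(\mathbb{E}_n)e_3$, where $e_3$ is the trivial path at vertex $3$) with radical generated by $x,y$. An element $f\in \operatorname{rad}^2R(\mathbb{E}_n)$ is called admissible if $(x+y+f(x,y))^{n-3}=0$ in $R(\mathbb{E}_n)$.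 For an admissible $f$ (represented by a noncommutative polynomial in $x,y$ all of whose monomials have degree at least $2$), the deformed preprojective algebra $P^f(\mathbb{E}_n)$ is the bound quiver algebra of $Q$ with the relations $a_0\bar a_0=0$; $a_1\bar a_1=0$; $\bar a_1a_1+a_2\bar a_2=0$; $\bar a_0a_0+\bar a_2a_2+a_3\bar a_3+f(\bar a_0a_0,\bar a_2a_2)=0$; $\bar a_ia_i+a_{i+1}\bar a_{i+1}=0$ for $i\in\{3,\dots,n-3\}$; $\bar a_{n-2}a_{n-2}=0$. Being a bound quiver algebra, its arrow ideal is nilpotent: explicitly, $P^f(\mathbb{E}_n)$ is the quotient of $KQ$ by the ideal generated by these relations together with all paths of length $m+1$ (equivalently, the quotient of the completed path algebra by the closed ideal generated by the relations). *)

(* Defs.v *)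
From HB Require Import structures.
From mathcomp Require Import all_boot all_order all_algebra.
From mathcomp Require Import finmap generic_quotient ring_quotient.
From mathcomp Require Import boolp monalg.

Set Implicit Arguments.
Unset Strict Implicit.
Unset Printing Implicit Defensive.

Import GRing.Theory.

Local Open Scope ring_scope.
Local Open Scope quotient_scope.

(* The quotient of the algebra A by the two-sided ideal generated by S. As S is
   arbitrary, the quotient may be the zero ring, so it is a [pzRingType] and an
   [lmodType K] satisfying [pres_scalerAl] and [pres_scalerAr], but not an
   [algType K], for which ssralg requires 1 != 0. *)

Section Presentation.
Variables (K : fieldType) (A : algType K) (S : A -> Prop).

Definition in_ideal (x : A) : Prop :=
  exists (k : nat) (a s b : 'I_k -> A),
    (forall i, S (s i)) /\ x = \sum_i a i * s i * b i.

Lemma in_ideal0 : in_ideal 0.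
Proof.
by exists 0%N, (fun=> 0), (fun=> 0), (fun=> 0); split=> [[]//|]; rewrite big_ord0.
Qed.

Lemma in_idealD x y : in_ideal x -> in_ideal y -> in_ideal (x + y).
Proof.
move=> [k [a [s [b [Ss ->]]]]] [l [a' [s' [b' [Ss' ->]]]]].
pose g (T : Type) (u : 'I_k -> T) (v : 'I_l -> T) (i : 'I_(k + l)) :=
  match split i with inl j => u j | inr j => v j end.
exists (k + l)%N, (g _ a a'), (g _ s s'), (g _ b b'); split.
  by move=> i; rewrite /g; case: (split i).
rewrite big_split_ord /=; congr (_ + _); apply: eq_bigr => i _.
  by rewrite /g (unsplitK (inl i)).
by rewrite /g (unsplitK (inr i)).
Qed.

Lemma in_idealM c d x : in_ideal x -> in_ideal (c * x * d).
Proof.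
move=> [k [a [s [b [Ss ->]]]]].
exists k, (fun i => c * a i), s, (fun i => b i * d); split=> //.
by rewrite mulr_sumr mulr_suml; apply: eq_bigr => i _; rewrite !mulrA.
Qed.

Lemma in_idealMl c x : in_ideal x -> in_ideal (c * x).
Proof. by move/(in_idealM c 1); rewrite mulr1. Qed.

Lemma in_idealMr d x : in_ideal x -> in_ideal (x * d).
Proof. by move/(in_idealM 1 d); rewrite mul1r. Qed.

Lemma in_idealB x y : in_ideal x -> in_ideal y -> in_ideal (x - y).
Proof.
by move=> Ix Iy; apply: in_idealD => //; rewrite -mulN1r; apply: in_idealMl.
Qed.

Lemma in_idealZ (a : K) x : in_ideal x -> in_ideal (a *: x).
Proof. by rewrite -[x in a *: x]mul1r scalerAl; apply: in_idealMl. Qed.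

Definition ideal_pred : {pred A} := fun x => `[< in_ideal x >].

Lemma ideal_pred_closed : zmod_closed ideal_pred.
Proof.
split=> [|x y /asboolP Ix /asboolP Iy]; apply/asboolP; first exact: in_ideal0.
exact: in_idealB.
Qed.

HB.instance Definition _ := GRing.isZmodClosed.Build A ideal_pred
  ideal_pred_closed.

Definition presAlg := Quotient.quot ideal_pred.

HB.instance Definition _ := GRing.Zmodule.on presAlg.
HB.instance Definition _ : isZmodQuotient _ _ _ _ _ presAlg :=
  ZmodQuotient.on presAlg.

Lemma pres_eqP x y : reflect (in_ideal (x - y)) (x == y %[mod presAlg]).
Proof. by rewrite -Quotient.idealrBE; apply: asboolP. Qed.

Lemma pres_reprB x : in_ideal (repr (\pi_presAlg x) - x).
Proof. by apply/pres_eqP; rewrite reprK. Qed.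

Definition pres_one : presAlg := \pi_presAlg 1.
Definition pres_mul (p q : presAlg) : presAlg := \pi_presAlg (repr p * repr q).
Definition pres_scale (a : K) (p : presAlg) : presAlg :=
  \pi_presAlg (a *: repr p).

Lemma pres_mulE x y :
  pres_mul (\pi_presAlg x) (\pi_presAlg y) = \pi_presAlg (x * y).
Proof.
apply/eqP/pres_eqP.
have -> (x' y' : A) : x' * y' - x * y = (x' - x) * y' + x * (y' - y).
  by rewrite mulrBl mulrBr addrA subrK.
by apply: in_idealD; [apply: in_idealMr|apply: in_idealMl]; apply: pres_reprB.
Qed.

Lemma pres_scaleE a x : pres_scale a (\pi_presAlg x) = \pi_presAlg (a *: x).
Proof.
apply/eqP/pres_eqP; rewrite -scalerBr; apply: in_idealZ; exact: pres_reprB.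
Qed.

Lemma pres_addE x y : \pi_presAlg x + \pi_presAlg y = \pi_presAlg (x + y).
Proof. by rewrite !piE. Qed.

Lemma presW (P : presAlg -> Prop) :
  (forall x, P (\pi_presAlg x)) -> forall p, P p.
Proof. by move=> PP p; rewrite -[p]reprK. Qed.

Lemma pres_mulA : associative pres_mul.
Proof.
elim/presW=> x; elim/presW=> y; elim/presW=> z.
by rewrite !pres_mulE mulrA.
Qed.

Lemma pres_mul1 : left_id pres_one pres_mul.
Proof. by elim/presW=> x; rewrite pres_mulE mul1r. Qed.

Lemma pres_mulr1 : right_id pres_one pres_mul.
Proof. by elim/presW=> x; rewrite pres_mulE mulr1. Qed.

Lemma pres_mulDl : left_distributive pres_mul +%R.
Proof.
elim/presW=> x; elim/presW=> y; elim/presW=> z.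
by rewrite pres_addE !pres_mulE pres_addE mulrDl.
Qed.

Lemma pres_mulDr : right_distributive pres_mul +%R.
Proof.
elim/presW=> x; elim/presW=> y; elim/presW=> z.
by rewrite pres_addE !pres_mulE pres_addE mulrDr.
Qed.

HB.instance Definition _ := GRing.Zmodule_isPzRing.Build presAlg
  pres_mulA pres_mul1 pres_mulr1 pres_mulDl pres_mulDr.

Lemma pres_scaleA a b p : pres_scale a (pres_scale b p) = pres_scale (a * b) p.
Proof. by elim/presW: p => x; rewrite !pres_scaleE scalerA. Qed.

Lemma pres_scale1 : left_id 1 pres_scale.
Proof. by elim/presW=> x; rewrite pres_scaleE scale1r. Qed.

Lemma pres_scaleDr : right_distributive pres_scale +%R.
Proof.
move=> a; elim/presW=> x; elim/presW=> y.
by rewrite pres_addE !pres_scaleE pres_addE scalerDr.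
Qed.

Lemma pres_scaleDl p : {morph pres_scale^~ p : a b / a + b}.
Proof.
by move=> a b; elim/presW: p => x; rewrite !pres_scaleE pres_addE scalerDl.
Qed.

HB.instance Definition _ := GRing.Zmodule_isLmodule.Build K presAlg
  pres_scaleA pres_scale1 pres_scaleDr pres_scaleDl.

Lemma pres_scalerAl (a : K) (p q : presAlg) : a *: (p * q) = (a *: p) * q.
Proof.
elim/presW: p => x; elim/presW: q => y; rewrite -[LHS]/(pres_scale a (pres_mul _ _)).
rewrite -[RHS]/(pres_mul (pres_scale a _) _).
by rewrite pres_mulE !pres_scaleE pres_mulE scalerAl.
Qed.

Lemma pres_scalerAr (a : K) (p q : presAlg) : a *: (p * q) = p * (a *: q).
Proof.
elim/presW: p => x; elim/presW: q => y; rewrite -[LHS]/(pres_scale a (pres_mul _ _)).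
rewrite -[RHS]/(pres_mul _ (pres_scale a _)).
by rewrite pres_mulE !pres_scaleE pres_mulE scalerAr.
Qed.

End Presentation.

Section Radical.
Variable A : pzRingType.

Definition right_ideal (I : A -> Prop) : Prop :=
  [/\ I 0, forall x y, I x -> I y -> I (x + y) & forall x a, I x -> I (x * a)].

Definition maximal_right_ideal (I : A -> Prop) : Prop :=
  [/\ right_ideal I, ~ I 1 &
      forall J : A -> Prop, right_ideal J -> (forall x, I x -> J x) ->
        ~ J 1 -> forall x, J x -> I x].

Definition rad (x : A) : Prop :=
  forall I : A -> Prop, maximal_right_ideal I -> I x.

Definition rad2 (x : A) : Prop :=
  exists (k : nat) (u v : 'I_k -> A),
    (forall i, rad (u i) /\ rad (v i)) /\ x = \sum_i u i * v i.

End Radical.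

Record quiver := Quiver {
  vert : finType;
  vert_gt0 : (0 < #|vert|)%N;
  arr : finType;
  src : arr -> vert;
  tgt : arr -> vert
}.

Section Paths.
Variable Q : quiver.

Fixpoint walk (v : vert Q) (s : seq (arr Q)) : bool :=
  if s is a :: s' then (src a == v) && walk (tgt a) s' else true.

(* A path is its starting vertex together with its sequence of arrows, from
   left to right; the sequence is empty for the trivial paths. *)
Record qpath := QPath {
  qpath_val :> vert Q * seq (arr Q);
  qpathP : walk qpath_val.1 qpath_val.2
}.

HB.instance Definition _ := [isSub for qpath_val].
HB.instance Definition _ := [Choice of qpath by <:].

Definition qstart (p : qpath) : vert Q := p.1.
Definition qend (p : qpath) : vert Q := last p.1 [seq tgt a | a <- p.2].
Definition qlen (p : qpath) : nat := size p.2.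

Definition trivial_path (v : vert Q) : qpath := @QPath (v, [::]) isT.

Lemma arrow_path_subproof a : walk (src a) [:: a].
Proof. by rewrite /= eqxx. Qed.

Definition arrow_path (a : arr Q) : qpath :=
  @QPath (src a, [:: a]) (arrow_path_subproof a).

Definition qcat (p q : qpath) : option qpath :=
  if qend p == qstart q then insub (p.1, p.2 ++ q.2) else None.

Lemma walk_cat v s t :
  walk v (s ++ t) = walk v s && walk (last v [seq tgt a | a <- s]) t.
Proof. by elim: s v => //= a s IHs v; rewrite IHs andbA. Qed.

Lemma qcat_valid (p q : qpath) : qend p = qstart q -> walk p.1 (p.2 ++ q.2).
Proof. by move=> e; rewrite walk_cat qpathP -/(qend p) e qpathP. Qed.

Lemma qcatE (p q : qpath) (e : qend p = qstart q) :
  qcat p q = Some (@QPath (p.1, p.2 ++ q.2) (qcat_valid e)).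
Proof.
rewrite /qcat e eqxx; case: insubP => [u _ Eu|]; last by rewrite /= qcat_valid.
by congr Some; apply: val_inj.
Qed.

Lemma qcat_none (p q : qpath) : qend p <> qstart q -> qcat p q = None.
Proof. by rewrite /qcat => /eqP/negPf->. Qed.

Lemma qcatA p q r : obind (qcat p) (qcat q r) = obind (qcat^~ r) (qcat p q).
Proof.
have [e1|ne1] := eqVneq (qend p) (qstart q); last first.
  rewrite (qcat_none (p := p) (q := q)) /=; last exact/eqP.
  have [e2|ne2] := eqVneq (qend q) (qstart r).
    by rewrite (qcatE e2) /= qcat_none //; apply/eqP.
  by rewrite qcat_none //; apply/eqP.
rewrite (qcatE e1) /=.
have E : qend (@QPath (p.1, p.2 ++ q.2) (qcat_valid e1)) = qend q.
  by rewrite /qend /= map_cat last_cat -/(qend p) e1.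
have [e2|ne2] := eqVneq (qend q) (qstart r); last first.
  by rewrite !qcat_none //; apply/eqP => //; rewrite E.
have e3 : qend (@QPath (p.1, p.2 ++ q.2) (qcat_valid e1)) = qstart r.
  by rewrite E.
by rewrite (qcatE e2) (qcatE e3) /= qcatE; congr Some; apply: val_inj; rewrite /= catA.
Qed.

Lemma qcat_trivl v p : qcat (trivial_path v) p = if v == qstart p then Some p else None.
Proof.
have [e|ne] := eqVneq v (qstart p); last by rewrite qcat_none //; apply/eqP.
rewrite (@qcatE (trivial_path v) p e); congr Some; apply: val_inj => /=.
by rewrite e /qstart; case: (val p).
Qed.

Lemma qcat_trivr v p : qcat p (trivial_path v) = if v == qend p then Some p else None.
Proof.
have [e|ne] := eqVneq v (qend p); last first.
  by rewrite qcat_none //; apply/eqP; rewrite eq_sym.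
rewrite (@qcatE p (trivial_path v) (esym e)); congr Some; apply: val_inj => /=.
by rewrite cats0; case: (val p).
Qed.

End Paths.

Section PathAlgebra.
Variables (K : fieldType) (Q : quiver).

Definition pathAlg : Type := {malg K[qpath Q]}.

HB.instance Definition _ := GRing.Lmodule.on pathAlg.

Definition path_elt (p : qpath Q) : pathAlg := << p >>.

Definition pcat (c : K) (p q : qpath Q) : pathAlg :=
  if qcat p q is Some r then << c *g r >> else 0.

Definition palg_one : pathAlg := \sum_v path_elt (trivial_path v).

Definition palg_mul_def (f g : pathAlg) : pathAlg :=
  \sum_(p <- msupp f) \sum_(q <- msupp g) pcat (f@_p * g@_q) p q.

Fact palg_mul_key : unit. Proof. by []. Qed.
Definition palg_mul := locked_with palg_mul_key palg_mul_def.

Lemma palg_mulE (f g : pathAlg) : palg_mul f g =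
  \sum_(p <- msupp f) \sum_(q <- msupp g) pcat (f@_p * g@_q) p q.
Proof. by rewrite /palg_mul unlock. Qed.

Lemma pcat0 p q : pcat 0 p q = 0.
Proof. by rewrite /pcat; case: qcat => // r; rewrite monalgU0. Qed.

Lemma pcatD a b p q : pcat (a + b) p q = pcat a p q + pcat b p q.
Proof. by rewrite /pcat; case: qcat => [r|]; rewrite ?addr0 ?monalgUD. Qed.

Lemma palg_mulw (d1 d2 : {fset qpath Q}) (f g : pathAlg) :
  (msupp f `<=` d1)%fset -> (msupp g `<=` d2)%fset ->
  palg_mul f g = \sum_(p <- d1) \sum_(q <- d2) pcat (f@_p * g@_q) p q.
Proof.
move=> le1 le2; rewrite palg_mulE (big_fset_incl _ le1) /=.
  apply/eq_bigr => p _; apply/big_fset_incl => // q _ /mcoeff_outdom ->.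
  by rewrite mulr0 pcat0.
move=> p _ /mcoeff_outdom fp; rewrite big1 // => q _.
by rewrite fp mul0r pcat0.
Qed.

Lemma palg_mulDl : left_distributive palg_mul +%R.
Proof.
move=> f g h.
rewrite (palg_mulw (msuppD_le f g) (fsubset_refl (msupp h))).
rewrite (palg_mulw (fsubsetUl _ (msupp g)) (fsubset_refl (msupp h))).
rewrite (palg_mulw (fsubsetUr (msupp f) _) (fsubset_refl (msupp h))).
rewrite -big_split /=; apply: eq_bigr => p _.
rewrite -big_split /=; apply: eq_bigr => q _.
by rewrite mcoeffD mulrDl pcatD.
Qed.

Lemma palg_mulDr : right_distributive palg_mul +%R.
Proof.
move=> h f g.
rewrite (palg_mulw (fsubset_refl (msupp h)) (msuppD_le f g)).
rewrite (palg_mulw (fsubset_refl (msupp h)) (fsubsetUl _ (msupp g))).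
rewrite (palg_mulw (fsubset_refl (msupp h)) (fsubsetUr (msupp f) _)).
rewrite -big_split /=; apply: eq_bigr => p _.
rewrite -big_split /=; apply: eq_bigr => q _.
by rewrite mcoeffD mulrDr pcatD.
Qed.

Lemma palg_mul0 : right_zero 0 palg_mul.
Proof.
by move=> f; rewrite palg_mulE big1 // => p _; rewrite msupp0 big_seq_fset0.
Qed.

Lemma palg_0mul : left_zero 0 palg_mul.
Proof. by move=> f; rewrite palg_mulE msupp0 big_seq_fset0. Qed.

Lemma palg_mul_suml I (r : seq I) (F : I -> pathAlg) g :
  palg_mul (\sum_(i <- r) F i) g = \sum_(i <- r) palg_mul (F i) g.
Proof.
by apply: (big_morph (palg_mul^~ g)) => [x y|]; [apply: palg_mulDl|apply: palg_0mul].
Qed.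

Lemma palg_mul_sumr I (r : seq I) (F : I -> pathAlg) g :
  palg_mul g (\sum_(i <- r) F i) = \sum_(i <- r) palg_mul g (F i).
Proof.
by apply: (big_morph (palg_mul g)) => [x y|]; [apply: palg_mulDr|apply: palg_mul0].
Qed.

Lemma palg_mulUU a b p q :
  palg_mul << a *g p >> << b *g q >> = pcat (a * b) p q.
Proof.
rewrite (palg_mulw msuppU_le msuppU_le) !big_seq_fset1.
by rewrite !mcoeffUU.
Qed.

Lemma palg_ind (P : pathAlg -> Prop) :
  P 0 -> (forall f g, P f -> P g -> P (f + g)) ->
  (forall a p, P << a *g p >>) -> forall f, P f.
Proof.
move=> P0 PD PU f; rewrite [f]monalgE.
by elim/big_ind: _ => // p _; apply: PU.
Qed.

(* The bilinearity steps are stated for variables only: unification is very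
   slow on the terms << a *g p >>. *)
Let assoc f g h := palg_mul f (palg_mul g h) = palg_mul (palg_mul f g) h.

Let assoc0l g h : assoc 0 g h.
Proof. by rewrite /assoc !palg_0mul. Qed.

Let assoc0m f h : assoc f 0 h.
Proof. by rewrite /assoc palg_mul0 !palg_0mul palg_mul0. Qed.

Let assoc0r f g : assoc f g 0.
Proof. by rewrite /assoc !palg_mul0. Qed.

Let assocDl f1 f2 g h : assoc f1 g h -> assoc f2 g h -> assoc (f1 + f2) g h.
Proof. by rewrite /assoc !palg_mulDl => -> ->. Qed.

Let assocDm f g1 g2 h : assoc f g1 h -> assoc f g2 h -> assoc f (g1 + g2) h.
Proof. by rewrite /assoc palg_mulDr !palg_mulDl palg_mulDr => -> ->. Qed.

Let assocDr f g h1 h2 : assoc f g h1 -> assoc f g h2 -> assoc f g (h1 + h2).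
Proof. by rewrite /assoc !palg_mulDr => -> ->. Qed.

Let pcat_mulr a b p q r (u := << a *g p >> : pathAlg) :
  palg_mul u (pcat b q r) = oapp (pcat (a * b) p) 0 (qcat q r).
Proof.
by rewrite /pcat; case: (qcat q r) => [s|]; [exact: palg_mulUU|exact: palg_mul0].
Qed.

Let pcat_mull a b p q r (u := << b *g r >> : pathAlg) :
  palg_mul (pcat a p q) u = oapp (fun s => pcat (a * b) s r) 0 (qcat p q).
Proof.
by rewrite /pcat; case: (qcat p q) => [s|]; [exact: palg_mulUU|exact: palg_0mul].
Qed.

Let pcat_assoc a p q r :
  oapp (pcat a p) 0 (qcat q r) = oapp (fun s => pcat a s r) 0 (qcat p q).
Proof.
have := qcatA p q r; rewrite /pcat.
by case: (qcat q r) (qcat p q) => [u|] [v|] //= => [->|->|<-].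
Qed.

Let assocU a b c p q r : assoc << a *g p >> << b *g q >> << c *g r >>.
Proof.
apply: (etrans (congr1 _ (palg_mulUU b c q r))).
apply: (etrans (pcat_mulr a (b * c) p q r)); rewrite mulrA pcat_assoc.
apply: (etrans (esym (pcat_mull (a * b) c p q r))).
exact: (congr1 (palg_mul^~ _) (esym (palg_mulUU a b p q))).
Qed.

Lemma palg_mulA : associative palg_mul.
Proof.
move=> f g h; rewrite -/(assoc f g h).
elim/palg_ind: f => [|f1 f2|a p]; [exact: assoc0l|exact: assocDl|].
elim/palg_ind: g => [|g1 g2|b q]; [exact: assoc0m|exact: assocDm|].
elim/palg_ind: h => [|h1 h2|c r]; [exact: assoc0r|exact: assocDr|].
exact: assocU.
Qed.

Lemma palg_mul1 : left_id palg_one palg_mul.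
Proof.
move=> f; elim/palg_ind: f => [|f g IHf IHg|a p].
- exact: palg_mul0.
- by rewrite palg_mulDr IHf IHg.
rewrite palg_mul_suml (bigD1 (qstart p)) //= big1 => [|v nv].
  by rewrite palg_mulUU /pcat qcat_trivl eqxx mul1r addr0.
by rewrite palg_mulUU /pcat qcat_trivl (negPf nv).
Qed.

Lemma palg_mulr1 : right_id palg_one palg_mul.
Proof.
move=> f; elim/palg_ind: f => [|f g IHf IHg|a p].
- exact: palg_0mul.
- by rewrite palg_mulDl IHf IHg.
rewrite palg_mul_sumr (bigD1 (qend p)) //= big1 => [|v nv].
  by rewrite palg_mulUU /pcat qcat_trivr eqxx mulr1 addr0.
by rewrite palg_mulUU /pcat qcat_trivr (negPf nv).
Qed.

Lemma palg_one_neq0 : palg_one != 0.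
Proof.
have /card_gt0P[v _] := vert_gt0 Q; apply/eqP => /malgP/(_ (trivial_path v)).
rewrite raddf_sum (bigD1 v) //= big1 => [|u nu].
  by rewrite mcoeffU eqxx addr0 mcoeff0 => /eqP; rewrite oner_eq0.
rewrite mcoeffU -val_eqE /= xpair_eqE andbT.
by rewrite (negPf nu).
Qed.

HB.instance Definition _ := GRing.Zmodule_isNzRing.Build pathAlg
  palg_mulA palg_mul1 palg_mulr1 palg_mulDl palg_mulDr palg_one_neq0.

Lemma palg_scaleU (a b : K) p : a *: (<< b *g p >> : pathAlg) = << a * b *g p >>.
Proof.
apply/malgP => q; apply: (etrans (mcoeffZ a << b *g p >> q)).
apply: (etrans (congr1 _ (mcoeffU p b q))).
apply: etrans (esym (mcoeffU p (a * b) q)); exact: mulrnAr.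
Qed.

Lemma palg_scale_pcat (a b : K) p q : a *: pcat b p q = pcat (a * b) p q.
Proof. by rewrite /pcat; case: qcat => [r|]; rewrite ?scaler0 ?palg_scaleU. Qed.

Lemma palg_scalerAl (a : K) (f g : pathAlg) : a *: (f * g) = (a *: f) * g.
Proof.
elim/palg_ind: f => [|f1 f2 IH1 IH2|b p].
- by rewrite scaler0 !mul0r scaler0.
- by rewrite mulrDl !scalerDr mulrDl IH1 IH2.
elim/palg_ind: g => [|g1 g2 IH1 IH2|c q].
- by rewrite !mulr0 scaler0.
- by rewrite !mulrDr scalerDr IH1 IH2.
rewrite palg_scaleU.
apply: (etrans (congr1 _ (palg_mulUU b c p q))).
rewrite palg_scale_pcat mulrA; exact: (esym (palg_mulUU (a * b) c p q)).
Qed.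

Lemma palg_scalerAr (a : K) (f g : pathAlg) : a *: (f * g) = f * (a *: g).
Proof.
elim/palg_ind: f => [|f1 f2 IH1 IH2|b p].
- by rewrite !mul0r scaler0.
- by rewrite !mulrDl !scalerDr IH1 IH2.
elim/palg_ind: g => [|g1 g2 IH1 IH2|c q].
- by rewrite scaler0 !mulr0 scaler0.
- by rewrite mulrDr !scalerDr mulrDr IH1 IH2.
rewrite palg_scaleU.
apply: (etrans (congr1 _ (palg_mulUU b c p q))).
rewrite palg_scale_pcat mulrCA; exact: (esym (palg_mulUU b (a * c) p q)).
Qed.

HB.instance Definition _ := GRing.Lmodule_isLalgebra.Build K pathAlg
  palg_scalerAl.
HB.instance Definition _ := GRing.Lalgebra_isAlgebra.Build K pathAlg
  palg_scalerAr.

End PathAlgebra.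

Section FreeAlgebra.
Variable K : fieldType.

(* The letter [false] stands for x and the letter [true] for y. *)
Definition freeAlg : Type := {malg K[{fmonom bool}]}.

HB.instance Definition _ := GRing.Lalgebra.on freeAlg.

Lemma freeAlg_scalerAr (a : K) (f g : freeAlg) : a *: (f * g) = f * (a *: g).
Proof.
apply/malgP => k; rewrite mcoeffZ.
apply: (etrans (congr1 ( *%R a) (mcoeffMl f g k))).
rewrite (mcoeffMlw k (fsubset_refl (msupp f)) (msuppZ_le a g)) mulr_sumr.
apply: eq_bigr => p _; rewrite mulr_sumr; apply: eq_bigr => q _.
by rewrite mcoeffZ mulrnAr mulrCA.
Qed.

HB.instance Definition _ := GRing.Lalgebra_isAlgebra.Build K freeAlg
  freeAlg_scalerAr.

Definition freeX : freeAlg := << fmu false >>.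
Definition freeY : freeAlg := << fmu true >>.

(* The empty word is evaluated to 1; this plays no role for polynomials without
   constant term. *)
Definition free_eval (A : algType K) (u v : A) (F : freeAlg) : A :=
  \sum_(w <- msupp F) F@_w *: \prod_(l <- (w : seq bool)) (if l then v else u).

Definition monomials_deg_ge2 (F : freeAlg) : Prop :=
  forall w, w \in msupp F -> (2 <= fdeg w)%N.

End FreeAlgebra.

Arguments freeX {K}.
Arguments freeY {K}.

Section TypeE.
Variables (n : nat) (K : fieldType).

(* For n > 0 the vertices 0, ..., n - 1 are the elements of 'I_n.-1.+1. The
   arrow (i, false) is a_i and the arrow (i, true) is its reverse. *)
Definition E_low (i : 'I_n.-1) : 'I_n.-1.+1 := inord i.

Definition E_high (i : 'I_n.-1) : 'I_n.-1.+1 :=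
  inord (if i == 0%N :> nat then 3%N else i.+1).

Lemma E_vert_gt0 : (0 < #|'I_n.-1.+1|)%N.
Proof. by rewrite card_ord. Qed.

Definition QE : quiver := @Quiver 'I_n.-1.+1 E_vert_gt0 ('I_n.-1 * bool)%type
  (fun e => if e.2 then E_high e.1 else E_low e.1)
  (fun e => if e.2 then E_low e.1 else E_high e.1).

Local Notation KQ := (pathAlg K QE).

(* Zero when i > n - 2, where there is no such arrow. *)
Definition E_arrow (rev : bool) (i : nat) : KQ :=
  if insub i : option 'I_n.-1 is Some j
  then path_elt K (@arrow_path QE (j, rev)) else 0.

Local Notation a := (E_arrow false).
Local Notation a' := (E_arrow true).

(* The relations, with an extra term [phi] at the vertex 3. *)
Inductive E_relation (phi : KQ) : KQ -> Prop :=
| E_rel0 : E_relation phi (a 0 * a' 0)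
| E_rel1 : E_relation phi (a 1 * a' 1)
| E_rel2 : E_relation phi (a' 1 * a 1 + a 2 * a' 2)
| E_rel3 : E_relation phi (a' 0 * a 0 + a' 2 * a 2 + a 3 * a' 3 + phi)
| E_reli (i : nat) : (3 <= i <= n - 3)%N ->
    E_relation phi (a' i * a i + a i.+1 * a' i.+1)
| E_reln : E_relation phi (a' (n - 2) * a (n - 2)).

Definition preprojE := presAlg (E_relation 0).

HB.instance Definition _ := GRing.PzRing.on preprojE.
HB.instance Definition _ := GRing.Lmodule.on preprojE.

(* The length of the longest nonzero paths of P(E_n), for n = 6, 7, 8. *)
Definition E_max_length : nat :=
  if n == 6%N then 10%N else if n == 7%N then 16%N else 28%N.

Inductive deformed_relation (F : freeAlg K) : KQ -> Prop :=
| def_rel r : E_relation (free_eval (a' 0 * a 0) (a' 2 * a 2) F) r ->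
    deformed_relation F r
| def_path p : qlen p = E_max_length.+1 -> deformed_relation F (path_elt K p).

Definition deformed_preprojE (F : freeAlg K) :=
  presAlg (deformed_relation F).

HB.instance Definition _ (F : freeAlg K) := GRing.PzRing.on (deformed_preprojE F).
HB.instance Definition _ (F : freeAlg K) := GRing.Lmodule.on (deformed_preprojE F).

Inductive RE_relation : freeAlg K -> Prop :=
| RE_relx : RE_relation (freeX ^+ 2)
| RE_rely : RE_relation (freeY ^+ 3)
| RE_relxy : RE_relation ((freeX + freeY) ^+ (n - 3)).

Definition RE := presAlg RE_relation.

HB.instance Definition _ := GRing.PzRing.on RE.
HB.instance Definition _ := GRing.Lmodule.on RE.

Definition RE_pi (F : freeAlg K) : RE := \pi_(presAlg RE_relation) F.

Definition admissible (f : RE) : Prop :=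
  rad2 f /\ (RE_pi freeX + RE_pi freeY + f) ^+ (n - 3) = 0.

End TypeE.

Arguments preprojE n K : clear implicits.
Arguments deformed_preprojE n {K} F.
Arguments RE n K : clear implicits.

(* Main.v *)
(* Put z = x + y in R = R(E_n) and N = n - 3.  If (z + f)^N = 0 and f agrees up
   to higher order with u z g(z) u^-1 - z, where u is unipotent and g(0) = 1, then
   the leading term h of the difference lies in the kernel of
   h |-> sum_i z^i h z^(N-1-i).  In small degrees this kernel is [z, R] + K z^d, so
   u and g can be corrected.  In the remaining degrees R_d = [x, R] + [y, R] once
   2 is invertible, so conjugating x and y removes the difference.  This gives
   unipotent p, q, u and g with g(0) = 1 such that
     X + Y + f(X, Y) = u z g(z) u^-1,  X = p x p^-1,  Y = q y q^-1.
   Multiplying the arrows of P(E_n) on the left and right by suitable p, q, u and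
   values of g then gives elements that satisfy the relations of P^f(E_n).  The map
   P^f(E_n) -> P(E_n) so obtained is the identity on leading terms for the path
   length, and P(E_n) is graded and vanishes in degrees above m, so it is bijective.
   The statements about R and the vanishing above degree m are verified by
   noncommutative Groebner bases over the integers. *)

Require Import Defs.
From HB Require Import structures.
From mathcomp Require Import all_boot all_order all_algebra.
From mathcomp Require Import finmap generic_quotient ring_quotient.
From mathcomp Require Import boolp monalg zify.
From Stdlib Require Ncring Ncring_tac.

Set Implicit Arguments.
Unset Strict Implicit.
Unset Printing Implicit Defensive.

Import GRing.Theory.

Local Open Scope ring_scope.

(** Two kinds of correction are combined because each fails in part of the range. Commutators with x
    and y do not span the low degrees: in degree 2 they give only the multiples of xy - yx. In high
    degrees the condition on the N-th power says nothing, since sum_i z^i h z^(N-1-i) lies beyond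
    the top degree of R. The degree [d0] at which the method changes lies in between. The equation
    is solved in R, but the solution is needed in P(E_n). It is therefore kept as formal
    combinations of words, which can be evaluated at any two elements that satisfy the relations of
    R. The values commute with all vertex idempotents and are invertible in the whole of P(E_n), so
    arrows may be multiplied by them. Injectivity rests on the fact that the relations of P^f(E_n)
    have those of P(E_n) as leading forms: an element of the kernel can be pushed to longer and
    longer paths. The computations differ in strength. For R the normal form must be well defined on
    R, because the statement on the kernel uses a linear map prescribed on normal words; for P(E_n)
    it suffices that paths of length m + 1 reduce to zero. *)

Instance nc_ops (A : pzRingType) : @Ncring.Ring_ops A 0 1 +%R *%R (fun x y => x - y) -%R eq := {}.
Instance nc_ring (A : pzRingType) : @Ncring.Ring A 0 1 +%R *%R (fun x y => x - y) -%R eq (nc_ops A).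
Proof.
split; try exact: _; move=> *.
- exact (add0r _).
- exact (addrC _ _).
- exact (addrA _ _ _).
- exact (mul1r _).
- exact (mulr1 _).
- exact (mulrA _ _ _).
- exact (mulrDl _ _ _).
- exact (mulrDr _ _ _).
- exact (subrr _).
Qed.
Ltac ncring := Ncring_tac.non_commutative_ring.

(** * Rewriting of words *)

(* The last letter comes first: see [evw]. *)
Definition word := seq nat.
Definition zpoly := seq (int * word).

Fixpoint weq (u v : word) : bool :=
  match u, v with
  | [::], [::] => true
  | a :: u', b :: v' => eqn a b && weq u' v'
  | _, _ => false
  end.

Fixpoint strip (u w : word) : option word :=
  match u, w with
  | [::], _ => Some w
  | a :: u', b :: w' => if eqn a b then strip u' w' else None
  | _, [::] => None
  end.

Fixpoint zins (c : int) (w : word) (p : zpoly) : zpoly :=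
  match p with
  | [::] => if c is Posz 0 then [::] else [:: (c, w)]
  | (c', w') :: p' =>
      if weq w w' then
        let s := intZmod.addz c c' in if s is Posz 0 then p' else (s, w') :: p'
      else (c', w') :: zins c w p'
  end.

Definition zadd (p q : zpoly) : zpoly := foldr (fun m r => zins m.1 m.2 r) q p.
Definition zscale (c : int) (p : zpoly) : zpoly :=
  [seq (intRing.mulz c m.1, m.2) | m <- p].
Definition zcomb (f : word -> zpoly) (p : zpoly) : zpoly :=
  foldr (fun m r => zadd (zscale m.1 (f m.2)) r) [::] p.
Definition zcat (p : zpoly) (w : word) : zpoly := [seq (m.1, m.2 ++ w) | m <- p].
Definition zcatl (w : word) (p : zpoly) : zpoly := [seq (m.1, w ++ m.2) | m <- p].

Definition rule := (word * zpoly)%type.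

(** A left-hand side is matched only at the head of the list, which is the end of the word: after a
    letter is appended to a normal word, every redex ends in that letter. *)
Fixpoint find_rule (rs : seq rule) (w : word) : option (word * zpoly) :=
  match rs with
  | [::] => None
  | (u, t) :: rs' => if strip u w is Some v then Some (v, t) else find_rule rs' w
  end.

Fixpoint nfmul (f : word -> nat -> zpoly) (p : zpoly) (w : word) : zpoly :=
  match w with
  | [::] => p
  | l :: w' => zcomb (f^~ l) (nfmul f p w')
  end.

(* The normal form of [w * l] for a normal word [w].  A result that is not fully
   reduced because [fuel] runs out still has the right value: see [ev_step]. *)
Fixpoint step (fuel : nat) (rs : seq rule) (w : word) (l : nat) : zpoly :=
  match fuel with
  | 0 => [:: (Posz 1, l :: w)]
  | fuel'.+1 =>
      if find_rule rs (l :: w) is Some (v, t) then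
        zcomb (nfmul (step fuel' rs) [:: (Posz 1, v)]) t
      else [:: (Posz 1, l :: w)]
  end.

Definition fuel := 60%N.

Definition nf (rs : seq rule) (p : zpoly) : zpoly :=
  zcomb (nfmul (step fuel rs) [:: (Posz 1, [::])]) p.

(** Lexicographic order in which the first letter of the word, the end of the list, counts most. The
    relations are homogeneous, so words of equal length are compared and [None] means equality. *)
Fixpoint wlt (u v : word) : option bool :=
  match u, v with
  | a :: u', b :: v' =>
      if wlt u' v' is Some c then Some c
      else if eqn a b then None else Some (ltn a b)
  | _, _ => None
  end.

Fixpoint lead (m : int * word) (p : zpoly) : (int * word) :=
  match p with
  | [::] => m
  | m' :: p' => lead (if wlt m.2 m'.2 is Some true then m' else m) p'
  end.

(** An element becomes a rule only if its leading coefficient is 1 or -1, so that rewriting never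
    divides and stays valid in every characteristic. Other elements are discarded, which is
    sound. *)
Definition add_rule (rs : seq rule) (p : zpoly) : seq rule :=
  match nf rs p with
  | [::] => rs
  | m :: p' =>
    let: (c, w) := lead m p' in
    if c is Posz 1 then rcons rs (w, zscale (Negz 0) (zins (Negz 0) w (m :: p')))
    else if c is Negz 0 then rcons rs (w, zins (Posz 1) w (m :: p'))
    else rs
  end.

(* S-polynomial of the overlap of length [k] between the left-hand sides of the
   rules [i] and [j]. *)
Definition spoly (rs : seq rule) (i j k : nat) : zpoly :=
  let: (s, ti) := nth ([::], [:: (Posz 1, [::])]) rs i in
  let: (t, tj) := nth ([::], [:: (Posz 1, [::])]) rs j in
  let v := take (size t - k) t in
  let u := drop k s in
  if weq (v ++ s) (t ++ u) then zadd (zcatl v ti) (zscale (Negz 0) (zcat tj u))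
  else [::].

(** The list [ds] names the overlaps to resolve, in order; an index may point to a rule created by
    an earlier overlap. The result is sound for every list. *)
Definition rules (rels : seq zpoly) (ds : seq (nat * nat * nat)) : seq rule :=
  foldl (fun rs d => add_rule rs (spoly rs d.1.1 d.1.2 d.2))
    (foldl add_rule [::] rels) ds.

Definition wmem (w : word) (ws : seq word) : bool := has (weq w) ws.
Fixpoint wundup (ws : seq word) : seq word :=
  if ws is w :: ws' then let r := wundup ws' in if wmem w r then r else w :: r
  else [::].
(** If [ws] spans the part of degree d, the words found here span the part of degree d + 1, provided
    that the products excluded by [comp] vanish. *)
Definition next (f : word -> nat -> zpoly) (comp : word -> nat -> bool) (k : nat)
  (ws : seq word) : seq word :=
  wundup (flatten [seq flatten [seq [seq m.2 | m <- f w l] | l <- iota 0 k & comp w l] | w <- ws]).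

Lemma weqE u v : weq u v = (u == v).
Proof. by elim: u v => [|a u IH] [|b v] //=; rewrite IH. Qed.

Lemma stripP u w v : strip u w = Some v -> w = u ++ v.
Proof.
elim: u w => [|a u IH] [|b w] //=; try by case=> ->.
by rewrite eqnE; case: eqP => // -> /IH ->.
Qed.

(** * Values of integral combinations of words *)

Section Combination.
Variables (V : zmodType) (f : word -> V).

(** The values lie in an arbitrary abelian group, since evaluation in an algebra, coordinate vectors
    and linear maps prescribed on normal words all have this form. *)
Definition evm (p : zpoly) : V := \sum_(m <- p) f m.2 *~ m.1.

Lemma evm_cons m p : evm (m :: p) = f m.2 *~ m.1 + evm p.
Proof. exact: big_cons. Qed.

Lemma evm_nil : evm [::] = 0.
Proof. exact: big_nil. Qed.

Lemma evm_cat p q : evm (p ++ q) = evm p + evm q.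
Proof. exact: big_cat. Qed.

Lemma evm_word w : evm [:: (Posz 1, w)] = f w.
Proof. by rewrite evm_cons evm_nil addr0. Qed.

Lemma evm_zins c w p : evm (zins c w p) = f w *~ c + evm p.
Proof.
elim: p => [|[c' w'] p IH] /=.
  by case: c => [[|c]|c]; rewrite ?evm_cons ?evm_nil ?mulr0z ?addr0.
rewrite weqE; case: eqP => [->|_]; last by rewrite !evm_cons IH addrCA.
rewrite evm_cons /= addrA -mulrzDr -[c + c']/(intZmod.addz c c').
by case: (intZmod.addz c c') => [[|s]|s]; rewrite ?evm_cons ?mulr0z ?add0r.
Qed.

Lemma evm_zadd p q : evm (zadd p q) = evm p + evm q.
Proof.
elim: p => [|m p IH]; first by rewrite evm_nil add0r.
by rewrite evm_cons /= evm_zins IH addrA.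
Qed.

Lemma evm_zscale c p : evm (zscale c p) = evm p *~ c.
Proof.
elim: p => [|m p IH]; first by rewrite evm_nil mul0rz.
by rewrite /= !evm_cons IH mulrzDl /= -mulrzA mulrC.
Qed.

Lemma evm_zcomb g p : evm (zcomb g p) = \sum_(m <- p) evm (g m.2) *~ m.1.
Proof.
elim: p => [|m p IH]; first by rewrite evm_nil big_nil.
by rewrite big_cons /= evm_zadd evm_zscale IH.
Qed.
End Combination.

Definition supp_in (ws : seq word) (p : zpoly) : bool := all (fun m => m.2 \in ws) p.

Lemma supp_in_zadd ws p q : supp_in ws p -> supp_in ws q -> supp_in ws (zadd p q).
Proof.
move=> + qin; elim: p => //= -[c w] p IH /= /andP[win /IH].
elim: (zadd p q) => [|[c' w'] r IHr] /= => [_|/andP[w'in rin]].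
  by case: c win => [[|c]|c] //= ->.
case: weq; last by rewrite /= w'in IHr.
by case: (intZmod.addz c c') => [[|s]|s] //=; rewrite w'in.
Qed.

Lemma supp_in_zcomb ws ws' g p : {in ws, forall w, supp_in ws' (g w)} ->
  supp_in ws p -> supp_in ws' (zcomb g p).
Proof.
move=> gin; elim: p => //= m p IH /andP[/gin gm /IH]; apply: supp_in_zadd.
by rewrite /supp_in all_map.
Qed.

Section Evaluation.
Variables (A : pzRingType) (env : nat -> A).

Fixpoint evw (w : word) : A := if w is l :: w' then evw w' * env l else 1.
Local Notation ev := (evm evw).

Lemma evw_cat u v : evw (u ++ v) = evw v * evw u.
Proof. by elim: u => [|l u IH] /=; rewrite ?mulr1 // IH mulrA. Qed.

Lemma ev_zcombM f p a : (forall w, ev (f w) = evw w * a) ->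
  ev (zcomb f p) = ev p * a.
Proof.
move=> fE; rewrite evm_zcomb [in RHS]/evm mulr_suml; apply: eq_bigr => m _.
by rewrite fE mulrzAl.
Qed.

Lemma ev_zcat p w : ev (zcat p w) = evw w * ev p.
Proof.
rewrite /evm big_map mulr_sumr; apply: eq_bigr => m _ /=.
by rewrite evw_cat mulrzAr.
Qed.

Lemma ev_zcatl p w : ev (zcatl w p) = ev p * evw w.
Proof.
rewrite /evm big_map mulr_suml; apply: eq_bigr => m _ /=.
by rewrite evw_cat mulrzAl.
Qed.

Definition valid (rs : seq rule) : Prop :=
  forall r, r \in rs -> evw r.1 = ev r.2.

Lemma find_ruleP rs w v t : valid rs ->
  find_rule rs w = Some (v, t) -> evw w = evw v * ev t.
Proof.
elim: rs => //= -[u s] rs IH rsP; case E: (strip u w) => [v'|].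
  case=> <- <-; rewrite (stripP E) evw_cat; congr (_ * _).
  by rewrite (rsP _ (mem_head _ _)).
by apply: IH => r rin; apply: rsP; rewrite inE rin orbT.
Qed.

Lemma ev_nfmul f p w : (forall v l, ev (f v l) = evw v * env l) ->
  ev (nfmul f p w) = ev p * evw w.
Proof.
move=> fE; elim: w => [|l w IH] /=; first by rewrite mulr1.
by rewrite (ev_zcombM _ (fE^~ l)) IH mulrA.
Qed.

Lemma ev_step fuel rs w l : valid rs -> ev (step fuel rs w l) = evw w * env l.
Proof.
move=> rsP; elim: fuel w l => [|fuel IH] w l /=; first exact: evm_word.
case E: find_rule => [[v t]|]; last exact: evm_word.
rewrite -[RHS]/(evw (l :: w)) (find_ruleP rsP E) evm_zcomb [in RHS]/evm mulr_sumr.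
by apply: eq_bigr => m _; rewrite ev_nfmul // evm_word mulrzAr.
Qed.

Lemma ev_nf rs p : valid rs -> ev (nf rs p) = ev p.
Proof.
move=> rsP; rewrite evm_zcomb; apply: eq_bigr => m _.
by rewrite ev_nfmul ?evm_word ?mul1r // => v l; apply: ev_step.
Qed.

Lemma valid_rcons rs r : valid rs -> evw r.1 = ev r.2 -> valid (rcons rs r).
Proof. by move=> rsP rP s; rewrite mem_rcons inE => /orP[/eqP->|/rsP]. Qed.

Lemma add_ruleP rs p : valid rs -> ev p = 0 -> valid (add_rule rs p).
Proof.
move=> rsP p0; rewrite /add_rule; have := ev_nf p rsP; rewrite p0.
case: (nf rs p) => [//|m q] q0; case: (lead m q) => [[[|[|c]]|[|c]] w] //;
  apply: valid_rcons => //; rewrite -[LHS]/(evw w) -[(_, _).2]/(_ : zpoly);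
  rewrite ?evm_zscale evm_zins q0 addr0 //.
by rewrite NegzE mulrNz mulr1z mulrNz mulr1z opprK.
Qed.

Lemma ev_spoly rs i j k : valid rs -> ev (spoly rs i j k) = 0.
Proof.
move=> rsP; rewrite /spoly.
(* The default rule rewrites the empty word to itself, so indices out of range are harmless. *)
have nthP (i' : nat) (r := nth ([::], [:: (Posz 1, [::])]) rs i') :
    evw r.1 = ev r.2.
  rewrite {}/r; case: (ltnP i' (size rs)) => [lt|ge]; first exact/rsP/mem_nth.
  by rewrite nth_default //= evm_word.
case: (nth _ rs i) (nthP i) => s ti /= sE; case: (nth _ rs j) (nthP j) => t tj /= tE.
rewrite weqE; case: eqP => [E|_]; last exact: evm_nil.
rewrite evm_zadd evm_zscale ev_zcatl ev_zcat -sE -tE -!evw_cat E.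
by rewrite NegzE mulrNz mulr1z subrr.
Qed.

Lemma rulesP rels ds : (forall p, p \in rels -> ev p = 0) ->
  valid (rules rels ds).
Proof.
move=> relsP; rewrite /rules.
have: valid (foldl add_rule [::] rels).
  have: valid [::] by [].
  elim: rels [::] relsP => //= p rels IH rs relsP rsP; apply: IH.
    by move=> q qin; apply: relsP; rewrite inE qin orbT.
  by apply: add_ruleP => //; apply: relsP; rewrite mem_head.
elim: ds (foldl _ _ _) => //= d ds IH rs rsP; apply: IH.
by apply: add_ruleP => //; apply: ev_spoly.
Qed.

Lemma zero_nf rs p : valid rs -> nilp (nf rs p) -> ev p = 0.
Proof. by move=> rsP /nilP E; rewrite -(ev_nf p rsP) E evm_nil. Qed.

Definition inspan (ws : seq word) (a : A) : Prop :=
  exists2 p : zpoly, supp_in ws p & a = ev p.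

Lemma mem_wundup ws : wundup ws =i ws.
Proof.
elim: ws => //= w ws IH v; rewrite inE.
have memE (us : seq word) : wmem w us = (w \in us).
  by rewrite /wmem -has_pred1; apply: eq_has => u /=; rewrite weqE eq_sym.
rewrite memE IH; case: ifP => [wws|_]; last by rewrite inE IH.
by rewrite IH; case: eqP => // ->.
Qed.

Lemma supp_in_next f (comp : word -> nat -> bool) k (ws : seq word) l w :
  (l < k)%N -> w \in ws -> comp w l -> supp_in (next f comp k ws) (f w l).
Proof.
move=> ltlk win cwl; apply/allP => m min; rewrite mem_wundup; apply/flattenP.
eexists; first by apply/mapP; exists w.
apply/flattenP; exists [seq m'.2 | m' <- f w l]; last exact: map_f.
by apply/mapP; exists l; rewrite // mem_filter cwl mem_iota.
Qed.

Lemma inspan_next f (comp : word -> nat -> bool) k (ws : seq word) a l :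
  (forall v l, ev (f v l) = evw v * env l) ->
  (forall v, v \in ws -> ~~ comp v l -> evw v * env l = 0) -> (l < k)%N ->
  inspan ws a -> inspan (next f comp k ws) (a * env l).
Proof.
move=> fE cE ltlk [p pin ->].
exists (zcomb (fun w => if comp w l then f w l else [::]) p).
  apply: supp_in_zcomb pin => w win; case: ifP => // cwl; exact: supp_in_next.
rewrite evm_zcomb mulr_suml big_seq [RHS]big_seq; apply: eq_bigr => m min.
rewrite mulrzAl; case: ifP => [_|/negbT cm]; first by rewrite fE.
by rewrite evm_nil cE // (allP pin).
Qed.
End Evaluation.

(** * Presented algebras *)

Section QuotientScope.
Local Open Scope quotient_scope.

Section NonzeroPresentation.
Variables (K : fieldType) (A : algType K) (S : A -> Prop).

Lemma gen_in_ideal x : S x -> in_ideal S x.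
Proof.
move=> Sx; exists 1%N, (fun=> 1), (fun=> x), (fun=> 1); split=> //.
by rewrite big_ord1 mul1r mulr1.
Qed.

Lemma in_ideal_sub (I : A -> Prop) :
  I 0 -> (forall x y, I x -> I y -> I (x + y)) ->
  (forall a s b, S s -> I (a * s * b)) -> forall x, in_ideal S x -> I x.
Proof.
move=> I0 ID IM x [k [a [s [b [Ss ->]]]]].
by elim/big_ind: _ => // i _; apply: IM.
Qed.

Lemma in_ideal_ker (B : pzRingType) (f : {rmorphism A -> B}) :
  (forall s, S s -> f s = 0) -> forall x, in_ideal S x -> f x = 0.
Proof.
move=> fS; apply: in_ideal_sub => [|x y fx fy|a s b /fS fs].
- exact: rmorph0.
- by rewrite rmorphD fx fy addr0.
- by rewrite !rmorphM fs mulr0 mul0r.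
Qed.

(** The proof that the ideal is proper is an argument of the type, so that the quotient can carry an
    [algType] structure, which includes 1 != 0. *)
Definition nzpres of ~ in_ideal S 1 := presAlg S.

Variable S1 : ~ in_ideal S 1.
Local Notation B := (nzpres S1).

HB.instance Definition _ := GRing.PzRing.on B.
HB.instance Definition _ := GRing.Lmodule.on B.

Lemma nzpres_neq0 : 1 != 0 :> B.
Proof.
apply/negP => /eqP E; apply: S1; rewrite -[X in in_ideal S X]subr0.
apply/pres_eqP/eqP; rewrite -[LHS]/(1 : B) E.
by apply/esym; rewrite -[0 : B]/(0 : presAlg S) piE.
Qed.

HB.instance Definition _ := GRing.PzSemiRing_isNonZero.Build B nzpres_neq0.
HB.instance Definition _ := GRing.Lmodule_isLalgebra.Build K B
  (@pres_scalerAl K A S).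
HB.instance Definition _ := GRing.Lalgebra_isAlgebra.Build K B
  (@pres_scalerAr K A S).

Definition npi (x : A) : B := \pi_(presAlg S) x.

Lemma npi_is_linear : linear npi.
Proof.
move=> a x y; rewrite /npi -[a *: _ in RHS]/(pres_scale a (\pi_(presAlg S) x)).
rewrite pres_scaleE; exact: esym (pres_addE S _ _).
Qed.
HB.instance Definition _ := GRing.isLinear.Build K A B *:%R npi npi_is_linear.

Lemma npi_is_monoid_morphism : monoid_morphism npi.
Proof. by split=> // x y; apply: esym; apply: pres_mulE. Qed.
HB.instance Definition _ := GRing.isMonoidMorphism.Build A B npi
  npi_is_monoid_morphism.

Lemma npi_eq0 x : npi x = 0 <-> in_ideal S x.
Proof.
rewrite -[X in _ <-> in_ideal S X]subr0; split.
  move=> E; apply/pres_eqP/eqP; apply: etrans E _.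
  exact: (esym (rmorph0 npi)).
by move/pres_eqP/eqP=> E; rewrite -(rmorph0 npi); exact: E.
Qed.

Lemma npiP (P : B -> Prop) : (forall x, P (npi x)) -> forall b, P b.
Proof. exact: presW. Qed.

Section Lift.
Variables (C : algType K) (f : {lrmorphism A -> C}).
Hypothesis fS : forall s, S s -> f s = 0.

Definition nlift of (forall s, S s -> f s = 0) := fun b : B => f (repr (b : presAlg S)) : C.

Lemma nliftE x : nlift fS (npi x) = f x.
Proof.
apply/eqP; rewrite -subr_eq0 /nlift -rmorphB; apply/eqP.
apply: in_ideal_ker fS _ _; exact: pres_reprB.
Qed.

Lemma nlift_is_linear : linear (nlift fS).
Proof.
move=> a; elim/npiP=> x; elim/npiP=> y.
by rewrite -linearP !nliftE linearP.
Qed.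
HB.instance Definition _ := GRing.isLinear.Build K B C *:%R (nlift fS) nlift_is_linear.

Lemma nlift_is_monoid_morphism : monoid_morphism (nlift fS).
Proof.
split; first by rewrite -(rmorph1 npi) nliftE rmorph1.
by elim/npiP=> x; elim/npiP=> y; rewrite -rmorphM !nliftE rmorphM.
Qed.
HB.instance Definition _ := GRing.isMonoidMorphism.Build B C (nlift fS)
  nlift_is_monoid_morphism.
End Lift.

End NonzeroPresentation.

End QuotientScope.

Arguments nlift : simpl never.

(** * Evaluation of noncommutative polynomials *)

Section FreeAlgebra.
Variables (K : fieldType).
Local Notation FA := (freeAlg K).

Lemma free_ind (P : FA -> Prop) :
  P 0 -> (forall f g, P f -> P g -> P (f + g)) ->
  (forall a w, P << a *g w >>) -> forall f, P f.
Proof.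
by move=> P0 PD PU f; rewrite [f]monalgE; elim/big_ind: _ => // w _; apply: PU.
Qed.

Variables (A : algType K) (u v : A).
Local Notation wd w := (\prod_(l <- (w : seq bool)) (if l then v else u)).

Lemma free_evalU a (w : {fmonom bool}) : free_eval u v << a *g w >> = a *: wd w.
Proof.
rewrite /free_eval msuppU; case: eqP => [->|_].
  by rewrite big_seq_fset0 scale0r.
by rewrite big_seq_fset1 mcoeffUU.
Qed.

Lemma free_evalEw (d : {fset {fmonom bool}}) (F : FA) : (msupp F `<=` d)%fset ->
  free_eval u v F = \sum_(w <- d) F@_w *: wd w.
Proof.
move=> le; rewrite /free_eval (big_fset_incl _ le) //= => w _ /mcoeff_outdom->.
by rewrite scale0r.
Qed.

Lemma free_eval_is_linear : linear (free_eval u v).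
Proof.
move=> a F G; set d := (msupp (a *: F + G) `|` (msupp F `|` msupp G))%fset.
have sub1 : (msupp (a *: F + G) `<=` d)%fset by apply: fsubsetUl.
have sub2 : (msupp F `<=` d)%fset.
  exact: fsubset_trans (fsubsetUl _ _) (fsubsetUr _ _).
have sub3 : (msupp G `<=` d)%fset.
  exact: fsubset_trans (fsubsetUr _ _) (fsubsetUr _ _).
rewrite (free_evalEw sub1) (free_evalEw sub2) (free_evalEw sub3).
rewrite scaler_sumr -big_split /=; apply: eq_bigr => w _.
by rewrite mcoeffD mcoeffZ scalerDl scalerA.
Qed.
HB.instance Definition _ := GRing.isLinear.Build K FA A *:%R (free_eval u v)
  free_eval_is_linear.

Lemma free_mulUU a b (w w' : {fmonom bool}) :
  (<< a *g w >> : FA) * << b *g w' >> = << a * b *g mmul w w' >>.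
Proof. exact: fgmulUU. Qed.

Lemma free_eval_is_monoid_morphism : monoid_morphism (free_eval u v).
Proof.
have evD F G : free_eval u v (F + G) = free_eval u v F + free_eval u v G.
  exact: linearD.
split=> [|F G]; first by rewrite free_evalU fm1 big_nil scale1r.
pose mult f g := free_eval u v (f * g) = free_eval u v f * free_eval u v g.
have mDl f1 f2 g : mult f1 g -> mult f2 g -> mult (f1 + f2) g.
  move=> e1 e2; apply: etrans (congr1 _ (mulrDl f1 f2 g)) _.
  apply: etrans (evD _ _) (etrans (congr2 +%R e1 e2) _).
  exact: etrans (esym (mulrDl _ _ _)) (congr1 ( *%R^~ _) (esym (evD _ _))).
have mDr f g1 g2 : mult f g1 -> mult f g2 -> mult f (g1 + g2).
  move=> e1 e2; apply: etrans (congr1 _ (mulrDr f g1 g2)) _.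
  apply: etrans (evD _ _) (etrans (congr2 +%R e1 e2) _).
  exact: etrans (esym (mulrDr _ _ _)) (congr1 ( *%R _) (esym (evD _ _))).
have m0l g : mult 0 g by rewrite /mult mul0r linear0 mul0r.
have m0r f : mult f 0 by rewrite /mult mulr0 linear0 mulr0.
rewrite -/(mult F G).
elim/free_ind: F => [|f1 f2|a w]; [exact: m0l|exact: mDl|].
elim/free_ind: G => [|g1 g2|b w']; [exact: m0r|exact: mDr|].
rewrite /mult free_mulUU !free_evalU fmM big_cat /=.
by rewrite -scalerAl -scalerAr scalerA.
Qed.
HB.instance Definition _ := GRing.isMonoidMorphism.Build FA A (free_eval u v)
  free_eval_is_monoid_morphism.

Lemma free_evalX : free_eval u v freeX = u.
Proof. by rewrite free_evalU fmU big_seq1 scale1r. Qed.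

Lemma free_evalY : free_eval u v freeY = v.
Proof. by rewrite free_evalU fmU big_seq1 scale1r. Qed.

Lemma rmorph_free_eval (B : algType K) (f : {lrmorphism A -> B}) F :
  f (free_eval u v F) = free_eval (f u) (f v) F.
Proof.
rewrite /free_eval raddf_sum; apply: eq_bigr => w _.
rewrite /= linearZ /= rmorph_prod; congr (_ *: _); apply: eq_bigr => l _.
by case: l.
Qed.

End FreeAlgebra.

(** Together with [rmorph_free_eval] this identifies the class of F in R with the value F(x, y)
    computed in R. *)
Lemma free_evalE (K : fieldType) (F : freeAlg K) : free_eval freeX freeY F = F.
Proof.
rewrite [RHS]monalgE; apply: eq_bigr => w _; move: (F@_w) => a.
rewrite -[w]fmK; elim: (w : seq bool) => {w} [|l s IH] in a *.
  rewrite big_nil -fmoneE; apply/malgP => k; apply: etrans (mcoeffZ _ _ _) _.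
  by rewrite mcoeffU1 mcoeffU mulr_natr.
rewrite big_cons scalerAr IH.
have -> : (if l then freeY else freeX) = << fmu l >> :> freeAlg K by case: l.
apply: etrans (free_mulUU _ _ _ _) _; rewrite mul1r; congr << _ *g _ >>.
by apply/val_inj; rewrite /= /mmul /= fmmulE fmuE.
Qed.

(** * Conjugation in filtered algebras *)

Section Unipotent.
Variables (K : fieldType) (R : algType K) (fil : nat -> R -> Prop) (top : nat).
Hypotheses (fil0 : forall r, fil 0 r) (filD : forall d r s, fil d r -> fil d s -> fil d (r + s))
  (filM : forall d e r s, fil d r -> fil e s -> fil (d + e) (r * s))
  (filZ : forall d (a : K) r, fil d r -> fil d (a *: r))
  (fil_le : forall d e r, (d <= e)%N -> fil e r -> fil d r)
  (fil_top : forall r, fil top r -> r = 0) (fil_zero : forall d, fil d 0).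

Lemma filN d r : fil d r -> fil d (- r).
Proof. by move=> /(filZ (- 1)); rewrite scaleN1r. Qed.

Lemma filB d r s : fil d r -> fil d s -> fil d (r - s).
Proof. by move=> Hr /filN; apply: filD. Qed.

Lemma filMl d r s : fil d s -> fil d (r * s).
Proof. exact: (filM (fil0 r)). Qed.

Lemma filMr d r s : fil d r -> fil d (r * s).
Proof. by rewrite -[d in fil d (_ * _)]addn0 => Hr; apply: filM. Qed.

Lemma filX r k : fil 1 r -> fil k (r ^+ k).
Proof. by move=> Hr; elim: k => // k IH; rewrite exprS -add1n; apply: filM. Qed.

Lemma fil_sum d I (r : seq I) (P : pred I) (G : I -> R) :
  (forall i, P i -> fil d (G i)) -> fil d (\sum_(i <- r | P i) G i).
Proof. by move=> H; elim/big_ind: _ => // *; apply: filD. Qed.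

Lemma horner_fil t (g : {poly K}) : fil 1 t -> g.[0] = 1 -> fil 1 (horner_alg t g - 1).
Proof.
move=> Ht g0; have /factor_theorem[q qE] : root (g - 1) 0.
  by rewrite /root hornerD hornerN hornerC g0 subrr.
rewrite -[1](rmorph1 (horner_alg t)) -rmorphB qE rmorphM /= subr0 horner_algX.
exact: filMl.
Qed.

Definition unip (r r' : R) : Prop := [/\ r * r' = 1, r' * r = 1, fil 1 (r - 1) & fil 1 (r' - 1)].

Lemma unip1 : unip 1 1.
Proof. by rewrite /unip !mulr1 !subrr. Qed.

Lemma unipM r r' s s' : unip r r' -> unip s s' -> unip (r * s) (s' * r').
Proof.
case=> rr' r'r r1 r'1 [ss' s's s1 s'1]; split.
- by rewrite mulrA -(mulrA r) ss' mulr1.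
- by rewrite mulrA -(mulrA s') r'r mulr1.
- have -> : r * s - 1 = (r - 1) * s + (s - 1) by ncring.
  by apply: filD => //; apply: filMr.
- have -> : s' * r' - 1 = (s' - 1) * r' + (r' - 1) by ncring.
  by apply: filD => //; apply: filMr.
Qed.

(** The inverse is the geometric series in -s, finite because degree [top] vanishes. Its terms from
    the square on have degree at least 2(d + 1). *)
Lemma unip_inv d s : fil d.+1 s ->
  exists2 r, unip (1 + s) r & fil (d.+1 + d.+1) (r - 1 + s).
Proof.
move=> Hs; pose t := - s; have Ht : fil d.+1 t by apply: filN.
have t1 : fil 1 t by apply: fil_le Ht.
pose r := \sum_(i < top) t ^+ i.
have rt : t * r = r * t.
  apply: commr_sum => i _; exact: commrX.
have lr : (1 - t) * r = 1.
  by rewrite -(opprB t 1) mulNr -subrX1 (fil_top (filX top t1)) sub0r opprK.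
have rE : r = 1 + t * r by apply/esym; rewrite -lr mulrBl mul1r subrK.
have rl : r * (1 - t) = 1 by rewrite mulrBr mulr1 -rt -[X in X - _]mul1r -mulrBl.
have Hr : fil 1 (r - 1) by rewrite {1}rE addrC addKr; apply: filMr.
exists r; first by rewrite -[s]opprK -/t; split; rewrite // addrC addKr; apply: filN.
have -> : r - 1 + s = t * t * r.
  rewrite {1}rE {1}rE -[s]opprK -/t; ncring.
by apply/filMr/filM.
Qed.

(** To leading order, conjugation by 1 + s adds the commutator [s, x]. Every other term contains s
    twice, or s together with X - x, and so has degree at least d + 3. *)
Lemma conj_step X x s r d : fil d.+1 s -> unip (1 + s) r ->
  fil (d.+1 + d.+1) (r - 1 + s) -> fil 1 x -> fil 2 (X - x) ->
  fil d.+3 ((1 + s) * X * r - X - (s * x - x * s)).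
Proof.
move=> Hs _; set e := r - 1 + s => He Hx HX.
have X1 : fil 1 X by rewrite -(subrK x X); apply: filD => //; apply: fil_le HX.
have -> : r = 1 - s + e by rewrite /e; ncring.
have -> : (1 + s) * X * (1 - s + e) - X - (s * x - x * s)
  = s * (X - x) - (X - x) * s - s * X * s + (1 + s) * X * e by ncring.
apply: filD; [apply: filB; [apply: filB|]|].
- by rewrite -addn2; apply: filM.
- by rewrite -add2n; apply: filM.
- have /fil_le : (d.+3 <= d.+1 + 1 + d.+1)%N by rewrite addn1 addnS !ltnS leq_addl.
  by apply; apply: filM => //; apply: filM.
- have /fil_le : (d.+3 <= 0 + 1 + (d.+1 + d.+1))%N.
    by rewrite addnS !ltnS leq_addl.
  by apply; apply: filM => //; apply: filM.
Qed.

Lemma unip_conj u u' d e r : unip u u' -> fil d r -> (e <= d.+1)%N -> fil e (u * r * u' - r).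
Proof.
move=> [_ _ u1 u'1] Hr /fil_le; apply.
have -> : u * r * u' - r = (u - 1) * r * u' + r * (u' - 1) by ncring.
by apply: filD; [apply/filMr; rewrite -add1n | rewrite -addn1]; apply: filM.
Qed.

Section Substitution.
Variables X Y X' Y' : R.
Hypotheses (HX : fil 1 X) (HY : fil 1 Y) (HX' : fil 1 X') (HY' : fil 1 Y').

Lemma fil_eval d (F : freeAlg K) : (forall w, w \in msupp F -> d <= fdeg w)%N ->
  fil d (free_eval X Y F).
Proof.
move=> HF; rewrite /free_eval big_seq; apply: fil_sum => w /HF /fil_le; apply.
apply: filZ; rewrite fdegE; elim: (w : seq bool) => [|l s IH]; first by rewrite big_nil.
by rewrite big_cons /= -add1n; apply: filM => //; case: l.
Qed.

(** The change of a monomial telescopes into products with one factor replaced by a difference; as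
    there are at least two letters, another factor of positive degree remains. Corrections of X and
    Y therefore affect F(X, Y) only one degree later. *)
Lemma fil_eval_diff d (F : freeAlg K) : monomials_deg_ge2 F ->
  fil d (X' - X) -> fil d (Y' - Y) ->
  fil d.+1 (free_eval X' Y' F - free_eval X Y F).
Proof.
move=> HF dX dY; rewrite /free_eval -sumrB big_seq; apply: fil_sum => w /HF.
rewrite -scalerBr fdegE => Hw; apply: filZ.
pose P (U V : R) (s : seq bool) := \prod_(l <- s) (if l then V else U).
rewrite -/(P X' Y' w) -/(P X Y w).
have PE s : fil (size s) (P X' Y' s).
  elim: s => [|l s IH]; first by rewrite /P big_nil.
  by rewrite /P big_cons /= -add1n; apply: filM => //; case: l.
have dP s : fil (d + (size s).-1) (P X' Y' s - P X Y s).
  elim: s => [|l s IH]; first by rewrite /P !big_nil subrr.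
  rewrite {1 2}/P !big_cons -/(P X' Y' s) -/(P X Y s).
  set a' := if l then Y' else X'; set a := if l then Y else X.
  have -> : a' * P X' Y' s - a * P X Y s = (a' - a) * P X' Y' s + a * (P X' Y' s - P X Y s).
    by ncring.
  apply: filD; first by apply: (filM (e := size s)) (PE s); rewrite /a' /a; case: l {a a'}.
  case: s IH => [|l' s] IH; first by rewrite /P !big_nil subrr mulr0.
  have -> : (d + (size [:: l, l' & s]).-1 = 1 + (d + (size (l' :: s)).-1))%N.
    by rewrite addnCA.
  by apply: filM => //; rewrite /a; case: (l).
by apply: fil_le (dP w); rewrite -addn1 leq_add2l; case: (w : seq bool) Hw => [|? []].
Qed.
End Substitution.

Section Descent.
Variables (x y : R) (N' d0 : nat).
Local Notation N := N'.+1.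
Local Notation z := (x + y).
Hypotheses (Hx : fil 1 x) (Hy : fil 1 y) (zN : z ^+ N = 0).

(* The part of [(z + h) ^+ k.+1] that is linear in [h]. *)
Fixpoint dpow (k : nat) (h : R) : R :=
  if k is k'.+1 then dpow k' h * z + z ^+ k * h else h.

(** For h of degree d + 1, [dpow N' h] always has degree at least d + 1 + N'. Asking for one degree
    more means that the leading term of h lies in the kernel. *)
Hypothesis dpow_ker : forall d h, (1 <= d)%N -> (d.+1 < d0)%N -> fil d.+1 h ->
  fil (d.+1 + N) (dpow N' h) ->
  exists s, exists2 c : K, fil d s & fil d.+2 (h - (s * z - z * s) - c *: z ^+ d.+1).
Hypothesis commutators : forall d h, (d0 <= d.+1)%N -> (1 <= d)%N -> fil d.+1 h ->
  exists s, exists2 t, fil d s & fil d t /\ fil d.+2 (h - (s * x - x * s) - (t * y - y * t)).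

Let Hz : fil 1 z. Proof. exact: filD. Qed.

Lemma fil_dpow d h k : fil d h -> fil (d + k) (dpow k h).
Proof.
move=> Hh; elim: k => [|k IH] /=; first by rewrite addn0.
apply: filD; first by rewrite addnS -addn1; apply: filM.
by rewrite addnC; apply: filM => //; apply: filX.
Qed.

(** Terms that contain h twice, and the replacement of Z by its leading term z, each raise the
    degree by at least one. Hence the linear part may be computed with z alone. *)
Lemma expr_perturb Z h d k : (2 <= d)%N -> fil 2 (Z - z) -> fil d h ->
  fil (d + k.+1) ((Z + h) ^+ k.+1 - Z ^+ k.+1 - dpow k h).
Proof.
move=> d2 HZ Hh.
have Z1 : fil 1 Z by rewrite -(subrK z Z); apply: filD => //; apply: fil_le HZ.
have Zz j : fil j.+1 (Z ^+ j - z ^+ j).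
  elim: j => [|j IH]; first by rewrite !expr0 subrr.
  have -> : Z ^+ j.+1 - z ^+ j.+1 = Z ^+ j * (Z - z) + (Z ^+ j - z ^+ j) * z.
    by rewrite !exprSr; ncring.
  by apply: filD; [rewrite -addn2 | rewrite -addn1]; apply: filM => //; apply: filX.
elim: k => [|k IH]; first by rewrite !expr1 /= [Z + h]addrC addrK subrr.
set e := _ - _ - _ in IH.
rewrite [(Z + h) ^+ _]exprSr [Z ^+ k.+2]exprSr /=.
have -> : (Z + h) ^+ k.+1 = Z ^+ k.+1 + dpow k h + e by rewrite /e; ncring.
have -> : (Z ^+ k.+1 + dpow k h + e) * (Z + h) - Z ^+ k.+1 * Z - (dpow k h * z + z ^+ k.+1 * h)
  = (Z ^+ k.+1 - z ^+ k.+1) * h + dpow k h * (Z - z) + dpow k h * h + e * (Z + h).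
  by ncring.
apply: filD; [apply: filD; [apply: filD|]|].
- by rewrite addnC; apply: filM.
- by rewrite -addn2 addnA; apply: filM => //; apply: fil_dpow.
- apply: fil_le (filM (fil_dpow k Hh) Hh).
  by rewrite -addnA leq_add2l -addn2 leq_add2l.
- rewrite addnS -addn1; apply: filM => //; apply: filD => //; apply: fil_le Hh.
  exact: leq_trans d2.
Qed.

Let normal u (g : {poly K}) u' := u * (z * horner_alg z g) * u'.

(** Since z commutes with g(z), the N-th power contains the factor z^N. *)
Lemma normal_nil u g u' : unip u u' -> normal u g u' ^+ N = 0.
Proof.
move=> [_ u'u _ _].
have cE a k : (u * a * u') ^+ k.+1 = u * a ^+ k.+1 * u'.
  elim: k => // k IH; rewrite exprS IH [a ^+ k.+2]exprS.
  rewrite -!mulrA; congr (_ * (_ * _)); rewrite !mulrA u'u mul1r //.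
rewrite /normal cE exprMn_comm; first by rewrite zN mul0r mulr0 mul0r.
rewrite /GRing.comm -{1 4}(horner_algX z) -!rmorphM /=; congr horner_alg; exact: mulrC.
Qed.

Lemma normal_lead u g u' : unip u u' -> g.[0] = 1 -> fil 2 (normal u g u' - z).
Proof.
move=> uu' /(horner_fil Hz) Hg.
have Hzg : fil 2 (z * horner_alg z g - z).
  have -> : z * horner_alg z g - z = z * (horner_alg z g - 1) by ncring.
  by apply: (filM (d := 1) (e := 1)).
have -> : normal u g u' - z = (normal u g u' - z * horner_alg z g) + (z * horner_alg z g - z).
  by rewrite addrA subrK.
by apply: filD => //; apply: (unip_conj (d := 1)) => //; apply: filMr.
Qed.

Variable F : freeAlg K.
Hypotheses (degF : monomials_deg_ge2 F) (admF : (z + free_eval x y F) ^+ N = 0).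
Hypothesis d0_gt1 : (1 < d0)%N.

Let fil_conj u u' r d : unip u u' -> fil d r -> fil d (u * r * u').
Proof. by move=> _ Hr; apply/filMr/filMl. Qed.

(** Both u z g(z) u' and z + f have N-th power zero, so the leading term of their difference h is in
    the kernel of [dpow N']. Its part [s, z] is absorbed by replacing u with (1 + s) u, its part c
    z^(d+2) by adding c X^(d+1) to g. *)
Lemma admissible_normal : exists u u' g, [/\ unip u u', g.[0] = 1 &
  fil d0 (z + free_eval x y F - normal u g u')].
Proof.
set f := free_eval x y F.
(* The maximum with 2 settles d = 0 and d = 1: f starts in degree 2. *)
suff H d : (d < d0)%N -> exists u u' g, [/\ unip u u', g.[0] = 1 &
    fil (maxn 2 d.+1) (z + f - normal u g u')].
  have := H d0.-1; rewrite prednK ?leqnn ?(ltn_trans _ d0_gt1) // (maxn_idPr d0_gt1).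
  exact.
elim: d => [|d IH] ltd.
  exists 1, 1, 1; split; [exact: unip1 | exact: hornerC |].
  rewrite /normal rmorph1 !mulr1 mul1r addrC addKr; exact: fil_eval.
have [u [u' [g [uu' g0]]]] := IH (ltnW ltd).
case: d ltd {IH} => [|d] ltd; first by exists u, u', g.
rewrite !(maxn_idPr _) //; set h := _ - _ => Hh.
have ZN := normal_nil g uu'; have HZ := normal_lead uu' g0.
have := expr_perturb N' (isT : (2 <= d.+2)%N) HZ Hh.
have -> : normal u g u' + h = z + f by rewrite /h addrC subrK.
rewrite admF ZN subrr sub0r => /filN; rewrite opprK => Dh.
have [s [c Hs Hc]] := dpow_ker (isT : 0 < d.+1)%N ltd Hh Dh.
have [r sr Hr] := unip_inv Hs.
exists ((1 + s) * u), (u' * r), (g + c *: 'X^(d.+1)); split.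
- exact: unipM.
- by rewrite hornerD hornerZ hornerXn expr0n mulr0 addr0.
(* This is the normal form for the corrected g before conjugation by 1 + s; it has leading term z,
   as [conj_step] requires. *)
pose Z1 := normal u g u' + c *: (u * z ^+ d.+2 * u').
have -> : normal ((1 + s) * u) (g + c *: 'X^(d.+1)) (u' * r) = (1 + s) * Z1 * r.
  rewrite /normal /Z1 rmorphD /= linearZ /= rmorphXn /= horner_algX mulr_algl [z ^+ d.+2]exprS.
  rewrite -/z /normal; set G := horner_alg z g; set W := c *: z ^+ d.+1.
  have -> : c *: (u * (z * z ^+ d.+1) * u') = u * (z * W) * u'.
    by rewrite /W -!scalerAr -scalerAl.
  rewrite {}/G {}/W; move: (horner_alg z g) (c *: _) => G W; ncring.
have zd : fil d.+2 (u * z ^+ d.+2 * u') by apply: fil_conj uu' _; apply: filX.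
have HZ1 : fil 2 (Z1 - z).
  rewrite /Z1 addrAC; apply: filD => //; apply: filZ; exact: fil_le zd.
have Hc1 := conj_step Hs sr Hr Hz HZ1.
have Hu : fil d.+3 (u * z ^+ d.+2 * u' - z ^+ d.+2).
  by apply: unip_conj uu' (filX _ Hz) _.
have -> : z + f - (1 + s) * Z1 * r = (h - (s * z - z * s) - c *: z ^+ d.+2)
   - ((1 + s) * Z1 * r - Z1 - (s * z - z * s)) - c *: (u * z ^+ d.+2 * u' - z ^+ d.+2).
  rewrite /h /Z1 scalerBr; ncring.
by apply: filB; [apply: filB | apply: filZ].
Qed.

(** From degree [d0] on, u and g stay fixed and only X and Y move: s and t are chosen with [s, x] +
    [t, y] equal to -h in leading degree, and the induced change of F(X, Y) is of higher degree. *)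
Theorem admissible_conjugate : (d0 <= top)%N ->
  exists p p' q q' u u' g, [/\ unip p p', unip q q', unip u u', g.[0] = 1 &
    p * x * p' + q * y * q' + free_eval (p * x * p') (q * y * q') F
    = normal u g u'].
Proof.
move=> le_top; have [u [u' [g [uu' g0 H0]]]] := admissible_normal.
pose E p p' q q' := p * x * p' + q * y * q'
  + free_eval (p * x * p') (q * y * q') F - normal u g u'.
suff H d : exists p p' q q', [/\ unip p p', unip q q' & fil (d0 + d) (E p p' q q')].
  have [p [p' [q [q' [pp' qq' HE]]]]] := H top.
  exists p, p', q, q', u, u', g; split=> //; apply/eqP; rewrite -subr_eq0.
  by apply/eqP/fil_top; apply: fil_le HE; rewrite leq_addl.
elim: d => [|d [p [p' [q [q' [pp' qq']]]]]].
  exists 1, 1, 1, 1; split; [exact: unip1 | exact: unip1 |].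
  by rewrite /E !mul1r !mulr1 addn0.
set X := p * x * p'; set Y := q * y * q'; set h := E _ _ _ _.
have -> : (d0 + d = (d0 + d).-2.+2)%N by case: d0 d0_gt1 => [|[]].
set e := (d0 + d).-2 => Hh.
have le1 : (d0 <= e.+2)%N.
  by rewrite /e; case: d0 d0_gt1 => [|[|k]] // _; rewrite !addSn /= !ltnS leq_addr.
have [s [t Hs [Ht Hst]]] := commutators le1 isT (filN Hh).
have [r sr Hr] := unip_inv Hs; have [r' tr' Hr'] := unip_inv Ht.
have HX : fil 2 (X - x) by apply: (unip_conj (d := 1) pp' Hx).
have HY : fil 2 (Y - y) by apply: (unip_conj (d := 1) qq' Hy).
have cX := conj_step Hs sr Hr Hx HX.
have cY := conj_step Ht tr' Hr' Hy HY.
exists ((1 + s) * p), (p' * r), ((1 + t) * q), (q' * r'); split; try exact: unipM.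
have -> : (d0 + d.+1 = e.+3)%N by rewrite addnS /e; case: d0 d0_gt1 => [|[]].
have XE : (1 + s) * p * x * (p' * r) = (1 + s) * X * r by rewrite /X !mulrA.
have YE : (1 + t) * q * y * (q' * r') = (1 + t) * Y * r' by rewrite /Y !mulrA.
rewrite /E XE YE; set X' := _ * X * r; set Y' := _ * Y * r'.
have fX : fil 1 X by apply: fil_conj pp' Hx.
have fY : fil 1 Y by apply: fil_conj qq' Hy.
have dX : fil e.+2 (X' - X).
  rewrite -[X' - X](subrK (s * x - x * s)); apply: filD; first exact: fil_le cX.
  by apply: filB; [rewrite -addn1 | rewrite -add1n]; apply: filM.
have dY : fil e.+2 (Y' - Y).
  rewrite -[Y' - Y](subrK (t * y - y * t)); apply: filD; first exact: fil_le cY.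
  by apply: filB; [rewrite -addn1 | rewrite -add1n]; apply: filM.
have fX' : fil 1 X' by rewrite -(subrK X X'); apply: filD => //; apply: fil_le dX.
have fY' : fil 1 Y' by rewrite -(subrK Y Y'); apply: filD => //; apply: fil_le dY.
have dF := fil_eval_diff fX fY fX' fY' degF dX dY.
have -> : X' + Y' + free_eval X' Y' F - normal u g u'
  = (X' - X - (s * x - x * s)) + (Y' - Y - (t * y - y * t))
    + (free_eval X' Y' F - free_eval X Y F)
    - (- h - (s * x - x * s) - (t * y - y * t)).
  rewrite /h /E -/X -/Y; ncring.
by apply: filB => //; apply: filD => //; apply: filD.
Qed.
End Descent.
End Unipotent.

(** * The algebra R(E_n) *)

(** Words are stored backwards: [mulz] multiplies by z = x + y on the right, [zmul] on the left. *)
Definition mulz (p : zpoly) : zpoly := zcatl [:: 0%N] p ++ zcatl [:: 1%N] p.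
Definition zmul (p : zpoly) : zpoly := zcat p [:: 0%N] ++ zcat p [:: 1%N].
Definition zpow (k : nat) : zpoly := iter k mulz [:: (Posz 1, [::])].
Fixpoint zdpow (k : nat) (w : word) : zpoly :=
  if k is k'.+1 then mulz (zdpow k' w) ++ zcatl w (zpow k) else [:: (Posz 1, w)].
Definition zopp (p : zpoly) : zpoly := zscale (Negz 0) p.

Definition relsR (N : nat) : seq zpoly :=
  [:: [:: (Posz 1, [:: 0; 0])]; [:: (Posz 1, [:: 1; 1; 1])]; zpow N]%N.
Definition rulesR N ds := rules (relsR N) ds.

Definition normal (rs : seq rule) (d : nat) : seq word :=
  iter d (next (step fuel rs) (fun _ _ => true) 2) [:: [::]].
Definition basis (rs : seq rule) (top : nat) : seq word :=
  flatten [seq normal rs d | d <- iota 0 top].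

Definition lookup (ws : seq word) (ps : seq zpoly) (w : word) : zpoly :=
  if w \in ws then nth [::] ps (index w ws) else [::].
Definition rows (M : seq (seq int)) (ws : seq word) : seq zpoly :=
  [seq zip r ws | r <- M].

Definition binary (w : word) : bool := all (fun l => l < 2)%N w.

(** The last clause lets every relation act from the right on every normal word and demands zero.
    The span of the normal words is then a right R-module, so the normal form is well defined on
    R. *)
Definition basis_check (rs : seq rule) (N top : nat) : bool :=
  let bs := basis rs top in
  [&& uniq bs, head [:: 0%N] bs == [::], (normal rs top == [::]),
   all (fun d => all (fun w => (size w == d) && binary w) (normal rs d)) (iota 0 top) &
   all (fun b => all (fun l => supp_in bs (step fuel rs b l)) (iota 0 2) &&
     all (fun p => zcomb (nfmul (step fuel rs) [:: (Posz 1, b)]) p == [::]) (relsR N)) bs].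

(* [(L, s_, k)] certifies, for each normal word [b] of degree [d + 1],
   b = L(dpow N' b) + (s b * z - z * s b) + k b *: z ^+ d.+1
   with [L] linear.  All coordinates refer to the order of [normal]. *)
Definition kernel_cert := (seq (seq int) * seq (seq int) * seq int)%type.
Definition kernel_check (rs : seq rule) (N' d : nat) (C : kernel_cert) : bool :=
  let: (L, s_, k) := C in
  let B := normal rs d.+1 in let B' := normal rs d in
  let T := normal rs (d.+1 + N') in
  all (fun b => let s := lookup B (rows s_ B') b in
    nilp (nf rs ((Posz 1, b) :: zopp (zcomb (lookup T (rows L B)) (nf rs (zdpow N' b)))
      ++ zopp (mulz s) ++ zmul s
      ++ zopp (zscale (nth (Posz 0) k (index b B)) (zpow d.+1))))) B.

(* [(s_, t_)] certifies 2 b = (s b * x - x * s b) + (t b * y - y * t b). *)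
Definition commutator_cert := (seq (seq int) * seq (seq int))%type.
Definition commutator_check (rs : seq rule) (d : nat) (C : commutator_cert) : bool :=
  let: (s_, t_) := C in
  let B := normal rs d.+1 in let B' := normal rs d in
  all (fun b => let s := lookup B (rows s_ B') b in let t := lookup B (rows t_ B') b in
    nilp (nf rs ((Posz 2, b) :: zopp (zcatl [:: 0%N] s) ++ zcat s [:: 0%N]
      ++ zopp (zcatl [:: 1%N] t) ++ zcat t [:: 1%N]))) B.

(** The index d stands for degree d + 1. The two families cover the degrees from 2 to d0 - 1 and
    from d0 to top - 1. *)
Definition kernel_checks rs N' d0 Cs :=
  all (fun d => kernel_check rs N' d (nth ([::], [::], [::]) Cs d.-1)) (iota 1 d0.-2).
Definition commutator_checks rs d0 top Cs :=
  all (fun d => commutator_check rs d (nth ([::], [::]) Cs (d.+1 - d0))) (iota d0.-1 (top - d0)).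

(** * Certificates for R(E_7) and R(E_8) *)

Definition overlaps4 := [:: (1,2,1); (1,3,1); (3,2,2)]%N.
Definition overlaps5 := [:: (1,2,2); (2,3,1); (4,1,1); (5,4,8)]%N.
(** The suffixes 4 and 5 are the values of N = n - 3. The lists are mere candidates: the identities
    that they encode are recomputed by the checks. *)
Definition kernel_certs4 : seq kernel_cert :=
  [:: ([:: [:: 0; 1; 0]; [:: 0; 0; 0]; [:: 0; 0; 0]; [:: 0; 0; 0]], [:: [:: 1; 0]; [:: 0; 0];
      [:: -1; 0]], [:: 0; 0; 1]);
      ([:: [:: 0; 0; 0; 0]; [:: 0; 0; 1; 0]; [:: 0; 0; 0; 0]], [:: [:: 1; -1; 0]; [:: 0; 1; 0];
          [:: 0; 0; 0]; [:: -1; 0; 0]], [:: -1; 1; 0; 1])]%Z.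
Definition commutator_certs4 : seq commutator_cert :=
  [:: ([:: [:: 0; -1; 1; 0]; [:: 0; 2; 0; 0]; [:: 0; -1; -1; 0]; [:: 0; 0; 0; 0]], [:: [:: 0; 2;
      1; 0]; [:: 0; 0; 0; 0]; [:: 0; 2; 1; 0]; [:: 0; -2; 0; 0]]);
      ([:: [:: -2; 0; 0; 0]; [:: -2; 0; 0; 0]; [:: 4; 0; 0; -2]; [:: 4; 0; 0; 0]], [:: [:: 0; 0;
          0; 2]; [:: 0; 0; 0; 0]; [:: 2; 0; 0; -2]; [:: 2; 0; 0; -2]]);
      ([:: [:: 0; 0; 2; 0]; [:: 2; 0; 0; 0]; [:: 0; 0; 0; 0]], [:: [:: 0; 0; 0; 0]; [:: 0; 0;
          -2; 0]; [:: 0; 0; -2; 0]]);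
      ([:: [:: 0; 0; 0]; [:: 0; -2; 0]], [:: [:: 0; 2; 0]; [:: 0; 0; 0]]);
      ([:: [:: -1; 0]], [:: [:: 0; 0]])]%Z.
Definition kernel_certs5 : seq kernel_cert :=
  [:: ([:: [:: 0; 0; 0]; [:: 0; 1; 0]; [:: 0; 0; 0]; [:: 0; 0; 0]; [:: 0; 0; 0]; [:: 0; 0;
      0]], [:: [:: 1; 0]; [:: 0; 0]; [:: -1; 0]], [:: 0; 0; 1]);
      ([:: [:: 0; 0; 0; 0]; [:: 0; 0; 1; 0]; [:: 0; 0; 0; 0]; [:: 0; 0; 0; 0]; [:: 0; 0; 0; 0];
          [:: 0; 0; 0; 0]], [:: [:: 1; -1; 0]; [:: 0; 1; 0]; [:: 0; 0; 0]; [:: -1; 0;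
          0]], [:: -1; 1; 0; 1]);
      ([:: [:: 0; 0; 1; 0; 1]; [:: 0; 0; 0; 0; 0]; [:: 0; 0; 0; 0; 0]; [:: 0; 0; 0; 0; 0];
          [:: 0; 0; 0; 0; 0]; [:: 0; 0; 0; 0; 0]], [:: [:: 4; 1; 2; 0]; [:: -2; 0; -1; 0];
          [:: 3; 1; 2; 0]; [:: -2; -1; -1; 0]; [:: -3; -1; -2; 0]], [:: -1; 1; -1; 1; 1]);
      ([:: [:: 0; 0; 0; -1; -1; 1]; [:: 0; 0; 0; 1; 1; 0]; [:: 0; 0; 0; 0; 0; 0]; [:: 0; 0; 0;
          0; 0; 0]; [:: 0; 0; 0; 0; 0; 0]; [:: 0; 0; 0; 0; 0; 0]], [:: [:: 1; -2; -1; -1; 0];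
          [:: -1; 0; -1; 0; 0]; [:: 0; 1; 1; 1; 0]; [:: 0; -2; -1; -1; 0]; [:: 0; 2; 1; 1; 0];
          [:: 0; 0; 0; 0; 0]], [:: 0; 0; 0; 0; 0; 0]);
      ([:: [:: 0; 0; 0; 0; 0; 1]; [:: 0; 0; 0; 0; 0; 0]; [:: 0; 0; 0; 0; 0; 0]; [:: 0; 0; 0; 0;
          0; 0]; [:: 0; 0; 0; 0; 0; 0]], [:: [:: -2; -2; -1; -1; -1; 0]; [:: 1; 2; 1; 1; 0; 0];
          [:: 2; 1; 1; 1; 1; 0]; [:: 1; 0; 1; 0; 1; 0]; [:: 2; 2; 1; 1; 0; 0]; [:: 0; 0; 0; 0;
          0; 0]], [:: 0; 0; 0; 0; 0; 0]);
      ([:: [:: 0; 0; 0; 0; 0; 1]; [:: 0; 0; 0; 0; 0; 0]; [:: 0; 0; 0; 0; 0; 0]; [:: 0; 0; 0; 0;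
          0; 0]], [:: [:: 1; 1; 0; 0; 1; 0]; [:: -1; -1; -1; 0; -1; 0]; [:: 0; 1; 0; 1; 1; 0];
          [:: 0; 0; -1; 1; 1; 0]; [:: -1; -1; 0; -1; -1; 0]; [:: 0; 0; 0; 0; 0; 0]], [:: 0; 0;
          0; 0; 0; 0]);
      ([:: [:: 0; 0; 0; 0; 0; 1]; [:: 0; 0; 0; 0; 0; 0]; [:: 0; 0; 0; 0; 0; 0]], [:: [:: 0; 1;
          0; 0; 0; 0]; [:: 0; -1; -1; 0; -1; -1]; [:: 0; 1; 1; 0; 0; 0]; [:: -1; 2; 1; 0; 1; 2];
          [:: 0; -1; -1; 0; 0; -1]; [:: 0; 0; 0; 0; 0; 0]], [:: 0; 0; 0; 0; 0; 0]);
      ([:: [:: 0; 0; 0; 0; 1; 1]; [:: 0; 0; 0; 0; 0; 0]], [:: [:: 4; 5; 2; -1; -1; 0]; [:: -2;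
          -2; -1; 0; 0; 0]; [:: 1; 1; 0; 0; 0; 0]; [:: -2; -2; -1; 0; 1; 0]; [:: 2; 3; 1; 0; 0;
          0]; [:: -2; -3; -1; 0; 0; 0]], [:: 0; 0; 0; 0; 0; 0])]%Z.
Definition commutator_certs5 : seq commutator_cert :=
  [:: ([:: [:: 2; 2; 2; 0; 0; 0]; [:: -4; -2; -2; 0; 0; 0]; [:: -2; 0; 0; 0; 0; 0]; [:: 2; 2; 0;
      0; 0; 0]; [:: 0; -2; 0; 0; 0; 0]], [:: [:: 2; 0; 0; 0; 0; 0]; [:: -4; -2; 0; 0; 0; 0];
      [:: 0; 0; 0; 0; 0; 0]; [:: 2; 0; 0; 0; 0; 0]; [:: 0; 0; 0; 0; 0; 0]]);
      ([:: [:: -2; 0; 0; 0; 0]; [:: 4; 0; 0; 0; 0]; [:: -2; 0; 0; 0; 0]; [:: 4; -2; 0; 0;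
          0]], [:: [:: 0; 2; 0; 0; 0]; [:: 2; -2; 0; 0; 0]; [:: 0; 0; 0; 0; 0]; [:: 2; -2; 0; 0;
          0]]);
      ([:: [:: 2; 0; 0; 0]; [:: 0; 0; 0; 0]; [:: 0; -2; 0; 0]], [:: [:: 0; -2; 0; 0]; [:: 0; -2;
          0; 0]; [:: 0; 0; 0; 0]]);
      ([:: [:: 0; 0; 0]; [:: -2; 0; 0]], [:: [:: 2; 0; 0]; [:: 0; 0; 0]]);
      ([:: [:: -1; 0]], [:: [:: 0; 0]])]%Z.

Section TwoLetters.
Variables (A : pzRingType) (x y : A).

Definition xy (l : nat) : A := if l is 0 then x else y.
Local Notation ev := (evm (evw xy)).

Lemma ev_mulz p : ev (mulz p) = ev p * (x + y).
Proof. by rewrite evm_cat !ev_zcatl /= !mul1r mulrDr. Qed.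

Lemma ev_zmul p : ev (zmul p) = (x + y) * ev p.
Proof. by rewrite evm_cat !ev_zcat /= !mul1r mulrDl. Qed.

Lemma ev_zpow k : ev (zpow k) = (x + y) ^+ k.
Proof. by elim: k => [|k IH]; [exact: evm_word|rewrite /= ev_mulz IH exprSr]. Qed.

Lemma ev_zopp p : ev (zopp p) = - ev p.
Proof. by rewrite evm_zscale NegzE mulrNz mulr1z. Qed.

Lemma ev_relsR N : x ^+ 2 = 0 -> y ^+ 3 = 0 -> (x + y) ^+ N = 0 ->
  forall p, p \in relsR N -> ev p = 0.
Proof.
move=> x2 y3 zN p; rewrite !inE => /or3P[] /eqP->; last by rewrite ev_zpow.
- by rewrite evm_word /= mul1r -expr2.
- by rewrite evm_word /= mul1r -expr2 -exprSr.
Qed.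
End TwoLetters.

Lemma ev_dpow (K : fieldType) (A : algType K) (x y : A) k w :
  evm (evw (xy x y)) (zdpow k w) = dpow x y k (evw (xy x y) w).
Proof.
elim: k => [|k IH]; first exact: evm_word.
rewrite -[zdpow k.+1 w]/(mulz (zdpow k w) ++ zcatl w (zpow k.+1)).
by rewrite evm_cat ev_mulz ev_zcatl ev_zpow IH.
Qed.

Lemma basisP rs top w d : (d < top)%N -> w \in normal rs d -> w \in basis rs top.
Proof.
move=> ltd win; apply/flattenP; exists (normal rs d) => //.
by apply: map_f; rewrite mem_iota.
Qed.

(** * The filtration by word length *)

Section WordFiltration.
Variables (K : fieldType) (A : algType K) (x y : A).
Local Notation evw := (evw (xy x y)).
Implicit Types (q : seq (K * word)) (r s : A).

(** The formal list is kept apart from its value, so that one expression can be evaluated both in R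
    and in P(E_n). *)
Definition kev q : A := \sum_(m <- q) m.1 *: evw m.2.

Definition wfil (d : nat) r : Prop :=
  exists2 q, all (fun m => binary m.2 && (d <= size m.2)%N) q & r = kev q.

Lemma kev_cons m q : kev (m :: q) = m.1 *: evw m.2 + kev q.
Proof. exact: big_cons. Qed.

Lemma wfil_zero d : wfil d 0.
Proof. by exists [::]; rewrite // /kev big_nil. Qed.

Lemma wfilD d r s : wfil d r -> wfil d s -> wfil d (r + s).
Proof.
move=> [q1 H1 ->] [q2 H2 ->]; exists (q1 ++ q2); first by rewrite all_cat H1.
by rewrite /kev big_cat.
Qed.

Lemma wfilZ d a r : wfil d r -> wfil d (a *: r).
Proof.
move=> [q Hq ->]; exists [seq (a * m.1, m.2) | m <- q]; first by rewrite all_map.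
by rewrite /kev big_map scaler_sumr; apply: eq_bigr => m _; rewrite scalerA.
Qed.

Lemma wfil_word d w : binary w -> (d <= size w)%N -> wfil d (evw w).
Proof.
by move=> bw dw; exists [:: (1, w)]; rewrite /= ?bw ?dw // /kev big_seq1 scale1r.
Qed.

Lemma wfil_sum d I (t : seq I) (F : I -> A) : (forall i, wfil d (F i)) ->
  wfil d (\sum_(i <- t) F i).
Proof. by move=> H; elim/big_ind: _ => // *; [exact: wfil_zero|exact: wfilD]. Qed.

Lemma wfil_le d e r : (d <= e)%N -> wfil e r -> wfil d r.
Proof.
move=> le_de [q Hq ->]; exists q => //; apply: sub_all Hq => m /andP[-> /=].
exact: leq_trans.
Qed.

Lemma wfilM d e r s : wfil d r -> wfil e s -> wfil (d + e) (r * s).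
Proof.
move=> [q1 H1 ->] [q2 H2 ->]; rewrite /kev mulr_suml big_seq.
elim/big_ind: _ => [|*|m1 /(allP H1)/andP[b1 s1]]; [exact: wfil_zero|exact: wfilD|].
rewrite mulr_sumr big_seq.
elim/big_ind: _ => [|*|m2 /(allP H2)/andP[b2 s2]]; [exact: wfil_zero|exact: wfilD|].
rewrite -scalerAl -scalerAr -evw_cat; do 2!apply: wfilZ; apply: wfil_word.
  by rewrite /binary all_cat; apply/andP.
by rewrite size_cat addnC leq_add.
Qed.

Lemma wfil_x : wfil 1 x. Proof. by rewrite -[x]mul1r; apply: (@wfil_word 1 [:: 0%N]). Qed.
Lemma wfil_y : wfil 1 y. Proof. by rewrite -[y]mul1r; apply: (@wfil_word 1 [:: 1%N]). Qed.

Lemma prod_word (s : seq bool) : exists2 w, binary w &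
  \prod_(l <- s) (if l then y else x) = evw w.
Proof.
exists (rev (map nat_of_bool s)).
  by rewrite /binary all_rev; elim: s => // -[] s.
elim/last_ind: s => [|s l IH]; first by rewrite big_nil.
rewrite big_rcons IH map_rcons rev_rcons /=; congr (_ * _); by case: l.
Qed.

Lemma wfil_free_eval F : wfil 0 (free_eval x y F).
Proof.
apply: wfil_sum => w; apply: wfilZ; have [v bv ->] := prod_word w.
exact: wfil_word.
Qed.
End WordFiltration.

(** * The module spanned by the normal words *)

Section NormalForms.
Variables (rs : seq rule) (N top : nat).
Variable ds : seq (nat * nat * nat).
Hypotheses (rsE : rs = rulesR N ds) (check : basis_check rs N top).
Local Notation bs := (basis rs top).
Local Notation f := (step fuel rs).
Local Notation nfw := (nfmul f [:: (Posz 1, [::])]).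

Lemma basis_uniq : uniq bs. Proof. by case/and5P: check. Qed.

Lemma normal_top : normal rs top = [::]. Proof. by case/and5P: check => _ _ /eqP. Qed.

Lemma normal_top_le d : (top <= d)%N -> normal rs d = [::].
Proof.
move=> /subnK <-; elim: (d - top)%N => [|k IH]; first exact: normal_top.
by rewrite addSn /normal iterS -/(normal rs _) IH.
Qed.

Lemma normal_size d w : w \in normal rs d -> size w = d.
Proof.
case: (ltnP d top) => [ltd|/normal_top_le->] // win.
case/and5P: check => _ _ _ /allP/(_ d); rewrite mem_iota ltd => /(_ isT)/allP Hs _.
by case/andP: (Hs _ win) => /eqP.
Qed.

Lemma normal_binary d w : w \in normal rs d -> binary w.
Proof.
case: (ltnP d top) => [ltd|/normal_top_le->] // win.
case/and5P: check => _ _ _ /allP/(_ d); rewrite mem_iota ltd => /(_ isT)/allP Hs _.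
by case/andP: (Hs _ win).
Qed.

Lemma top_gt0 : (0 < top)%N.
Proof. by case: top check => // /and5P[_]; rewrite /basis. Qed.

Lemma nil_basis : [::] \in bs.
Proof. by apply: (basisP top_gt0); rewrite mem_seq1. Qed.

Lemma step_basis b l : b \in bs -> (l < 2)%N -> supp_in bs (f b l).
Proof.
case/and5P: check => _ _ _ _ /allP H /H/andP[/allP Hl _] ltl.
by apply: Hl; rewrite mem_iota.
Qed.

Lemma rel_basis b p : b \in bs -> p \in relsR N ->
  zcomb (nfmul f [:: (Posz 1, b)]) p = [::].
Proof.
by case/and5P: check => _ _ _ _ /allP H /H/andP[_ /allP Hp] /Hp/eqP.
Qed.

Lemma nfmul_basis p w : binary w -> supp_in bs p -> supp_in bs (nfmul f p w).
Proof.
elim: w => //= l w IH /andP[ltl bw] pin.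
by apply: supp_in_zcomb (IH bw pin) => b bin; apply: step_basis.
Qed.

Lemma nfw_normal w : binary w -> supp_in (normal rs (size w)) (nfw w).
Proof.
elim: w => [|l w IH] //= /andP[ltl bw].
by apply: supp_in_zcomb (IH bw) => b bin; apply: supp_in_next.
Qed.

Variable K : fieldType.
Local Notation m := (size bs).-1.

Lemma size_bs : size bs = m.+1.
Proof. by case: bs nil_basis. Qed.

Definition dv (w : word) : 'rV[K]_m.+1 := \row_j (nth [::] bs j == w)%:R.
Local Notation rv := (evm dv).

(** Row vectors are acted on from the right, so matrices multiply in the order of the letters of a
    word. *)
Definition act (l : nat) : 'M[K]_m.+1 := \matrix_(i < m.+1) rv (f (nth [::] bs i) l).

Lemma dv_act w l : w \in bs -> dv w *m act l = rv (f w l).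
Proof.
move=> win; have ltw : (index w bs < m.+1)%N by rewrite -size_bs index_mem.
rewrite mulmx_sum_row (bigD1 (Ordinal ltw)) //= big1 ?addr0 => [|i ni].
  by rewrite mxE nth_index // eqxx scale1r rowK nth_index.
rewrite mxE; case: eqP => [E|_]; last by rewrite scale0r.
case/eqP: ni; apply: val_inj => /=; rewrite -E index_uniq ?basis_uniq //.
by apply: leq_trans (ltn_ord i) _; apply: eq_leq (esym size_bs).
Qed.

Lemma rv_act p l : supp_in bs p -> rv p *m act l = rv (zcomb (f^~ l) p).
Proof.
move=> pin; rewrite evm_zcomb [X in X *m _]/evm mulmx_suml big_seq [RHS]big_seq.
apply: eq_bigr => c cin; rewrite -dv_act; last exact: (allP pin).
exact: (raddfMz (mulmxr (act l))).
Qed.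

Lemma rv_sum (V : lmodType K) (g : word -> V) p : supp_in bs p ->
  \sum_(j < m.+1) rv p 0 j *: g (nth [::] bs j) = evm g p.
Proof.
elim: p => [_|c p IH /andP[cin /IH {}IH]].
  by rewrite !evm_nil big1 // => j _; rewrite mxE scale0r.
have E j : rv (c :: p) 0 j = (nth [::] bs j == c.2)%:R *~ c.1 + rv p 0 j.
  by rewrite evm_cons mxE -scaler_int 2!mxE mulrzl.
under eq_bigr do rewrite E scalerDl.
rewrite big_split /= evm_cons -IH; congr (_ + _).
have ltc : (index c.2 bs < m.+1)%N by rewrite -size_bs index_mem.
rewrite (bigD1 (Ordinal ltc)) //= big1 ?addr0 => [|j nj].
  by rewrite nth_index // eqxx scaler_int.
case: eqP => [Ej|_]; last by rewrite mul0rz scale0r.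
case/eqP: nj; apply: val_inj => /=; rewrite -Ej index_uniq ?basis_uniq //.
by apply: leq_trans (ltn_ord j) _; apply: eq_leq (esym size_bs).
Qed.

Lemma rv_evw p w : binary w -> supp_in bs p ->
  rv p *m evw (xy (act 0) (act 1)) w = rv (nfmul f p w).
Proof.
move=> + pin; elim: w => /= [_|l w IH /andP[ltl bw]]; first exact: mulmx1.
rewrite -rv_act; last exact: nfmul_basis.
by rewrite -IH // mulmxA; case: l ltl => [|[]].
Qed.

Lemma relsR_binary p c : p \in relsR N -> c \in p -> binary c.2.
Proof.
rewrite !inE => /or3P[] /eqP->; try by rewrite inE => /eqP->.
suff: all (fun c => binary c.2) (zpow N) by move/allP; apply.
elim: N => //= k IH; rewrite all_cat !all_map.
by apply/andP; split; apply: sub_all IH.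
Qed.

Lemma rel_act p : p \in relsR N -> evm (evw (xy (act 0) (act 1))) p = 0.
Proof.
move=> pin; set E := evm _ _; apply/row_matrixP => i.
have ltib : (i < size bs)%N.
  by apply: leq_trans (ltn_ord i) _; apply: eq_leq (esym size_bs).
have bin := mem_nth [::] ltib; set b := nth _ _ _ in bin.
have -> : row i E = dv b *m E.
  rewrite mulmx_sum_row (bigD1 i) //= big1 ?addr0 => [|j ji].
    by rewrite mxE eqxx scale1r.
  rewrite mxE nth_uniq ?basis_uniq //; first by rewrite (negPf (ji : val j != i)) scale0r.
  by apply: leq_trans (ltn_ord j) _; apply: eq_leq (esym size_bs).
rewrite row0 -[dv b]evm_word /E [X in _ *m X]/evm mulmx_sumr.
have := congr1 rv (rel_basis bin pin); rewrite evm_nil evm_zcomb => E0.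
apply: etrans E0; rewrite big_seq [RHS]big_seq; apply: eq_bigr => c cin.
rewrite -rv_evw ?(relsR_binary pin cin) //; last by rewrite /supp_in /= bin.
exact: (raddfMz (mulmx _)).
Qed.

Variable S : freeAlg K -> Prop.
Hypothesis SE : forall s, S s -> [\/ s = freeX ^+ 2, s = freeY ^+ 3 | s = (freeX + freeY) ^+ N].
Hypotheses (SX : S (freeX ^+ 2)) (SY : S (freeY ^+ 3)) (SZ : S ((freeX + freeY) ^+ N)).

Local Notation rep := (free_eval (act 0) (act 1) : {lrmorphism freeAlg K -> 'M[K]_m.+1}).

Lemma rep_rel s : S s -> rep s = 0.
Proof.
have E p : p \in relsR N -> evm (evw (xy (act 0) (act 1))) p = 0 by apply: rel_act.
have EX := free_evalX (act 0) (act 1); have EY := free_evalY (act 0) (act 1).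
case/SE => ->; rewrite rmorphXn ?rmorphD /= ?EX ?EY.
- by have := E _ (mem_head _ _); rewrite evm_word /= mul1r expr2.
- have := E [:: (Posz 1, [:: 1; 1; 1])%N]; rewrite !inE eqxx orbT evm_word /= mul1r.
  by rewrite exprSr expr2; apply.
- by have := E (zpow N); rewrite ev_zpow !inE eqxx !orbT; apply.
Qed.

(** R maps to a matrix algebra of positive size. *)
Lemma one_notin : ~ in_ideal S 1.
Proof.
move/(in_ideal_ker rep_rel); rewrite rmorph1 => /eqP; exact/negP/oner_neq0.
Qed.

Local Notation R := (nzpres one_notin).
Local Notation x := (npi one_notin freeX).
Local Notation y := (npi one_notin freeY).
Local Notation evr := (evw (xy x y)).

Lemma relR_holds p : p \in relsR N -> evm evr p = 0.
Proof.
have np s : S s -> npi one_notin s = 0 by move=> Ss; apply/npi_eq0/gen_in_ideal.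
have xyE : x + y = npi one_notin (freeX + freeY) by exact: esym (rmorphD _ _ _).
have npX s k : S (s ^+ k) -> npi one_notin s ^+ k = 0.
  by move=> Ss; exact: etrans (esym (rmorphXn _ _ _)) (np _ Ss).
move: p; apply: ev_relsR; [exact: npX SX|exact: npX SY|].
exact: etrans (congr1 (fun t => t ^+ N) xyE) (npX _ _ SZ).
Qed.

Lemma wfil0 r : wfil x y 0 r.
Proof.
elim/npiP: r => F; rewrite -[F]free_evalE rmorph_free_eval; exact: wfil_free_eval.
Qed.

Lemma valid_R : valid (xy x y) rs.
Proof. by rewrite rsE; apply: rulesP => p; apply: relR_holds. Qed.

Lemma evr_nfw w : evr w = evm evr (nfw w).
Proof.
rewrite ev_nfmul ?evm_word ?mul1r // => v l; apply: ev_step; exact: valid_R.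
Qed.

(** There are no normal words of degree [top] or more, so words of such length have an empty normal
    form. *)
Lemma wfil_top r : wfil x y top r -> r = 0.
Proof.
case=> q Hq ->; rewrite /kev big_seq big1 // => c /(allP Hq)/andP[bw sw].
have := nfw_normal bw; rewrite normal_top_le // evr_nfw.
by case: (nfw c.2) => // _; rewrite evm_nil scaler0.
Qed.

Lemma zR : (x + y) ^+ N = 0.
Proof. by rewrite -ev_zpow relR_holds // !inE eqxx !orbT. Qed.

(* The normal form of an element of R, seen through the representation on the
   span of the normal words, followed by the linear map with values [L]. *)
Definition coordmap (L : word -> R) (r : R) : R :=
  \sum_(j < m.+1) (dv [::] *m nlift rep_rel r) 0 j *: L (nth [::] bs j).

Lemma coordmap_is_linear L : linear (coordmap L).
Proof.
move=> a r s; rewrite /coordmap scaler_sumr -big_split; apply: eq_bigr => j _ /=.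
by rewrite (linearP (nlift rep_rel)) mulmxDr -scalemxAr !mxE scalerDl scalerA.
Qed.
HB.instance Definition _ L := GRing.isLinear.Build K R R *:%R (coordmap L) (coordmap_is_linear L).

(** Acting on the empty word reproduces the normal form of w. This is what makes a map prescribed on
    normal words independent of how an element of R is written. *)
Lemma coordmap_word L w : binary w -> coordmap L (evr w) = evm L (nfw w).
Proof.
move=> bw; rewrite /coordmap.
have -> : nlift rep_rel (evr w) = evw (xy (act 0) (act 1)) w.
  have EX := free_evalX (act 0) (act 1); have EY := free_evalY (act 0) (act 1).
  elim: w {bw} => [|l w IH] /=; first exact: rmorph1.
  rewrite rmorphM /= IH; congr (_ * _).
  by case: l => [|l] /=; rewrite nliftE /= ?EX ?EY.
have nil_in : supp_in bs [:: (Posz 1, [::])] by rewrite /supp_in /= nil_basis.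
rewrite -[dv _]evm_word rv_evw //; apply: rv_sum; exact: nfmul_basis.
Qed.
End NormalForms.

(** * Soundness of the certificates *)

Section Certificates.
Variables (K : fieldType) (R : algType K) (x y : R) (rs : seq rule) (N' top : nat).
Local Notation N := N'.+1.
Local Notation z := (x + y).
Local Notation evr := (evw (xy x y)).
Local Notation fil := (wfil x y).
Local Notation nfw := (nfmul (step fuel rs) [:: (Posz 1, [::])]).
Hypotheses (check : basis_check rs N top) (rs_valid : valid (xy x y) rs).
Hypothesis fil0 : forall r, fil 0 r.
Hypothesis coord : forall L : word -> R,
  exists T : {linear R -> R}, forall w, binary w -> T (evr w) = evm L (nfw w).

Lemma fil_normal_form d r : fil d r ->
  exists q, [/\ all (fun m => m.2 \in normal rs d) q & fil d.+1 (r - kev x y q)].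
Proof.
case=> q Hq ->; elim: q Hq => [_|c q IH /andP[/andP[bc sc] /IH[q' [Hq' rq']]]].
  by exists [::]; rewrite /kev !big_nil subrr; split=> //; apply: wfil_zero.
rewrite kev_cons; case: (ltngtP d (size c.2)) sc => // [lt|dE] _.
  exists q'; split=> //; rewrite -addrA; apply: wfilD => //.
  by apply/wfilZ/wfil_word.
exists ([seq (c.1 * m.1%:~R, m.2) | m <- nfw c.2] ++ q'); split.
  rewrite all_cat Hq' andbT all_map; have := nfw_normal rs bc.
  by rewrite -dE; apply: sub_all.
rewrite /kev big_cat big_map /= -!/(kev _ _ _).
have -> : c.1 *: evr c.2 = \sum_(m <- nfw c.2) (c.1 * m.1%:~R) *: evr m.2.
  have -> : evr c.2 = evm evr (nfw c.2).
    rewrite ev_nfmul ?evm_word ?mul1r // => v l; exact: ev_step.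
  rewrite scaler_sumr; apply: eq_bigr => m _.
  by rewrite -scalerA scaler_int.
by rewrite opprD addrACA subrr add0r.
Qed.

Lemma fil_supp d p : supp_in (normal rs d) p -> fil d (evm evr p).
Proof.
elim: p => [|c p IH] /=; first by rewrite evm_nil => _; apply: wfil_zero.
case/andP=> cin /IH Hp; rewrite evm_cons -scaler_int; apply: wfilD => //.
apply/wfilZ/wfil_word; first exact: normal_binary check _ _ cin.
by rewrite (normal_size check cin).
Qed.

Lemma supp_lookup ws M ws' w : supp_in ws' (lookup ws (rows M ws') w).
Proof.
rewrite /lookup; case: ifP => // _; case: (ltnP (index w ws) (size M)) => [lt|ge]; last first.
  by rewrite nth_default // size_map.
rewrite (nth_map [::]) //; elim: (nth _ M _) ws' => [|c r IH] [|v vs] //=.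
rewrite mem_head; apply: sub_all (IH vs) => m min; rewrite inE min; exact: orbT.
Qed.

Lemma coord_nf (L : word -> zpoly) (T : {linear R -> R}) p :
  (forall w, binary w -> T (evr w) = evm (fun v => evm evr (L v)) (nfw w)) ->
  all (fun m => binary m.2) p -> T (evm evr p) = evm evr (zcomb L (nf rs p)).
Proof.
move=> TE bp; rewrite [in RHS]evm_zcomb -/(evm (fun v => evm evr (L v)) _) evm_zcomb.
rewrite /evm linear_sum big_seq [RHS]big_seq; apply: eq_bigr => c cin.
by rewrite raddfMz /= TE // (allP bp).
Qed.

Lemma zdpow_binary k w : binary w -> all (fun m => binary m.2) (zdpow k w).
Proof.
move=> bw; have mulz_binary p : all (fun m => binary m.2) p -> all (fun m => binary m.2) (mulz p).
  by move=> bp; rewrite all_cat !all_map; apply/andP; split; apply: sub_all bp.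
have zpow_binary j : all (fun m => binary m.2) (zpow j).
  by elim: j => // j; apply: mulz_binary.
elim: k => [|k IH]; first by rewrite /= bw.
rewrite -[zdpow k.+1 w]/(mulz (zdpow k w) ++ zcatl w (zpow k.+1)) all_cat mulz_binary //=.
rewrite all_map; apply: sub_all (zpow_binary k.+1) => m bm.
by rewrite /= /binary all_cat [all _ w]bw.
Qed.

Lemma dpow_linear k : linear (dpow x y k).
Proof.
move=> a r s; elim: k => //= k ->.
rewrite (mulrDl (a *: dpow x y k r)) (mulrDr (_ ^+ _) (a *: r)).
by rewrite -scalerAl -scalerAr addrACA -scalerDr.
Qed.
HB.instance Definition _ k := GRing.isLinear.Build K R R *:%R (dpow x y k) (dpow_linear k).

(** Summing the certified identity over the normal words in the leading term H of h gives H = T(dpow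
    N' H) + [S, z] + c z^(d+1). The map T reads only degree d + 1 + N', where [dpow N' h] has no
    component, so the first term drops out. *)
Lemma kernel_cert_sound d C h : kernel_check rs N' d C -> fil d.+1 h ->
  fil (d.+1 + N) (dpow x y N' h) ->
  exists s, exists2 c : K, fil d s & fil d.+2 (h - (s * z - z * s) - c *: z ^+ d.+1).
Proof.
case: C => [[M S_] k] Hchk Hh Dh.
set B := normal rs d.+1; set B' := normal rs d; set U := normal rs (d.+1 + N').
pose L := lookup U (rows M B); pose s b := lookup B (rows S_ B') b.
have [T TE] := coord (fun v => evm evr (L v)).
have bE b : b \in B -> evr b = T (dpow x y N' (evr b))
    + (evm evr (s b) * z - z * evm evr (s b)) + ((nth (Posz 0) k (index b B))%:~R : K) *: z ^+ d.+1.
  move=> bin; have /(zero_nf rs_valid) := allP Hchk b bin.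
  rewrite evm_cons 3!evm_cat !ev_zopp evm_zscale ev_zpow ev_mulz ev_zmul -/B -/B' -/U -/L -/(s b).
  rewrite -(coord_nf TE); last exact/zdpow_binary/(normal_binary check bin).
  rewrite ev_dpow scaler_int /= => E.
  apply/eqP; rewrite -subr_eq0 -[X in _ == X]E; apply/eqP.
  move: (T _) (evm evr (s b)) (_ *~ nth _ _ _) => t e f; ncring.
(* [L] is zero outside the normal words of degree d + 1 + N', and normal forms preserve the
   degree. *)
have Tker r : fil (d.+1 + N) r -> T r = 0.
  case=> q Hq ->; rewrite /kev linear_sum big_seq big1 // => c /(allP Hq)/andP[bc sc].
  rewrite linearZ /= TE // [evm _ _]big_seq big1 ?scaler0 // => m min.
  rewrite /L /lookup; case: ifP => [mU|]; last by rewrite evm_nil mul0rz.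
  have := normal_size check (allP (nfw_normal rs bc) _ min).
  by rewrite (normal_size check mU) => E; move: sc; rewrite -E addnS ltnn.
have [q [Hq Hr]] := fil_normal_form Hh.
set H := kev x y q in Hr; set h' := h - H in Hr.
have THD : T (dpow x y N' H) = 0.
  have -> : H = h - h' by rewrite /h' opprB addrC subrK.
  rewrite linearB linearB /= (Tker _ Dh) Tker ?subr0 //.
  rewrite addnS -addSn.
  apply: (fil_dpow fil0 (@wfilD _ _ x y) (@wfilM _ _ x y)) => //.
    exact: wfil_x.
  exact: wfil_y.
suff [S [c HS HE]] : exists S, exists2 c : K, fil d S &
    H - (S * z - z * S) - c *: z ^+ d.+1 = T (dpow x y N' H).
  exists S, c => //; rewrite -[h](subrK H) -/h'.
  by rewrite -addrA -addrA [_ + (- _ - _)]addrA HE THD addr0.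
clear h' Hr THD; rewrite {}/H; elim: q Hq => [_|c q IH /andP[cin /IH[S [a HS HE]]]].
  exists 0, 0; first exact: wfil_zero.
  by rewrite /kev big_nil mul0r mulr0 scale0r !subr0 (linear0 (dpow x y N')) linear0.
exists (c.1 *: evm evr (s c.2) + S), (c.1 * (nth (Posz 0) k (index c.2 B))%:~R + a).
  by apply: wfilD => //; apply/wfilZ/fil_supp/supp_lookup.
rewrite kev_cons dpow_linear linearP -HE.
rewrite [in LHS](bE _ cin) -/B; move: (T _) (evm evr (s _)) => t e.
move: z => u; move: (u ^+ d.+1) => zz.
rewrite !scalerDr scalerN (scalerAl _ e) (scalerAr _ u) scalerA scalerDl.
move: (c.1 *: e) (_ *: zz) (a *: zz) (c.1 *: t) => v1 v2 v3 v4; ncring.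
Qed.

(** The certificate expresses 2 b, not b, by commutators. Dividing by 2 is the only use of the
    assumption on the characteristic. *)
Lemma commutator_cert_sound d C h : commutator_check rs d C -> (2%:R : K) != 0 ->
  fil d.+1 h ->
  exists s, exists2 t, fil d s & fil d t /\
    fil d.+2 (h - (s * x - x * s) - (t * y - y * t)).
Proof.
case: C => [S_ T_] Hchk K2 Hh; set B := normal rs d.+1; set B' := normal rs d.
pose s b := lookup B (rows S_ B') b; pose t b := lookup B (rows T_ B') b.
have bE b : b \in B -> evr b = 2%:R^-1 *: (evm evr (s b) * x - x * evm evr (s b)
    + (evm evr (t b) * y - y * evm evr (t b))).
  move=> bin; have /(zero_nf rs_valid) := allP Hchk b bin.
  rewrite evm_cons 3!evm_cat !ev_zopp !ev_zcatl !ev_zcat -/B -/B' -/(s b) -/(t b) /= !mul1r.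
  move=> E; apply: (scalerI K2); rewrite scalerA divff // scale1r scaler_nat.
  apply/eqP; rewrite -subr_eq0 -[X in _ == X]E; apply/eqP; rewrite -[evr b *~ 2]/(evr b *+ 2).
  have I (v e f : R) : v - (e * x - x * e + (f * y - y * f))
    = v + (- (e * x) + (x * e + (- (f * y) + y * f))) by ncring.
  exact: I.
have [q [Hq Hr]] := fil_normal_form Hh.
suff [S [T [HS HT HE]]] : exists S T, [/\ fil d S, fil d T &
    kev x y q = S * x - x * S + (T * y - y * T)] by
  exists S, T => //; split=> //; rewrite -addrA -opprD -HE.
elim: q Hq {Hr} => [_|c q IH /andP[cin /IH[S [T [HS HT HE]]]]].
  exists 0, 0; split; try exact: wfil_zero.
  by rewrite /kev big_nil !mul0r !mulr0 !subrr addr0.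
pose a := c.1 * 2%:R^-1.
exists (a *: evm evr (s c.2) + S), (a *: evm evr (t c.2) + T); split.
- by apply: wfilD => //; apply/wfilZ/fil_supp/supp_lookup.
- by apply: wfilD => //; apply/wfilZ/fil_supp/supp_lookup.
rewrite kev_cons HE (bE _ cin) scalerA -/a.
move: (evm _ _) (evm _ _) => e f; rewrite !scalerDr !scalerN.
rewrite (scalerAl a e) (scalerAr a x) (scalerAl a f) (scalerAr a y).
move: (a *: e) (a *: f) => e' f'; ncring.
Qed.
End Certificates.

(** * Transport of the solution to other algebras *)

Section Transport.
Variables (K : fieldType) (A B : algType K) (f : {lrmorphism A -> B}) (x y : A).

Lemma rmorph_evw w : f (evw (xy x y) w) = evw (xy (f x) (f y)) w.
Proof.
elim: w => [|l w IH] /=; first exact: rmorph1.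
by rewrite rmorphM /= IH; case: l.
Qed.

Lemma rmorph_kev q : f (kev x y q) = kev (f x) (f y) q.
Proof.
rewrite /kev raddf_sum; apply: eq_bigr => m _.
by rewrite /= linearZ /= rmorph_evw.
Qed.

Lemma rmorph_horner_alg (t : A) (g : {poly K}) : f (horner_alg t g) = horner_alg (f t) g.
Proof.
elim/poly_ind: g => [|g c IH]; first by rewrite !rmorph0.
by rewrite !rmorphD !rmorphM /= IH !horner_algX !horner_algC rmorph_alg.
Qed.

Lemma rmorph_conjugate p p' q q' u u' F (g : {poly K}) :
  let X := p * x * p' in let Y := q * y * q' in
  X + Y + free_eval X Y F = u * ((x + y) * horner_alg (x + y) g) * u' ->
  let X := f p * f x * f p' in let Y := f q * f y * f q' in
  X + Y + free_eval X Y F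
    = f u * ((f x + f y) * horner_alg (f x + f y) g) * f u'.
Proof.
move=> X Y E X' Y'.
have XE : X' = f X by rewrite !rmorphM. have YE : Y' = f Y by rewrite !rmorphM.
have := congr1 f E; rewrite !rmorphD /= rmorph_free_eval XE YE => ->.
by rewrite !rmorphM /= rmorph_horner_alg rmorphD.
Qed.
End Transport.

Definition unip_list (K : fieldType) (q : seq (K * word)) : bool :=
  all (fun m => binary m.2 && (0 < size m.2)%N) q.

Section UnipotentPair.
Variables (K : fieldType) (B : algType K) (x y : B) (q q' : seq (K * word)).
Definition inv_pair : Prop :=
  [/\ unip_list q, unip_list q', (1 + kev x y q) * (1 + kev x y q') = 1 &
      (1 + kev x y q') * (1 + kev x y q) = 1].
End UnipotentPair.

Section Relations.
Variables (n N' d0 top : nat) (ds : seq (nat * nat * nat)).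
Variables (Ck : seq kernel_cert) (Cc : seq commutator_cert).
Local Notation N := N'.+1.
Local Notation rs := (rulesR N ds).
Hypotheses (nE : (n - 3)%N = N) (check : basis_check rs N top)
  (kchk : kernel_checks rs N' d0 Ck) (cchk : commutator_checks rs d0 top Cc)
  (d0_gt1 : (1 < d0)%N) (d0_top : (d0 <= top)%N).
Variables (K : fieldType) (K2 : (2%:R : K) != 0).
Local Notation S := (@RE_relation n K).

Lemma RE_relationE s : S s ->
  [\/ s = freeX ^+ 2, s = freeY ^+ 3 | s = (freeX + freeY) ^+ N].
Proof. by case; rewrite ?nE; [constructor 1|constructor 2|constructor 3]. Qed.

Lemma RE_relN : S ((freeX + freeY) ^+ N).
Proof. by rewrite -nE; constructor. Qed.

Let H1 := one_notin check RE_relationE.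
Local Notation R := (nzpres H1).
Local Notation x := (npi H1 freeX).
Local Notation y := (npi H1 freeY).

(** The solution in R is recorded by lists of words and a polynomial g, the same for all B. Two
    elements of B that satisfy the relations define a morphism from R to B, which carries along the
    inverses and the equation. *)
Lemma RE_conjugate (F : freeAlg K) : monomials_deg_ge2 F ->
  (RE_pi n freeX + RE_pi n freeY + RE_pi n F) ^+ (n - 3) = 0 ->
  exists p p' q q' u u' (g : {poly K}), g.[0] = 1 /\
  forall (B : algType K) (x y : B), x ^+ 2 = 0 -> y ^+ 3 = 0 -> (x + y) ^+ N = 0 ->
  [/\ inv_pair x y p p', inv_pair x y q q', inv_pair x y u u' &
    let X := (1 + kev x y p) * x * (1 + kev x y p') in
    let Y := (1 + kev x y q) * y * (1 + kev x y q') in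
    X + Y + free_eval X Y F
    = (1 + kev x y u) * ((x + y) * horner_alg (x + y) g) * (1 + kev x y u')].
Proof.
move=> degF; rewrite nE => admF.
have fE G : npi H1 G = free_eval x y G by rewrite -rmorph_free_eval free_evalE.
have {}admF : (x + y + free_eval x y F) ^+ N = 0 by rewrite -fE; exact: admF.
have SX : S (freeX ^+ 2) by exact: RE_relx.
have SY : S (freeY ^+ 3) by exact: RE_rely.
have f0 : forall r : R, wfil x y 0 r by move=> r; apply: wfil0.
have ftop : forall r : R, wfil x y top r -> r = 0.
  by move=> r; apply: (wfil_top (erefl _)) => //; exact: RE_relN.
have zN : (x + y) ^+ N = 0 by apply: zR => //; exact: RE_relN.
have val : valid (xy x y) rs.
  by apply: (valid_R (erefl _)) => //; exact: RE_relN.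
have coord (L : word -> R) : exists T : {linear R -> R},
    forall w, binary w -> T (evw (xy x y) w) = evm L (nfmul (step fuel rs) [:: (Posz 1, [::])] w).
  by exists (@coordmap rs N top check K S RE_relationE L) => w bw; apply: coordmap_word.
have ker (d : nat) (h : R) : (1 <= d)%N -> (d.+1 < d0)%N -> wfil x y d.+1 h ->
    wfil x y (d.+1 + N) (dpow x y N' h) -> exists s, exists2 c : K, wfil x y d s &
      wfil x y d.+2 (h - (s * (x + y) - (x + y) * s) - c *: (x + y) ^+ d.+1).
  move=> d1 ltd Hh Dh.
  apply: (kernel_cert_sound check val f0 coord (allP kchk d _)) => //.
  by rewrite mem_iota d1 /=; case: d0 ltd => [|[]].
have comm (d : nat) (h : R) : (d0 <= d.+1)%N -> (1 <= d)%N -> wfil x y d.+1 h ->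
    exists s, exists2 t, wfil x y d s &
      wfil x y d t /\ wfil x y d.+2 (h - (s * x - x * s) - (t * y - y * t)).
  move=> led d1 Hh; case: (ltnP d.+1 top) => [ltt|get].
    apply: (commutator_cert_sound check val (allP cchk d _)) => //.
    rewrite mem_iota; apply/andP; split; first by rewrite -ltnS prednK // ltnW.
    by rewrite -ltnS -addSn prednK ?subnKC //; apply: ltnW.
  (* Beyond the certified degrees nothing is left of R. *)
  have -> : h = 0 by apply/ftop/(wfil_le get).
  by exists 0, 0; rewrite ?mul0r ?mulr0 ?subrr; [|split]; apply: wfil_zero.
have [P [P' [Q [Q' [U [U' [g [HP HQ HU g0 E]]]]]]]] := admissible_conjugate f0
  (@wfilD _ _ x y) (@wfilM _ _ x y) (@wfilZ _ _ x y) (@wfil_le _ _ x y) ftop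
  (@wfil_zero _ _ x y) (wfil_x _ _) (wfil_y _ _) zN ker comm degF admF d0_gt1 d0_top.
have listE (r : R) : wfil x y 1 (r - 1) -> exists2 l, unip_list l & r = 1 + kev x y l.
  by case=> l Hl E'; exists l => //; rewrite -E' addrC subrK.
have [PP' P'P /listE[p Hp pE] /listE[p' Hp' p'E]] := HP.
have [QQ' Q'Q /listE[q Hq qE] /listE[q' Hq' q'E]] := HQ.
have [UU' U'U /listE[u Hu uE] /listE[u' Hu' u'E]] := HU.
exists p, p', q, q', u, u', g; split=> // B x1 y1 x2 y3 z4.
have fS : forall s, S s -> (free_eval x1 y1 : {lrmorphism freeAlg K -> B}) s = 0.
  have EX := free_evalX x1 y1; have EY := free_evalY x1 y1.
  by move=> s /RE_relationE[] ->; rewrite rmorphXn ?rmorphD /= ?EX ?EY.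
pose psi : {lrmorphism R -> B} := nlift fS.
have psix : psi x = x1 by rewrite -[LHS]/(nlift fS x) nliftE; apply: free_evalX.
have psiy : psi y = y1 by rewrite -[LHS]/(nlift fS y) nliftE; apply: free_evalY.
clearbody psi; have psik l : psi (1 + kev x y l) = 1 + kev x1 y1 l.
  by rewrite rmorphD rmorph1 /= rmorph_kev psix psiy.
have pair a a' r r' : unip_list a -> unip_list a' -> r = 1 + kev x y a ->
    r' = 1 + kev x y a' -> r * r' = 1 -> r' * r = 1 -> inv_pair x1 y1 a a'.
  move=> Ha Ha' rE r'E rr' r'r; split=> //; rewrite -!psik -rE -r'E -rmorphM.
    by rewrite rr' rmorph1.
  by rewrite r'r rmorph1.
split; [exact: pair pE p'E _ _|exact: pair qE q'E _ _|exact: pair uE u'E _ _|].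
rewrite -!psik -pE -p'E -qE -q'E -uE -u'E -psix -psiy.
exact: rmorph_conjugate E.
Qed.
End Relations.

(** * Path algebras *)

Section PathExtension.
Variables (K : fieldType) (Q : quiver).
Local Notation KQ := (pathAlg K Q).
Local Notation pe := (@path_elt K Q).
Implicit Types (u : KQ) (p : qpath Q).

Lemma path_eltZ (a : K) p : << a *g p >> = a *: pe p :> KQ.
Proof. by rewrite palg_scaleU mulr1. Qed.

Lemma path_eltM p p' : pe p * pe p' = oapp pe 0 (qcat p p').
Proof.
by apply: etrans (palg_mulUU 1 1 p p') _; rewrite /pcat mulr1; case: qcat.
Qed.

Section Ext.
Variables (V : lmodType K) (f : qpath Q -> V).
Definition pext u : V := \sum_(p <- msupp u) u@_p *: f p.

Lemma pextEw (d : {fset qpath Q}) u : (msupp u `<=` d)%fset ->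
  pext u = \sum_(p <- d) u@_p *: f p.
Proof.
move=> le; rewrite /pext (big_fset_incl _ le) //= => p _ /mcoeff_outdom->.
by rewrite scale0r.
Qed.

Lemma pext_is_linear : linear pext.
Proof.
move=> a u v; set d := (msupp (a *: u + v) `|` (msupp u `|` msupp v))%fset.
have sub1 : (msupp (a *: u + v) `<=` d)%fset by apply: fsubsetUl.
have sub2 : (msupp u `<=` d)%fset.
  exact: fsubset_trans (fsubsetUl _ _) (fsubsetUr _ _).
have sub3 : (msupp v `<=` d)%fset.
  exact: fsubset_trans (fsubsetUr _ _) (fsubsetUr _ _).
rewrite (pextEw sub1) (pextEw sub2) (pextEw sub3).
rewrite scaler_sumr -big_split /=; apply: eq_bigr => p _.
by rewrite mcoeffD mcoeffZ scalerDl scalerA.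
Qed.
HB.instance Definition _ := GRing.isLinear.Build K KQ V *:%R pext pext_is_linear.

Lemma pext_path p : pext (pe p) = f p.
Proof.
by rewrite /pext msuppU oner_eq0 big_seq_fset1 mcoeffUU scale1r.
Qed.
End Ext.

Definition pev (q : seq (K * qpath Q)) : KQ := \sum_(m <- q) m.1 *: pe m.2.

Lemma pevE u : exists2 q, u = pev q & forall m, m \in q -> m.2 \in msupp u.
Proof.
exists [seq (u@_p, p) | p <- msupp u].
  rewrite {1}[u]monalgE /pev big_map; apply: eq_bigr => p _; exact: path_eltZ.
by move=> m /mapP[p pin ->].
Qed.

Lemma pev_ind (P : KQ -> Prop) : P 0 -> (forall u v, P u -> P v -> P (u + v)) ->
  (forall a u, P u -> P (a *: u)) -> (forall p, P (pe p)) -> forall u, P u.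
Proof.
move=> P0 PD PZ PU u; have [q -> _] := pevE u.
by rewrite /pev; elim/big_ind: _ => // m _; apply: PZ.
Qed.
End PathExtension.

(** * The universal property of a path algebra *)

Section PathMorphism.
Variables (K : fieldType) (Q : quiver) (A : algType K).
Variables (e : vert Q -> A) (al : arr Q -> A).
Local Notation KQ := (pathAlg K Q).

(** The data that define a morphism from the path algebra. Idempotents may be zero, as in
    [vertex0_rep]. *)
Definition quiver_rep : Prop :=
  [/\ forall u v, e u * e v = if u == v then e u else 0, \sum_v e v = 1,
      forall a, e (src a) * al a = al a & forall a, al a * e (tgt a) = al a].

Hypothesis rep : quiver_rep.

Definition arrows_val (s : seq (arr Q)) : A := \prod_(a <- s) al a.
Definition path_val (p : qpath Q) : A := e p.1 * arrows_val p.2.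

Lemma path_val_end p : path_val p * e (qend p) = path_val p.
Proof.
have [eM _ _ e_tgt] := rep; rewrite /path_val /qend; case: (val p) => v s /=.
elim/last_ind: s => [|s a _]; first by rewrite /arrows_val big_nil mulr1 eM eqxx.
by rewrite map_rcons last_rcons /arrows_val big_rcons /= -!mulrA e_tgt.
Qed.

Lemma path_val_cat p q : path_val p * path_val q = oapp path_val 0 (qcat p q).
Proof.
have [E|ne] := eqVneq (qend p) (qstart q).
  rewrite (qcatE E) /= {2}/path_val mulrA -[e q.1]/(e (qstart q)) -E path_val_end.
  by rewrite /path_val /= /arrows_val big_cat /= mulrA.
rewrite qcat_none /=; last exact/eqP.
have [eM _ _ _] := rep.
by rewrite -path_val_end {2}/path_val mulrA -(mulrA (path_val p)) eM (negPf ne) mulr0 mul0r.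
Qed.

Definition path_hom of quiver_rep : KQ -> A := pext path_val.
Arguments path_hom : simpl never.
Local Notation hom := (path_hom rep).
HB.instance Definition _ := GRing.Linear.copy hom (pext path_val).

Lemma path_hom_path p : hom (path_elt K p) = path_val p.
Proof. exact: pext_path. Qed.

Lemma path_hom_mult : monoid_morphism hom.
Proof.
split.
  have [_ e1 _ _] := rep; rewrite -e1 [1 in LHS]/(palg_one K Q) /palg_one linear_sum.
  apply: eq_bigr => v _.
  by rewrite /= path_hom_path /path_val /arrows_val big_nil mulr1.
have hD u v : hom (u + v) = hom u + hom v by exact: linearD.
have hZ a u : hom (a *: u) = a *: hom u by exact: linearZ.
have h0 : hom 0 = 0 by exact: linear0.
pose mult u v := hom (u * v) = hom u * hom v.
move=> u v; rewrite -/(mult u v); elim/pev_ind: u => [|u1 u2|a u|p].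
- by rewrite /mult mul0r h0 mul0r.
- move=> E1 E2; apply: etrans (congr1 _ (mulrDl u1 u2 v)) _.
  apply: etrans (hD _ _) (etrans (congr2 +%R E1 E2) _).
  exact: etrans (esym (mulrDl _ _ _)) (congr1 ( *%R^~ _) (esym (hD _ _))).
- move=> E; apply: etrans (congr1 _ (esym (scalerAl a u v))) _.
  apply: etrans (hZ _ _) (etrans (congr1 _ E) _).
  exact: etrans (scalerAl _ _ _) (congr1 ( *%R^~ _) (esym (hZ _ _))).
elim/pev_ind: v => [|v1 v2|a v|q].
- by rewrite /mult mulr0 h0 mulr0.
- move=> E1 E2; apply: etrans (congr1 _ (mulrDr _ v1 v2)) _.
  apply: etrans (hD _ _) (etrans (congr2 +%R E1 E2) _).
  exact: etrans (esym (mulrDr _ _ _)) (congr1 ( *%R _) (esym (hD _ _))).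
- move=> E; apply: etrans (congr1 _ (esym (scalerAr a _ v))) _.
  apply: etrans (hZ _ _) (etrans (congr1 _ E) _).
  exact: etrans (scalerAr _ _ _) (congr1 ( *%R _) (esym (hZ _ _))).
rewrite /mult; apply: etrans (congr1 hom (path_eltM K p q)) _.
apply: etrans _ (esym (congr2 *%R (path_hom_path p) (path_hom_path q))).
by rewrite path_val_cat; case: qcat => [r|] //=; apply: path_hom_path.
Qed.
HB.instance Definition _ := GRing.isMonoidMorphism.Build KQ A hom path_hom_mult.

Lemma path_hom_arrow a : hom (path_elt K (arrow_path a)) = al a.
Proof.
have [_ _ e_src _] := rep.
by rewrite path_hom_path /path_val /arrows_val big_seq1 e_src.
Qed.
End PathMorphism.

(** * Grading and filtration by path length *)

Section PathFiltration.
Variables (K : fieldType) (Q : quiver).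
Local Notation KQ := (pathAlg K Q).
Local Notation pe := (@path_elt K Q).
Implicit Types (u v : KQ) (p : qpath Q).

(** A predicate on lengths serves both for the filtration, [pfil], and for the homogeneous parts,
    [phom]. *)
Definition pspan (P : pred nat) u : Prop :=
  exists2 q : seq (K * qpath Q), all (fun m => P (qlen m.2)) q & u = pev q.
Definition pfil l u := pspan (leq l) u.
Definition phom l u := pspan (pred1 l) u.

Lemma pspan0 P : pspan P 0.
Proof. by exists [::]; rewrite // /pev big_nil. Qed.

Lemma pspanD P u v : pspan P u -> pspan P v -> pspan P (u + v).
Proof.
move=> [q Hq ->] [r Hr ->]; exists (q ++ r); first by rewrite all_cat Hq.
by rewrite /pev big_cat.
Qed.

Lemma pspanZ P a u : pspan P u -> pspan P (a *: u).
Proof.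
move=> [q Hq ->]; exists [seq (a * m.1, m.2) | m <- q]; first by rewrite all_map.
by rewrite /pev big_map scaler_sumr; apply: eq_bigr => m _; rewrite scalerA.
Qed.

Lemma pspanN P u : pspan P u -> pspan P (- u).
Proof. by move=> /(pspanZ (- 1)); rewrite scaleN1r. Qed.

Lemma pspan_path (P : pred nat) p : P (qlen p) -> pspan P (pe p).
Proof. by move=> Pp; exists [:: (1, p)]; rewrite /= ?Pp // /pev big_seq1 scale1r. Qed.

Lemma pspan_sub (P P' : pred nat) u : (forall k, P k -> P' k) -> pspan P u -> pspan P' u.
Proof. by move=> PP' [q Hq ->]; exists q => //; apply: sub_all Hq => m; apply: PP'. Qed.

Lemma pspan_ind (P : pred nat) (I : KQ -> Prop) : I 0 ->
  (forall u v, I u -> I v -> I (u + v)) -> (forall a u, I u -> I (a *: u)) ->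
  (forall p, P (qlen p) -> I (pe p)) -> forall u, pspan P u -> I u.
Proof.
move=> I0 ID IZ Ip _ [q Hq ->]; rewrite /pev big_seq.
by elim/big_ind: _ => // m /(allP Hq)/Ip; apply: IZ.
Qed.

Lemma qlen_cat p p' r : qcat p p' = Some r -> qlen r = (qlen p + qlen p')%N.
Proof.
have [E|/eqP ne] := eqVneq (qend p) (qstart p'); last by rewrite qcat_none.
by rewrite (qcatE E) => -[<-]; rewrite /qlen /= size_cat.
Qed.

Lemma pspanM (P1 P2 P3 : pred nat) u v :
  (forall j k, P1 j -> P2 k -> P3 (j + k)%N) ->
  pspan P1 u -> pspan P2 v -> pspan P3 (u * v).
Proof.
move=> PP Hu Hv; move: u Hu; apply: pspan_ind => [|u1 u2 H1 H2|a u H|p Hp].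
- rewrite mul0r; exact: pspan0.
- rewrite (mulrDl u1 u2 v); exact: pspanD.
- rewrite -(scalerAl a u v); exact: pspanZ.
move: v Hv; apply: pspan_ind => [|v1 v2 H1 H2|a v H|p' Hp'].
- rewrite mulr0; exact: pspan0.
- rewrite (mulrDr (pe p) v1 v2); exact: pspanD.
- rewrite -(scalerAr a (pe p) v); exact: pspanZ.
rewrite (path_eltM K p p'); case E: qcat => [r|] /=; last exact: pspan0.
by apply: pspan_path; rewrite (qlen_cat E); apply: PP.
Qed.

Lemma pfilM j k u v : pfil j u -> pfil k v -> pfil (j + k) (u * v).
Proof. by apply: pspanM => j' k'; apply: leq_add. Qed.

Lemma phomM j k u v : phom j u -> phom k v -> phom (j + k) (u * v).
Proof. by apply: pspanM => j' k' /eqP-> /eqP->; rewrite /= eqxx. Qed.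

Lemma pfil_le j k u : (j <= k)%N -> pfil k u -> pfil j u.
Proof. by move=> jk; apply: pspan_sub => i; apply: leq_trans. Qed.

Lemma pfil0 u : pfil 0 u.
Proof.
by have [q -> _] := pevE u; exists q => //; apply/allP => m _; rewrite leq0n.
Qed.

Lemma path_split p k : (k <= qlen p)%N -> exists p1 p2, qlen p1 = k /\ pe p = pe p1 * pe p2.
Proof.
move=> lek; have := qpathP p; rewrite -{1}(cat_take_drop k p.2) walk_cat => /andP[W1 W2].
pose p1 := @QPath Q (p.1, take k p.2) W1; pose p2 := @QPath Q (_, drop k p.2) W2.
exists p1, p2; split; first by rewrite /qlen size_takel.
have E : qend p1 = qstart p2 by [].
rewrite (path_eltM K p1 p2) (qcatE E) /=; congr path_elt; apply: val_inj => /=.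
by rewrite cat_take_drop; case: (val p).
Qed.

Definition pcomp l : KQ -> KQ := pext (fun p => if qlen p == l then pe p else 0).
HB.instance Definition _ l := GRing.Linear.on (pcomp l).

Lemma pcomp_hom l k u : phom k u -> pcomp l u = if k == l then u else 0.
Proof.
pose I v := pcomp l v = if k == l then v else 0.
move: u; apply: (pspan_ind (I := I)); rewrite /I.
- by rewrite linear0 if_same.
- by move=> u v Eu Ev; rewrite linearD /= Eu Ev; case: ifP => //; rewrite addr0.
- by move=> a u Eu; rewrite linearZ /= Eu; case: ifP => //; rewrite scaler0.
by move=> p /eqP pk; rewrite /pcomp pext_path pk.
Qed.

Lemma pcomp_fil l u : pfil l.+1 u -> pcomp l u = 0.
Proof.
pose I v := pcomp l v = 0.
move: u; apply: (pspan_ind (I := I)); rewrite /I.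
- by rewrite linear0.
- by move=> u v Eu Ev; rewrite linearD /= Eu Ev addr0.
- by move=> a u Eu; rewrite linearZ /= Eu scaler0.
by move=> p lt; rewrite /pcomp pext_path gtn_eqF.
Qed.

Lemma pfil_split l u : pfil l u -> exists u0 u1, [/\ phom l u0, pfil l.+1 u1 & u = u0 + u1].
Proof.
pose I v := exists u0 u1, [/\ phom l u0, pfil l.+1 u1 & v = u0 + u1].
move: u; apply: (pspan_ind (I := I)).
- by exists 0, 0; split; [exact: pspan0|exact: pspan0|rewrite addr0].
- move=> _ _ [u0 [u1 [H0 H1 ->]]] [v0 [v1 [G0 G1 ->]]].
  by exists (u0 + v0), (u1 + v1); split; [exact: pspanD|exact: pspanD|exact: addrACA].
- move=> a _ [u0 [u1 [H0 H1 ->]]].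
  by exists (a *: u0), (a *: u1); split; [exact: pspanZ|exact: pspanZ|exact: scalerDr].
move=> p; rewrite leq_eqVlt => /orP[/eqP lE|lt].
  exists (pe p), 0; split; [|exact: pspan0|by rewrite addr0].
  by apply: pspan_path; rewrite /= lE.
by exists 0, (pe p); split; [exact: pspan0|exact: pspan_path|rewrite add0r].
Qed.
End PathFiltration.

(** * Comparison of two quotients by leading terms *)

Section Deformation.
Variables (K : fieldType) (Q : quiver) (B : algType K) (m : nat).
Local Notation KQ := (pathAlg K Q).
Local Notation pe := (@path_elt K Q).
Variables (S0 SF : KQ -> Prop) (pi Phi : {lrmorphism KQ -> B}).
Hypotheses (pi_ker : forall u, pi u = 0 -> in_ideal S0 u)
  (pi_surj : forall b, exists u, b = pi u)
  (S0_hom : forall s, S0 s -> phom 2 s)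
  (S0_def : forall s, S0 s -> exists2 r, pfil 3 r & SF (s + r))
  (SF_path : forall p : qpath Q, qlen p = m -> SF (pe p))
  (pi_path : forall p : qpath Q, qlen p = m -> pi (pe p) = 0)
  (Phi_lead : forall p, exists2 r, pfil (qlen p).+1 r & Phi (pe p) = pi (pe p + r))
  (Phi_SF : forall s, SF s -> Phi s = 0).

Lemma long_pi u : pfil m u -> pi u = 0.
Proof.
pose I v := pi v = 0; move: u; apply: (pspan_ind (I := I)); rewrite /I.
- exact: linear0.
- by move=> u v Eu Ev; rewrite linearD /= Eu Ev addr0.
- by move=> a u Eu; rewrite linearZ /= Eu scaler0.
move=> p /(path_split K)[p1 [p2 [l1 ->]]].
exact: etrans (rmorphM pi _ _) (etrans (congr1 ( *%R^~ _) (pi_path l1)) (mul0r _)).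
Qed.

Lemma long_ideal u : pfil m u -> in_ideal SF u.
Proof.
case=> q Hq ->; rewrite /pev big_seq.
elim/big_ind: _ => [|*|c /(allP Hq)/(path_split K)[p1 [p2 [l1 ->]]]].
- exact: in_ideal0.
- exact: in_idealD.
exact/in_idealZ/in_idealMr/gen_in_ideal/SF_path.
Qed.

Lemma Phi_filtered l u : pfil l u -> exists2 r, pfil l.+1 r & Phi u = pi (u + r).
Proof.
pose I v := exists2 r, pfil l.+1 r & Phi v = pi (v + r).
move: u; apply: (pspan_ind (I := I)).
- by exists 0; [exact: pspan0|rewrite addr0 !linear0].
- move=> u v [r Hr Er] [s Hs Es]; exists (r + s); first exact: pspanD.
  by rewrite addrACA (linearD pi) linearD /= Er Es.
- move=> a u [r Hr Er]; exists (a *: r); first exact: pspanZ.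
  by rewrite -scalerDr !linearZ /= Er.
move=> p lep; have [r Hr Er] := Phi_lead p; exists r => //.
by apply: pfil_le Hr.
Qed.

(** Descending induction on the length: pi u = Phi u - pi r with r in longer paths, and pi vanishes
    from length m on. *)
Lemma Phi_surj b : exists u, Phi u = b.
Proof.
have [u ->] := pi_surj b; have {b} : pfil (m - m) u by rewrite subnn; apply: pfil0.
have: (m <= m)%N by [].
(* The induction variable k measures the distance to length m: u lies in [pfil (m - k)]. *)
move: {1 4}m u; elim=> [|k IH] u lek.
  by rewrite subn0 => /long_pi->; exists 0; rewrite linear0.
move=> Hu; have [r Hr Er] := Phi_filtered Hu.
rewrite -subSn // subSS in Hr; have [w Ew] := IH r (ltnW lek) Hr.
by exists (u - w); rewrite linearB /= Er Ew linearD /= addrK.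
Qed.

(** The relations [S0] are homogeneous, so a component of p s q is p s q itself or zero. Replacing s
    by the relation s + r of [SF] costs p r q, which consists of longer paths. *)
Lemma ideal_component x l : in_ideal S0 x ->
  exists2 v, pfil l.+1 v & in_ideal SF (pcomp l x - v).
Proof.
move: x; pose I y := exists2 v, pfil l.+1 v & in_ideal SF (pcomp l y - v).
have I0 : I 0 by exists 0; [exact: pspan0|rewrite linear0 subrr; exact: in_ideal0].
have ID y1 y2 : I y1 -> I y2 -> I (y1 + y2).
  move=> [v1 H1 E1] [v2 H2 E2]; exists (v1 + v2); first exact: pspanD.
  by rewrite linearD /= opprD addrACA; apply: in_idealD.
have IZ a y : I y -> I (a *: y).
  move=> [v H E]; exists (a *: v); first exact: pspanZ.
  by rewrite linearZ /= -scalerBr; apply: in_idealZ.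
apply: (in_ideal_sub I0 ID) => a s b Ss.
have gDl (a1 a2 c : KQ) : (a1 + a2) * s * c = a1 * s * c + a2 * s * c.
  exact: etrans (congr1 ( *%R^~ c) (mulrDl a1 a2 s)) (mulrDl _ _ c).
have gZl (k : K) (a1 c : KQ) : k *: a1 * s * c = k *: (a1 * s * c).
  exact: etrans (congr1 ( *%R^~ c) (esym (scalerAl k a1 s))) (esym (scalerAl k _ c)).
have gDr (a1 b1 b2 : KQ) : a1 * (b1 + b2) = a1 * b1 + a1 * b2 by exact: mulrDr.
have gZr (k : K) (a1 b1 : KQ) : a1 * (k *: b1) = k *: (a1 * b1) by exact: esym (scalerAr k a1 b1).
elim/pev_ind: a => [|a1 a2 H1 H2|c a H|p].
- by rewrite !mul0r.
- exact: (eq_ind_r I (ID _ _ H1 H2) (gDl a1 a2 b)).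
- exact: (eq_ind_r I (IZ c _ H) (gZl c a b)).
elim/pev_ind: b => [|b1 b2 H1 H2|c b H|q].
- by rewrite mulr0.
- exact: (eq_ind_r I (ID _ _ H1 H2) (gDr _ b1 b2)).
- exact: (eq_ind_r I (IZ c _ H) (gZr c _ b)).
have Hh : phom (qlen p + 2 + qlen q) (pe p * s * pe q).
  by apply: phomM; [apply: phomM; [apply: pspan_path => /=|exact: S0_hom]|apply: pspan_path => /=].
rewrite /I (pcomp_hom l Hh); case: eqP => [<-|_]; last first.
  by exists 0; [exact: pspan0|rewrite subrr; exact: in_ideal0].
have [r Hr Sr] := S0_def Ss; exists (- (pe p * r * pe q)).
  apply: pspanN.
  have -> : (qlen p + 2 + qlen q).+1 = (qlen p + 3 + qlen q)%N by rewrite -addSn -addnS.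
  have Hp x : pfil (qlen x) (pe x) by apply: pspan_path; apply: leqnn.
  exact: pfilM (pfilM (Hp p) Hr) (Hp q).
rewrite opprK -mulrDl -mulrDr; apply: in_idealM; exact: gen_in_ideal.
Qed.

(** If Phi u = 0, then u + r lies in the ideal of [S0] for some r in longer paths, so modulo the
    ideal of [SF] the leading part of u equals a combination of longer paths. As Phi kills [SF], the
    new representative is again in the kernel. The process ends at length m, where all paths are
    relations. *)
Lemma Phi_inj u : Phi u = 0 -> in_ideal SF u.
Proof.
have: pfil (m - m) u by rewrite subnn; apply: pfil0.
have: (m <= m)%N by [].
move: {1 4}m u; elim=> [|k IH] u lek; first by rewrite subn0 => /long_ideal.
move=> Hu Eu; have [r Hr Er] := Phi_filtered Hu.
have [u0 [u1 [H0 H1 E]]] := pfil_split Hu.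
have Hw : pfil (m - k.+1).+1 (u1 + r) by apply: pspanD.
have := pi_ker (etrans (esym Er) Eu); rewrite E -addrA.
move=> /(ideal_component (m - k.+1)) [v Hv].
rewrite linearD /= (pcomp_hom _ H0) eqxx (pcomp_fil Hw) addr0 => Iv.
have -> : u0 + u1 = (u0 - v) + (v + u1) by rewrite addrA subrK.
apply: in_idealD => //; apply: IH; first exact: ltnW.
  by rewrite -subSn // subSS in Hv H1; apply: pspanD.
have : Phi (u0 + u1) = 0 by rewrite -E.
have -> : u0 + u1 = (u0 - v) + (v + u1) by rewrite addrA subrK.
by rewrite linearD /= (in_ideal_ker Phi_SF Iv) add0r.
Qed.
End Deformation.

(** * Twisting the arrows of a quotient *)

Section Representation.
Variables (K : fieldType) (Q : quiver) (B : algType K).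
Local Notation KQ := (pathAlg K Q).
Local Notation pe := (@path_elt K Q).
Variable pi : {lrmorphism KQ -> B}.
Variables (ev : vert Q -> B) (al : arr Q -> B).
Hypotheses (evE : forall v, pi (pe (trivial_path v)) = ev v)
  (alE : forall a, pi (pe (arrow_path a)) = al a).

Lemma lrmorphism_rep : quiver_rep ev al.
Proof.
have piM p q : pi (pe p) * pi (pe q) = oapp (fun r => pi (pe r)) 0 (qcat p q).
  apply: etrans (esym (rmorphM pi _ _)) _.
  by apply: etrans (congr1 pi (path_eltM K p q)) _; case: qcat => //=; rewrite rmorph0.
split=> [u v||a|a].
- rewrite -evE -[ev v]evE piM qcat_trivl [qstart _]/=.
  by case: eqP => [->|] //=.
- rewrite -(rmorph1 pi) [1 in RHS]/(palg_one K Q) /palg_one [RHS]raddf_sum.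
  by apply: eq_bigr => v _; rewrite -evE.
- rewrite -evE -[al a]alE piM qcat_trivl.
  by rewrite [qstart _]/= eqxx.
- rewrite -evE -[al a]alE piM qcat_trivr.
  by rewrite [qend _]/= eqxx.
Qed.

Lemma lrmorphism_path p : pi (pe p) = path_val ev al p.
Proof.
rewrite /path_val; case: p => -[v s] /= W; elim: s v W => [|a s IH] v W.
  rewrite /arrows_val big_nil mulr1 -evE; congr (pi (pe _)); exact: val_inj.
have /andP[/eqP av Ws] := W.
pose q := @QPath Q (tgt a, s) Ws.
have E : qend (arrow_path a) = qstart q by [].
have -> : pe (@QPath Q (v, a :: s) W) = pe (arrow_path a) * pe q.
  rewrite (path_eltM K (arrow_path a) q) (qcatE E) /=; congr path_elt.
  by apply: val_inj; rewrite /= av.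
have [_ _ e_src e_tgt] := lrmorphism_rep.
have E2 : pi (pe q) = ev (tgt a) * arrows_val al s by exact: IH.
apply: etrans (rmorphM pi _ _) (etrans (congr2 *%R (alE a) E2) _).
rewrite [in RHS]/arrows_val big_cons (mulrA (al a)) e_tgt.
by rewrite (mulrA (ev v)) -av e_src.
Qed.

(** Commutation with the vertex idempotents only, not with all of B. Multiplying an arrow by such an
    element on either side keeps its source and target. *)
Definition central r : Prop := forall v, ev v * r = r * ev v.

Lemma central1 : central 1. Proof. by move=> v; rewrite mulr1 mul1r. Qed.
Lemma centralD r s : central r -> central s -> central (r + s).
Proof. by move=> Hr Hs v; rewrite mulrDl mulrDr Hr Hs. Qed.
Lemma centralM r s : central r -> central s -> central (r * s).
Proof. by move=> Hr Hs v; rewrite mulrA Hr -mulrA Hs mulrA. Qed.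
Lemma centralZ c r : central r -> central (c *: r).
Proof. by move=> Hr v; rewrite -scalerAl -scalerAr Hr. Qed.
Lemma central0 : central 0. Proof. by move=> v; rewrite mulr0 mul0r. Qed.

Lemma central_horner t (g : {poly K}) : central t -> central (horner_alg t g).
Proof.
move=> Ht; elim/poly_ind: g => [|g c IH]; first by rewrite rmorph0; apply: central0.
rewrite rmorphD rmorphM /= horner_algX horner_algC; apply: centralD; first exact: centralM.
exact/centralZ/central1.
Qed.

Lemma central_kev x y q : central x -> central y -> central (kev x y q).
Proof.
move=> Hx Hy; rewrite /kev; elim/big_ind: _ => [|*|c _]; [exact: central0|exact: centralD|].
apply: centralZ; elim: (c.2) => [|l w IH]; first exact: central1.
by apply: centralM => //; case: l.
Qed.

Lemma central_loop a b : src a = tgt b -> central (al a * al b).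
Proof.
have [eM _ e_src e_tgt] := lrmorphism_rep; move=> sa v.
have El : ev v * al a = if v == src a then al a else 0.
  by rewrite -{1}(e_src a) mulrA eM; case: eqP => [->|_]; rewrite ?e_src ?mul0r.
have Er : al b * ev v = if tgt b == v then al b else 0.
  by rewrite -{1}(e_tgt b) -mulrA eM; case: eqP => _; rewrite ?e_tgt ?mulr0.
by rewrite mulrA El -mulrA Er sa eq_sym; case: ifP; rewrite ?mul0r ?mulr0.
Qed.

Definition bfil l b : Prop := exists2 u, pfil l u & b = pi u.

Lemma bfil_zero l : bfil l 0.
Proof. by exists 0; [exact: pspan0|rewrite linear0]. Qed.
Lemma bfilD l b c : bfil l b -> bfil l c -> bfil l (b + c).
Proof. by move=> [u Hu ->] [v Hv ->]; exists (u + v); [exact: pspanD|rewrite linearD]. Qed.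
Lemma bfilZ l a b : bfil l b -> bfil l (a *: b).
Proof. by move=> [u Hu ->]; exists (a *: u); [exact: pspanZ|rewrite linearZ]. Qed.
Lemma bfilM j k b c : bfil j b -> bfil k c -> bfil (j + k) (b * c).
Proof. by move=> [u Hu ->] [v Hv ->]; exists (u * v); [exact: pfilM|rewrite rmorphM]. Qed.
Lemma bfil_le j k b : (j <= k)%N -> bfil k b -> bfil j b.
Proof. by move=> jk [u Hu ->]; exists u => //; apply: pfil_le Hu. Qed.
Lemma bfil_arrow a : bfil 1 (al a).
Proof. by exists (pe (arrow_path a)); [apply: pspan_path|rewrite alE]. Qed.

Hypothesis bfil0 : forall b, bfil 0 b.

Variables L R : arr Q -> B.
Hypotheses (cL : forall a, central (L a)) (cR : forall a, central (R a))
  (L1 : forall a, bfil 1 (L a - 1)) (R1 : forall a, bfil 1 (R a - 1)).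

Definition twist a := L a * al a * R a.

Lemma twist_rep : quiver_rep ev twist.
Proof.
have [eM e1 e_src e_tgt] := lrmorphism_rep; split=> // a; rewrite /twist.
  by rewrite !mulrA cL -(mulrA (L a)) e_src.
by rewrite -mulrA -cR mulrA -(mulrA (L a)) e_tgt.
Qed.

Local Notation Phi := (path_hom twist_rep).

(** The two products are compared arrow by arrow. Each multiplier is 1 up to positive length, so
    replacing one arrow by its twist gains at least one in length. *)
Lemma twist_lead p : exists2 r, pfil (qlen p).+1 r & Phi (pe p) = pi (pe p + r).
Proof.
suff [r Hr Er] : bfil (qlen p).+1 (Phi (pe p) - pi (pe p)).
  by exists r => //; rewrite linearD /= -Er addrC subrK.
rewrite path_hom_path lrmorphism_path /path_val -mulrBr -[X in bfil X _]add0n.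
apply: bfilM => //; rewrite /qlen; elim: (val p).2 => [|a s IH].
  by rewrite /arrows_val !big_nil subrr; apply: bfil_zero.
rewrite /arrows_val !big_cons -!/(arrows_val _ _).
have -> : twist a * arrows_val twist s - al a * arrows_val al s
  = (twist a - al a) * arrows_val twist s + al a * (arrows_val twist s - arrows_val al s).
  by move: (twist a) (al a) => t u; ncring.
have -> : twist a - al a = (L a - 1) * al a * R a + al a * (R a - 1).
  by rewrite /twist; move: (al a) => u; ncring.
have fs : bfil (size s) (arrows_val twist s).
  elim: {IH} s => [|b s IH] /=; first exact: bfil0.
  rewrite /arrows_val big_cons -add1n; apply: bfilM => //.
  rewrite -[1%N]/((0 + 1) + 0)%N; apply: bfilM => //; apply: bfilM => //; exact: bfil_arrow.
apply: bfilD; last by rewrite -[X in bfil X _]add1n; apply: bfilM => //; apply: bfil_arrow.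
rewrite -[X in bfil X _]add2n; apply: bfilM => //; apply: bfilD.
  by rewrite -[2%N]/((1 + 1) + 0)%N; apply: bfilM => //; apply: bfilM => //; apply: bfil_arrow.
by rewrite -[2%N]/(1 + 1)%N; apply: bfilM => //; apply: bfil_arrow.
Qed.
End Representation.

Lemma horner_intertwine (K : fieldType) (B : algType K) (t t' a : B) (g : {poly K}) :
  t * a = a * t' -> horner_alg t g * a = a * horner_alg t' g.
Proof.
move=> E; elim/poly_ind: g => [|g c IH]; first by rewrite !rmorph0 mul0r mulr0.
rewrite !rmorphD !rmorphM /= !horner_algX !horner_algC mulrDl mulrDr.
by rewrite -mulrA E mulrA IH mulrA mulr_algl mulr_algr.
Qed.

(** * Preprojective algebras of type E *)

Section TypeE.
Variables (n : nat) (K : fieldType) (B : algType K).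
Hypothesis n_ge6 : (6 <= n)%N.
Local Notation Q := (QE n).
Local Notation KQ := (pathAlg K Q).
Local Notation pe := (@path_elt K Q).
Variables (pi : {lrmorphism KQ -> B}) (ev : vert Q -> B) (al : arr Q -> B).
Hypotheses (evE : forall v, pi (pe (trivial_path v)) = ev v)
  (alE : forall a, pi (pe (arrow_path a)) = al a).

Definition arrow_at (rev : bool) (i : nat) : B :=
  if insub i : option 'I_n.-1 is Some j then al (j, rev) else 0.

Local Notation ar := arrow_at.

Lemma pi_E_arrow rev i : pi (E_arrow n K rev i) = ar rev i.
Proof. by rewrite /E_arrow /arrow_at; case: insub => [j|]; [exact: alE|exact: rmorph0]. Qed.

Local Notation a := (ar false).
Local Notation a' := (ar true).

Lemma ar_central rev i : central ev (ar rev i * ar (~~ rev) i).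
Proof.
rewrite /arrow_at; case: insub => [j|]; last by rewrite mul0r; apply: central0.
apply: (central_loop evE alE); by case: rev.
Qed.

Lemma ar_fil rev i : bfil pi 1 (ar rev i).
Proof. rewrite /arrow_at; case: insub => [j|]; [exact: bfil_arrow|exact: bfil_zero]. Qed.

Hypothesis pi_rel : forall r, E_relation (0 : KQ) r -> pi r = 0.

Lemma pi2 rev rev' i i' : pi (E_arrow n K rev i * E_arrow n K rev' i') = ar rev i * ar rev' i'.
Proof. by apply: etrans (rmorphM pi _ _) _; apply: congr2; apply: pi_E_arrow. Qed.

Lemma ar_rel0 : a 0 * a' 0 = 0.
Proof. exact: etrans (esym (pi2 _ _ _ _)) (pi_rel (E_rel0 _)). Qed.

Lemma ar_rel1 : a 1 * a' 1 = 0.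
Proof. exact: etrans (esym (pi2 _ _ _ _)) (pi_rel (E_rel1 _)). Qed.

Lemma ar_rel2 : a' 1 * a 1 + a 2 * a' 2 = 0.
Proof.
rewrite -!pi2; exact: etrans (esym (rmorphD pi _ _)) (pi_rel (E_rel2 _)).
Qed.

Lemma ar_rel3 : a' 0 * a 0 + a' 2 * a 2 + a 3 * a' 3 = 0.
Proof.
have piD u v : pi (u + v) = pi u + pi v by exact: rmorphD.
apply: etrans _ (pi_rel (E_rel3 (0 : KQ))); apply: esym.
apply: etrans (piD _ _) _; rewrite [pi 0]rmorph0 addr0.
apply: etrans (piD _ _) _; apply: congr2; last exact: pi2.
by apply: etrans (piD _ _) _; apply: congr2; apply: pi2.
Qed.

Lemma ar_reli i : (3 <= i <= n - 3)%N -> a' i * a i + a i.+1 * a' i.+1 = 0.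
Proof.
move=> ri; rewrite -!pi2.
exact: etrans (esym (rmorphD pi _ _)) (pi_rel (E_reli _ ri)).
Qed.

Lemma ar_reln : a' (n - 2) * a (n - 2) = 0.
Proof. exact: etrans (esym (pi2 _ _ _ _)) (pi_rel (E_reln _)). Qed.

Local Notation x := (a' 0 * a 0).
Local Notation y := (a' 2 * a 2).
(* The sign absorbs those of the relations: [zeta i * a i = a i * zeta i.+1]. *)
Definition zeta i : B := (-1) ^+ i *: (a i * a' i).

Lemma x_sq : x ^+ 2 = 0.
Proof. by rewrite expr2 mulrA -(mulrA (a' 0)) ar_rel0 mulr0 mul0r. Qed.

(** y^3 = a_2' (a_2 a_2')^2 a_2, and a_2 a_2' = - a_1' a_1 has square zero. *)
Lemma y_cube : y ^+ 3 = 0.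
Proof.
have /eqP := ar_rel2; rewrite addrC addr_eq0 => /eqP E.
have sq0 : (a 2 * a' 2) * (a 2 * a' 2) = 0.
  by rewrite E mulrNN mulrA -(mulrA (a' 1)) ar_rel1 mulr0 mul0r.
have -> : y ^+ 3 = a' 2 * ((a 2 * a' 2) * (a 2 * a' 2)) * a 2.
  by rewrite exprS expr2 !mulrA.
by rewrite sq0 mulr0 mul0r.
Qed.

Lemma xy_zeta : x + y = zeta 3.
Proof.
have /eqP := ar_rel3; rewrite addr_eq0 => /eqP->.
by rewrite /zeta exprS expr2 mulrNN !mulr1 scaleN1r.
Qed.

Lemma zeta_succ i : (3 <= i <= n - 3)%N -> zeta i * a i = a i * zeta i.+1.
Proof.
move=> /ar_reli/eqP; rewrite addrC addr_eq0 => /eqP E.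
rewrite /zeta -scalerAl -scalerAr E exprS mulN1r scaleNr mulrN scalerN opprK.
by rewrite mulrA.
Qed.

Lemma zeta_last : zeta (n - 2) * a (n - 2) = 0.
Proof. by rewrite /zeta -scalerAl -mulrA ar_reln mulr0 scaler0. Qed.

(** At the end of the long arm zeta has square zero. Since zeta_i^(j+1) is, up to sign, a_i
    zeta_(i+1)^j a_i', the exponent grows by one with each step towards the vertex 3. By [xy_zeta]
    this is the third relation of R. *)
Lemma zeta_nil : zeta 3 ^+ (n - 3) = 0.
Proof.
suff H k : (k <= n - 5)%N -> zeta (n - 2 - k) ^+ k.+2 = 0.
  have := H (n - 5)%N (leqnn _).
  have -> : (n - 2 - (n - 5) = 3)%N by lia.
  by have -> : ((n - 5).+2 = n - 3)%N by lia.
elim: k => [_|k IH lek].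
  by rewrite subn0 expr2 {2}/zeta -scalerAr mulrA zeta_last mul0r scaler0.
set i := (n - 2 - k.+1)%N.
have iS : i.+1 = (n - 2 - k)%N by lia.
have ri : (3 <= i <= n - 3)%N by lia.
have pow j : zeta i ^+ j * a i = a i * zeta i.+1 ^+ j.
  elim: j => [|j IHj]; first by rewrite !expr0 mul1r mulr1.
  by rewrite exprSr -mulrA zeta_succ // mulrA IHj -mulrA -exprSr.
rewrite exprSr {2}/zeta -scalerAr mulrA pow iS IH ?mulr0 ?mul0r ?scaler0 //.
exact: ltnW.
Qed.

Lemma zeta_central i : central ev (zeta i).
Proof. exact/centralZ/(ar_central false). Qed.

Hypothesis bfil0 : forall b, bfil pi 0 b.

Lemma zeta_fil i : bfil pi 1 (zeta i).
Proof.
apply: bfilZ; apply: (bfil_le (isT : 1 <= 1 + 1)%N).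
by apply: bfilM; apply: ar_fil.
Qed.

(** * The twisted arrows satisfy the deformed relations *)

Section Twist.
Variables (p p' q q' u u' : B) (g : {poly K}) (F : freeAlg K).
Hypotheses (pp' : p' * p = 1) (qq' : q' * q = 1) (uu' : u' * u = 1) (g0 : g.[0] = 1).
Hypotheses (cp : central ev p) (cp' : central ev p') (cq : central ev q)
  (cq' : central ev q') (cu : central ev u) (cu' : central ev u').
Hypotheses (fp : bfil pi 1 (p - 1)) (fp' : bfil pi 1 (p' - 1)) (fq : bfil pi 1 (q - 1))
  (fq' : bfil pi 1 (q' - 1)) (fu : bfil pi 1 (u - 1)) (fu' : bfil pi 1 (u' - 1)).
Local Notation X := (p * x * p').
Local Notation Y := (q * y * q').
Hypothesis XYF : X + Y + free_eval X Y F
  = u * ((x + y) * horner_alg (x + y) g) * u'.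

Definition twistl (rev : bool) (i : nat) : B :=
  if rev then (if i == 0%N then p else if i == 2%N then q else 1)
  else (if i == 3%N then u else 1).
Definition twistr (rev : bool) (i : nat) : B :=
  if rev then
    (if (i < 3)%N then 1 else horner_alg (zeta i) g * (if i == 3%N then u' else 1))
  else (if i == 0%N then p' else if i == 2%N then q' else 1).

Lemma twistl_central rev i : central ev (twistl rev i).
Proof. by rewrite /twistl; do ?case: ifP => // _; apply: central1. Qed.

Lemma twistr_central rev i : central ev (twistr rev i).
Proof.
rewrite /twistr; do ?case: ifP => // _; try exact: central1.
  by apply: centralM => //; apply/central_horner/zeta_central.
by apply: centralM; [apply/central_horner/zeta_central|apply: central1].
Qed.

Lemma fil_sub1 : bfil pi 1 (1 - 1).
Proof. by rewrite subrr; apply: bfil_zero. Qed.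

Lemma twistl_fil rev i : bfil pi 1 (twistl rev i - 1).
Proof. by rewrite /twistl; do ?case: ifP => // _; apply: fil_sub1. Qed.

Lemma twistr_fil rev i : bfil pi 1 (twistr rev i - 1).
Proof.
have Hg : bfil pi 1 (horner_alg (zeta i) g - 1).
  apply: (horner_fil bfil0 (@bfilM _ _ _ pi)) => //; exact: zeta_fil.
rewrite /twistr; do ?case: ifP => // _; try exact: fil_sub1; last by rewrite mulr1.
set h := horner_alg _ _ in Hg *; have -> : h * u' - 1 = (h - 1) * u' + (u' - 1) by ncring.
by apply: bfilD => //; rewrite -[1%N]addn0; apply: bfilM.
Qed.

(* a_0, a_0', a_2, a_2', a_3, a_3' become a_0 p', p a_0', a_2 q', q a_2', u a_3,
   a_3' g(zeta_3) u', and a_i' becomes a_i' g(zeta_i) for i > 3. *)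
Let L (e : arr Q) : B := twistl e.2 e.1.
Let R (e : arr Q) : B := twistr e.2 e.1.
Definition twistE_rep : quiver_rep ev (twist al L R) :=
  twist_rep evE alE (fun e => twistl_central e.2 e.1) (fun e => twistr_central e.2 e.1).

Local Notation Phi := (path_hom twistE_rep).

Lemma twistE_lead (P : qpath Q) : exists2 r, pfil (qlen P).+1 r & Phi (pe P) = pi (pe P + r).
Proof.
apply: twist_lead => // e; [exact: twistl_fil|exact: twistr_fil].
Qed.

Lemma twistE_arrow rev i : Phi (E_arrow n K rev i) = twistl rev i * ar rev i * twistr rev i.
Proof.
rewrite /E_arrow /arrow_at; case: insubP => [j _ ji|_]; last by rewrite mulr0 mul0r; apply: rmorph0.
by apply: etrans (path_hom_arrow twistE_rep (j, rev)) _; rewrite /twist /L /R /= ji.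
Qed.

Lemma twistE_arrow2 rev rev' i i' : Phi (E_arrow n K rev i * E_arrow n K rev' i')
  = twistl rev i * ar rev i * (twistr rev i * twistl rev' i') * ar rev' i' * twistr rev' i'.
Proof.
apply: etrans (rmorphM Phi _ _) _; apply: etrans (congr2 _ (twistE_arrow _ _) (twistE_arrow _ _)) _.
by rewrite !mulrA.
Qed.

(** At the vertices 0 and 2 the products p' p and q' q cancel; at the vertex 3 the relation is
    [XYF]. Along the long arm u' u cancels, and g(zeta_i) a_i = a_i g(zeta_(i+1)) brings a common
    factor to the right. *)
Lemma twistE_kill r : E_relation (free_eval (E_arrow n K true 0 * E_arrow n K false 0)
    (E_arrow n K true 2 * E_arrow n K false 2) F) r -> Phi r = 0.
Proof.
have PD u1 v1 : Phi (u1 + v1) = Phi u1 + Phi v1 by exact: rmorphD.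
have tE i : (3 <= i)%N -> twistr true i * twistl false i = horner_alg (zeta i) g.
  move=> i3; rewrite /twistr /twistl ltnNge i3 /=; case: ifP => _; last by rewrite !mulr1.
  by rewrite -mulrA uu' mulr1.
case.
- apply: etrans (twistE_arrow2 _ _ _ _) _; rewrite /twistl /twistr /= mul1r mulr1 pp'.
  by rewrite mulr1 ar_rel0.
- apply: etrans (twistE_arrow2 _ _ _ _) _; rewrite /twistl /twistr /= !mul1r !mulr1.
  exact: ar_rel1.
- apply: etrans (PD _ _) _.
  apply: etrans (congr2 _ (twistE_arrow2 _ _ _ _) (twistE_arrow2 _ _ _ _)) _.
  rewrite /twistl /twistr /= !mul1r !mulr1 qq' mulr1; exact: ar_rel2.
- have EX : Phi (E_arrow n K true 0 * E_arrow n K false 0) = X.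
    by apply: etrans (twistE_arrow2 _ _ _ _) _; rewrite /twistl /twistr /= !mulr1 !mulrA.
  have EY : Phi (E_arrow n K true 2 * E_arrow n K false 2) = Y.
    by apply: etrans (twistE_arrow2 _ _ _ _) _; rewrite /twistl /twistr /= !mulr1 !mulrA.
  have EZ : Phi (E_arrow n K false 3 * E_arrow n K true 3)
      = - (u * ((x + y) * horner_alg (x + y) g) * u').
    apply: etrans (twistE_arrow2 _ _ _ _) _; rewrite /twistl /twistr /= !mulr1 xy_zeta.
    have E3 : a 3 * a' 3 = - zeta 3 by rewrite /zeta exprS expr2 mulrNN !mulr1 scaleN1r opprK.
    by rewrite -(mulrA u) E3 mulrN mulNr !mulrA.
  apply: etrans (PD _ _) (etrans (congr2 _ (etrans (PD _ _) (congr2 _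
    (etrans (PD _ _) (congr2 _ EX EY)) EZ)) (etrans (rmorph_free_eval _ _ Phi F)
    (congr2 (fun s t => free_eval s t F) EX EY))) _).
  by rewrite addrAC XYF subrr.
- move=> i ri; have [i3 _] := andP ri.
  apply: etrans (PD _ _) _.
  apply: etrans (congr2 _ (twistE_arrow2 _ _ _ _) (twistE_arrow2 _ _ _ _)) _.
  rewrite tE // -(mulrA (_ * _) (horner_alg _ _)) (horner_intertwine _ (zeta_succ ri)).
  case: i ri i3 => [|[|[|i]]] // ri _; rewrite /twistl /twistr /= !mul1r !mulr1 mulrA -mulrDl.
  by rewrite ar_reli // mul0r.
have n3 : (3 <= n - 2)%N by lia.
apply: etrans (twistE_arrow2 _ _ _ _) _; rewrite tE // -(mulrA (_ * _) (horner_alg _ _)).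
(* At the end of the arm zeta a = 0 = a 0, hence g(zeta) a = a g(0). *)
rewrite (@horner_intertwine _ _ _ 0 _ _ (etrans zeta_last (esym (mulr0 _)))).
by rewrite mulrA -(mulrA (twistl _ _)) ar_reln mulr0 !mul0r.
Qed.
End Twist.
End TypeE.

(* The code [2 * i] stands for the arrow a_i and [2 * i + 1] for its reverse. *)
Definition csrc (c : nat) : nat :=
  let i := c./2 in if odd c then (if i is 0 then 3 else i.+1)%N else i.
Definition ctgt (c : nat) : nat :=
  let i := c./2 in if odd c then i else (if i is 0 then 3 else i.+1)%N.

Definition relsE (n : nat) : seq (seq word) :=
  ([:: [:: [:: 1; 0]]; [:: [:: 3; 2]]; [:: [:: 2; 3]; [:: 5; 4]];
      [:: [:: 0; 1]; [:: 4; 5]; [:: 7; 6]]]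
  ++ [seq [:: [:: i.*2; i.*2.+1]; [:: i.*2.+3; i.*2.+2]] | i <- iota 3 (n - 5)]
  ++ [:: [:: [:: (n - 2).*2; (n - 2).*2.+1]]])%N.

Definition relabel (perm : seq nat) (rels : seq (seq word)) : seq zpoly :=
  [seq [seq (Posz 1, [seq index c perm | c <- w]) | w <- r] | r <- rels].

(** The head of the list is the last arrow. Products of arrows that do not compose vanish, but this
    is not among the rewriting rules; it enters through this filter. *)
Definition composable (perm : seq nat) (w : word) (l : nat) : bool :=
  if w is h :: _ then eqn (ctgt (nth 0%N perm h)) (csrc (nth 0%N perm l)) else true.

(** The initial words have one letter, so the index d stands for length d + 1. *)
Definition path_words (n : nat) (rs : seq rule) (perm : seq nat) (d : nat) : seq word :=
  iter d (next (step fuel rs) (composable perm) n.-1.*2) [seq [:: l] | l <- iota 0 n.-1.*2].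

Definition rulesE (n : nat) (perm : seq nat) ds := rules (relabel perm (relsE n)) ds.

(* The permutations order the arrows so that the Groebner bases are small. *)
Definition arrows7 := [:: 5; 2; 10; 6; 0; 8; 9; 3; 4; 1; 11; 7]%N.
Definition arrows8 := [:: 12; 11; 2; 3; 10; 5; 4; 0; 9; 6; 1; 8; 13; 7]%N.
Definition overlaps7 := [:: (0,3,1); (3,0,1); (3,7,1); (7,4,1); (4,8,1); (9,2,1); (4,9,1);
    (10,5,1); (12,1,1); (13,4,1); (14,6,1); (16,5,1); (18,6,1); (15,19,3); (20,18,6); (17,20,3);
    (17,21,3); (19,20,3); (21,15,2); (23,16,5); (19,21,3); (5,24,1); (2,25,1); (25,12,4)]%N.
Definition overlaps8 := [:: (0,3,1); (3,0,1); (3,8,1); (8,4,1); (4,9,1); (10,2,1); (4,10,1);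
    (11,5,1); (13,1,1); (14,4,1); (15,6,1); (17,5,1); (18,7,1); (19,6,1); (21,7,1); (16,22,3);
    (23,21,7); (24,23,3); (24,24,3); (26,19,6); (20,25,4); (20,26,4); (22,25,4); (20,27,4);
    (22,26,4); (27,16,2); (5,30,1); (31,17,5); (22,27,4); (5,32,1); (2,33,1); (33,13,4);
    (6,34,1)]%N.

(** * Vanishing of long paths *)

Section Nilpotency.
Variables (n : nat) (K : fieldType) (B : algType K) (perm : seq nat).
Variables (ds : seq (nat * nat * nat)) (m : nat).
Hypotheses (n_ge6 : (6 <= n)%N) (permP : perm_eq perm (iota 0 n.-1.*2))
  (check : nilp (path_words n (rulesE n perm ds) perm m)).
Local Notation Q := (QE n).
Local Notation KQ := (pathAlg K Q).
Local Notation pe := (@path_elt K Q).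
Variables (pi : {lrmorphism KQ -> B}) (ev : vert Q -> B) (al : arr Q -> B).
Hypotheses (evE : forall v, pi (pe (trivial_path v)) = ev v)
  (alE : forall a, pi (pe (arrow_path a)) = al a)
  (pi_rel : forall r, E_relation (0 : KQ) r -> pi r = 0).

Local Notation ar := (arrow_at al).
Definition code_val (c : nat) : B := ar (odd c) c./2.
Definition letter_val (l : nat) : B := code_val (nth 0%N perm l).
Local Notation evc := (evw code_val).
Local Notation evl := (evw letter_val).

Lemma code_val_even i : code_val i.*2 = ar false i.
Proof. by rewrite /code_val odd_double doubleK. Qed.
Lemma code_val_odd i : code_val i.*2.+1 = ar true i.
Proof. by rewrite /code_val /= odd_double /= uphalf_double. Qed.

Lemma mem_perm c : (c \in perm) = (c < n.-1.*2)%N.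
Proof. by rewrite (perm_mem permP) mem_iota. Qed.

Lemma letter_val_index c : (c < n.-1.*2)%N -> letter_val (index c perm) = code_val c.
Proof. by move=> ltc; rewrite /letter_val nth_index // mem_perm. Qed.

Lemma evl_relabel w : all (ltn^~ n.-1.*2) w -> evl [seq index c perm | c <- w] = evc w.
Proof. by elim: w => //= c w IH /andP[ltc /IH->]; rewrite letter_val_index. Qed.

Lemma relabel_zero p : p \in relabel perm (relsE n) -> evm evl p = 0.
Proof.
case/mapP=> r rin ->.
have rel r' : all (all (ltn^~ n.-1.*2)) r' -> \sum_(w <- r') evc w = 0 ->
    evm evl [seq (Posz 1, [seq index c perm | c <- w]) | w <- r'] = 0.
  move=> /allP Hr' <-; rewrite /evm big_map big_seq [RHS]big_seq.
  by apply: eq_bigr => w win /=; rewrite evl_relabel ?Hr'.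
move: rin; rewrite !mem_cat => /or3P[]; last 1 first.
- rewrite inE => /eqP->; apply: rel; first by rewrite /= !andbT; lia.
  rewrite big_seq1 /= mul1r code_val_even code_val_odd.
  exact: ar_reln alE pi_rel.
- rewrite !inE => /or4P[] /eqP->; apply: rel; try by (rewrite /= ?andbT; lia).
  + rewrite big_seq1 /= mul1r; exact: ar_rel0 alE pi_rel.
  + rewrite big_seq1 /= mul1r; exact: ar_rel1 alE pi_rel.
  + rewrite !big_cons big_nil /= !mul1r addr0; exact: ar_rel2 alE pi_rel.
  + rewrite !big_cons big_nil /= !mul1r addr0 addrA; exact: ar_rel3 alE pi_rel.
- case/mapP=> i; rewrite mem_iota => ri ->; apply: rel; first by rewrite /= !andbT; lia.
  rewrite !big_cons big_nil /= !mul1r addr0 code_val_even code_val_odd.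
  rewrite -[i.*2.+2]/(i.+1.*2) -[i.*2.+3]/(i.+1.*2.+1) code_val_even code_val_odd.
  by apply: ar_reli alE pi_rel _ _; lia.
Qed.

Lemma csrcE (j : 'I_n.-1) c : c./2 = j -> src ((j, odd c) : arr Q) = csrc c :> nat.
Proof.
move=> cj; rewrite /csrc cj /=; have := ltn_ord j; case: (odd c) => ltj.
  by rewrite /E_high; case: (j : nat) ltj => [|k] ltj /=; rewrite inordK //; lia.
by rewrite /E_low inordK //; lia.
Qed.

Lemma ctgtE (j : 'I_n.-1) c : c./2 = j -> tgt ((j, odd c) : arr Q) = ctgt c :> nat.
Proof.
move=> cj; rewrite /ctgt cj /=; have := ltn_ord j; case: (odd c) => ltj.
  by rewrite /E_low inordK //; lia.
by rewrite /E_high; case: (j : nat) ltj => [|k] ltj /=; rewrite inordK //; lia.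
Qed.

Lemma code_val0 c c' : ctgt c != csrc c' -> code_val c * code_val c' = 0.
Proof.
have [eM _ e_src e_tgt] := lrmorphism_rep evE alE.
move=> ne; rewrite /code_val /arrow_at; case: insubP => [j _ ji|_]; last by rewrite mul0r.
case: insubP => [j' _ ji'|_]; last by rewrite mulr0.
rewrite -(e_tgt (j, _)) -(e_src (j', _)) mulrA -(mulrA (al _)) eM.
case: eqP => [E|_]; last by rewrite mulr0 mul0r.
by move: ne; rewrite -(ctgtE (esym ji)) -(csrcE (esym ji')) E eqxx.
Qed.

Lemma words_span w : all (ltn^~ n.-1.*2) w -> (0 < size w)%N ->
  inspan letter_val (path_words n (rulesE n perm ds) perm (size w).-1) (evl w).
Proof.
have val : valid letter_val (rulesE n perm ds).
  by apply: rulesP => p; apply: relabel_zero.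
case: w => // l w; elim: w l => [|h w IH] l.
  move=> /= /andP[ltl _] _; exists [:: (Posz 1, [:: l])].
    by rewrite /supp_in /= andbT map_f // mem_iota.
  by rewrite evm_word.
case/andP=> ltl Hw _; apply: inspan_next => //.
- by move=> v k; apply: ev_step.
- move=> [|k v] // _ /=; rewrite eqnE => ne; rewrite -mulrA code_val0 ?mulr0 //.
- exact: IH.
Qed.

Lemma path_nil p : qlen p = m.+1 -> pi (pe p) = 0.
Proof.
rewrite (lrmorphism_path evE alE) /path_val /qlen => ps.
pose code (e : arr Q) := index (e.1.*2 + e.2)%N perm.
have lt (e : arr Q) : (e.1.*2 + e.2 < n.-1.*2)%N by have := ltn_ord e.1; case: (e.2); lia.
have -> : arrows_val al p.2 = evl (rev [seq code e | e <- p.2]).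
  elim/last_ind: (p.2) => [|s e IH]; first by rewrite /arrows_val big_nil.
  rewrite /arrows_val big_rcons /= -/(arrows_val al s) IH map_rcons rev_rcons /=.
  congr (_ * _); rewrite letter_val_index // /code_val /arrow_at.
  rewrite halfD odd_double /= doubleK oddD odd_double /=.
  case: e => j r /=.
  have -> : (r : nat)./2 = 0%N by case: r.
  rewrite add0n addn0 insubT ?ltn_ord // => H; congr (al (_, _)); last by case: r.
  exact: val_inj.
have := @words_span (rev [seq code e | e <- p.2]).
rewrite size_rev size_map ps all_rev all_map /= => -[]//.
  apply/allP => e _ /=; rewrite -[X in (_ < X)%N](size_iota 0) -(perm_size permP) index_mem.
  by rewrite mem_perm.
move=> [|c q] //=; last by move: check => /nilP->.
by move=> _ ->; rewrite evm_nil mulr0.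
Qed.
End Nilpotency.

(** * The isomorphism *)

Section Isomorphism.
Variables (n : nat) (K : fieldType) (perm : seq nat) (ds : seq (nat * nat * nat)).
Hypotheses (n_ge6 : (6 <= n)%N) (permP : perm_eq perm (iota 0 n.-1.*2))
  (check : nilp (path_words n (rulesE n perm ds) perm (E_max_length n))).
Local Notation Q := (QE n).
Local Notation KQ := (pathAlg K Q).
Local Notation pe := (@path_elt K Q).
Local Notation S0 := (E_relation (0 : KQ)).

(** The simple module at the vertex 0. It shows that the relations of P(E_n) generate a proper
    ideal. *)
Definition vertex0_rep : @quiver_rep K Q K^o (fun v => (v == ord0)%:R) (fun=> 0).
Proof.
split=> [u v||a|a]; rewrite ?mulr0 ?mul0r //.
- have [->|ne] := eqVneq u v; first by case: (v == _); rewrite ?mulr1 ?mulr0.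
  have [u0|_] := eqVneq u ord0; last by rewrite mul0r.
  by rewrite u0 eq_sym in ne; rewrite (negPf ne) mulr0.
- by rewrite (bigD1 ord0) //= big1 ?addr0 // => v /negPf->.
Qed.

Lemma preproj_nontrivial : ~ in_ideal S0 1.
Proof.
pose h := path_hom vertex0_rep : {lrmorphism KQ -> K^o}.
have hA rev i : h (E_arrow n K rev i) = 0.
  rewrite /E_arrow; case: insub => [j|]; last exact: rmorph0.
  exact: (path_hom_arrow vertex0_rep).
have hM rev i x : h (E_arrow n K rev i * x) = 0.
  exact: etrans (rmorphM h _ _) (etrans (congr1 ( *%R^~ _) (hA _ _)) (mul0r _)).
have hD u v : h u = 0 -> h v = 0 -> h (u + v) = 0.
  by move=> hu hv; exact: etrans (rmorphD h _ _) (etrans (congr2 +%R hu hv) (addr0 _)).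
have h0 : h 0 = 0 by exact: rmorph0.
suff kill s : S0 s -> h s = 0.
  by move/(in_ideal_ker kill); rewrite rmorph1 => /eqP; exact/negP/oner_neq0.
case; try exact: (hM); try (by apply: (hD); apply: (hM)).
  by do 3!apply: (hD) => //; apply: (hM).
by move=> i _; apply: (hD); apply: (hM).
Qed.

Local Notation B := (nzpres preproj_nontrivial).
Local Notation pi := (npi preproj_nontrivial : {lrmorphism KQ -> B}).
Let ev v : B := pi (pe (trivial_path v)).
Let al a : B := pi (pe (arrow_path a)).
Let evE v : pi (pe (trivial_path v)) = ev v. Proof. by []. Qed.
Let alE a : pi (pe (arrow_path a)) = al a. Proof. by []. Qed.
Let pi_rel r : S0 r -> pi r = 0. Proof. by move=> Sr; apply/npi_eq0/gen_in_ideal. Qed.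
Let bfil0 b : bfil pi 0 b.
Proof. by elim/npiP: b => u; exists u => //; apply: pfil0. Qed.

Variable F : freeAlg K.
Hypothesis degF : monomials_deg_ge2 F.
Local Notation SF := (@deformed_relation n K F).
Hypothesis conjugate : exists p p' q q' u u' (g : {poly K}), g.[0] = 1 /\
  forall (A : algType K) (x y : A), x ^+ 2 = 0 -> y ^+ 3 = 0 -> (x + y) ^+ (n - 3) = 0 ->
  [/\ inv_pair x y p p', inv_pair x y q q', inv_pair x y u u' &
    let X := (1 + kev x y p) * x * (1 + kev x y p') in
    let Y := (1 + kev x y q) * y * (1 + kev x y q') in
    X + Y + free_eval X Y F
    = (1 + kev x y u) * ((x + y) * horner_alg (x + y) g) * (1 + kev x y u')].

Lemma pi_long p : qlen p = (E_max_length n).+1 -> pi (pe p) = 0.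
Proof. exact: (path_nil n_ge6 permP check evE alE pi_rel). Qed.

Let x := arrow_at al true 0 * arrow_at al false 0.
Let y := arrow_at al true 2 * arrow_at al false 2.

Lemma deformation_hom : exists Phi : {lrmorphism KQ -> B},
  (forall p, exists2 r, pfil (qlen p).+1 r & Phi (pe p) = pi (pe p + r)) /\
  (forall s, SF s -> Phi s = 0).
Proof.
have [p [p' [q [q' [u [u' [g [g0 H]]]]]]]] := conjugate.
have z0 : (x + y) ^+ (n - 3) = 0.
  by rewrite /x /y (xy_zeta alE pi_rel); apply: (zeta_nil n_ge6 alE pi_rel).
have [[Hp Hp' _ pp'] [Hq Hq' _ qq'] [Hu Hu' _ uu'] E] :=
  H B _ _ (x_sq alE pi_rel) (y_cube alE pi_rel) z0.
have ck l : central ev (1 + kev x y l).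
  by apply: centralD; [exact: central1|apply: central_kev; apply: (ar_central evE alE true)].
have fk l : unip_list l -> bfil pi 1 (1 + kev x y l - 1).
  move=> /allP Hl; rewrite addrC addKr /kev big_seq.
  elim/big_ind: _ => [|*|c /Hl/andP[_]]; [exact: bfil_zero|exact: bfilD|].
  case: (c.2) => // k w _; apply: bfilZ => /=; rewrite -[1%N]add0n; apply: bfilM => //.
  apply: (bfil_le (isT : 1 <= 1 + 1)%N).
  by case: k => [|k] /=; apply: bfilM; apply: ar_fil.
pose Phi := path_hom (twistE_rep evE alE g (ck p) (ck p') (ck q) (ck q') (ck u) (ck u')).
have lead : forall P, exists2 r, pfil (qlen P).+1 r & Phi (pe P) = pi (pe P + r).
  move=> P; apply: (twistE_lead evE alE bfil0 g0) => //; exact: fk.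
exists Phi; split=> // s [r Hr|P HP].
  apply: (twistE_kill n_ge6 evE alE pi_rel) Hr => //.
(* For a relation that is a path P of length m + 1, Phi P = pi (P + r), and both terms are too long
   to survive in P(E_n). *)
have [r Hr rE] := lead P.
have r0 : pi r = 0 by apply: (long_pi pi_long); apply: pfil_le Hr; rewrite HP; apply: leqnSn.
exact: etrans rE (etrans (rmorphD pi _ _) (etrans (congr2 +%R (pi_long HP) r0) (addr0 0))).
Qed.

Lemma E_arrow_hom rev i : phom 1 (E_arrow n K rev i).
Proof. by rewrite /E_arrow; case: insub => [j|]; [exact: pspan_path|exact: pspan0]. Qed.

Lemma S0_phom s : S0 s -> phom 2 s.
Proof.
have H rev rev' i i' : phom 2 (E_arrow n K rev i * E_arrow n K rev' i').
  by apply: (phomM (E_arrow_hom _ _) (E_arrow_hom _ _)).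
case; try exact: (H); try (by apply: pspanD; apply: (H)).
  by apply: pspanD; [apply: pspanD; [apply: pspanD|]|]; try exact: (H); exact: pspan0.
by move=> i _; apply: pspanD; apply: (H).
Qed.

(** The loops at 3 have length 2 and F has no monomial of degree below 2, so the deforming term has
    path length at least 4. *)
Lemma S0_deform s : S0 s -> exists2 r, pfil 3 r & SF (s + r).
Proof.
set fF := free_eval (E_arrow n K true 0 * E_arrow n K false 0)
    (E_arrow n K true 2 * E_arrow n K false 2) F.
have fil2 rev i : pfil 2 (E_arrow n K rev i * E_arrow n K (~~ rev) i).
  by apply: pspan_sub (phomM (E_arrow_hom _ _) (E_arrow_hom _ _)) => k /eqP->.
have fil1 rev i : pfil 1 (E_arrow n K rev i * E_arrow n K (~~ rev) i) by apply: pfil_le (fil2 _ _).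
have Hf : pfil 3 fF.
  rewrite /fF /free_eval big_seq; apply: big_ind => [|*|w /degF]; [exact: pspan0|exact: pspanD|].
  move=> dw; apply: pspanZ; rewrite fdegE in dw; apply: (@pfil_le _ _ _ 4) => //.
  case: (w : seq bool) dw => [|l1 [|l2 v]] // _; rewrite !big_cons mulrA.
  rewrite -[4%N]addn0 -[4%N]/(2 + 2)%N; apply: pfilM; last exact: pfil0.
  by apply: pfilM; [case: l1|case: l2]; apply: (fil2 true).
have old s' : E_relation fF s' -> exists2 r, pfil 3 r & SF (s' + r).
  by move=> Ss'; exists 0; [exact: pspan0|rewrite addr0; apply: def_rel].
case=> [||||i ri|].
- exact: old (E_rel0 _).
- exact: old (E_rel1 _).
- exact: old (E_rel2 _).
- by exists fF => //; rewrite addr0; apply: def_rel; exact: E_rel3.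
- exact: old (E_reli _ ri).
- exact: old (E_reln _).
Qed.

Theorem deformed_iso : exists phi : {linear deformed_preprojE n F -> preprojE n K},
    GRing.monoid_morphism phi /\ bijective phi.
Proof.
have [Phi [lead kill]] := deformation_hom.
(* Phi kills the relations and sends 1 to 1, which is not zero. *)
have nt : ~ in_ideal SF 1.
  move=> I1; have /eqP := in_ideal_ker kill I1.
  by rewrite rmorph1 oner_eq0.
have ker u : pi u = 0 -> in_ideal S0 u by move/npi_eq0.
have surj (b : B) : exists u, b = pi u by elim/npiP: b => u; exists u.
have SF_path (p : qpath Q) : qlen p = (E_max_length n).+1 -> SF (pe p) by exact: def_path.
have inj := Phi_inj ker S0_phom S0_deform SF_path lead kill.
have sur := Phi_surj surj pi_long lead.
pose f : {lrmorphism nzpres nt -> B} := nlift kill.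
exists (f : {linear _ -> _}); split; first exact: (@nlift_is_monoid_morphism _ _ _ nt _ _ kill).
have [w wE] := choice sur.
exists (fun b => npi nt (w b)) => [d|b].
  elim/npiP: d => u; apply/eqP; rewrite -subr_eq0 -rmorphB; apply/eqP/npi_eq0/inj.
  by rewrite rmorphB /= wE /f /= nliftE subrr.
by rewrite /= nliftE wE.
Qed.
End Isomorphism.

(** * The computations *)

Lemma path_check7 : nilp (path_words 7 (rulesE 7 arrows7 overlaps7) arrows7 (E_max_length 7)).
Proof. by vm_compute. Qed.

Lemma path_check8 : nilp (path_words 8 (rulesE 8 arrows8 overlaps8) arrows8 (E_max_length 8)).
Proof. by vm_compute. Qed.

(** As x and y stand for loops of length 2, the bound 9 is half of the maximal path length 16, plus
    one; for n = 8 it is 28/2 + 1 = 15. *)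
Lemma basis_check4 : basis_check (rulesR 4 overlaps4) 4 9.
Proof. by vm_compute. Qed.

Lemma basis_check5 : basis_check (rulesR 5 overlaps5) 5 15.
Proof. by vm_compute. Qed.

(** The value of [d0] is 4 here and 10 for N = 5. From these degrees up to 8 and 14 the commutators
    suffice once 2 is inverted. *)
Lemma kernel_check4 : kernel_checks (rulesR 4 overlaps4) 3 4 kernel_certs4.
Proof. by vm_compute. Qed.

Lemma kernel_check5 : kernel_checks (rulesR 5 overlaps5) 4 10 kernel_certs5.
Proof. by vm_compute. Qed.

Lemma commutator_check4 : commutator_checks (rulesR 4 overlaps4) 4 9 commutator_certs4.
Proof. by vm_compute. Qed.

Lemma commutator_check5 : commutator_checks (rulesR 5 overlaps5) 10 15 commutator_certs5.
Proof. by vm_compute. Qed.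

Unset Implicit Arguments.

Theorem theorem1p6 (n : nat) (K : closedFieldType)
  (hn : n = 7%N \/ n = 8%N) (hK : 2%N \notin [pchar K])
  (f : RE n K) (hf : admissible f)
  (F : freeAlg K) (hdeg : monomials_deg_ge2 F) (hF : RE_pi n F = f) :
  exists phi : {linear deformed_preprojE n F -> preprojE n K},
    GRing.monoid_morphism phi /\ bijective phi.
Proof.
have K2 : (2%:R : K) != 0 by move: hK; rewrite inE.
case: hf => _; rewrite -hF => admF.
case: hn => nE; subst n.
  exact: (deformed_iso (isT : 6 <= 7)%N (isT : perm_eq arrows7 (iota 0 12)) path_check7 hdeg
    (RE_conjugate (erefl : 7 - 3 = 4)%N basis_check4 kernel_check4 commutator_check4
      isT isT K2 hdeg admF)).
exact: (deformed_iso (isT : 6 <= 8)%N (isT : perm_eq arrows8 (iota 0 14)) path_check8 hdeg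
  (RE_conjugate (erefl : 8 - 3 = 5)%N basis_check5 kernel_check5 commutator_check5
    isT isT K2 hdeg admF)).
Qed.
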